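(* Let $u:\mathbb{R}^N\to\mathbb{R}$ be bounded and Borel, let $x\in\mathbb{R}^N$ and $r_x>0$. Assume that $u\in C^2(\bar B_{r_x}(x))$, that $p_x:=\nabla u(x)\neq 0$, and denote $C_x:=\frac12\|\nabla^2u\|_{L^\infty(B_{r_x}(x))}$. Assume that $u$ is uniformly continuous on $\mathbb{R}^N\setminus \bar B_{r_x}(x)$ with modulus of continuity $$\omega_u(a)=\sup\{|u(z)-u(\bar z)|:\ z,\bar z\in\mathbb{R}^N\setminus \bar B_{r_x}(x),\ |z-\bar z|\le a\}.$$ Then for every $\epsilon\in(0,r_x)$: $$\Big|\mathcal{A}_\epsilon u(x)-u(x)-\frac{s}{C(N,s)|A_{\mathbf p}|}\epsilon^{2s}\,\mathcal{L}_{s,\mathbf p}[u](x)\Big|\le \frac{s}{1-s}C_x\epsilon^2+\epsilon^{2s}\Big(4sC_x\frac{r_x^{2-2s}-\epsilon^{2-2s}}{1-s}\,m_\epsilon+\big(r_x^{-2s}+\frac{2s}{2s-1}r_x^{1-2s}\big)\,\omega_u(m_\epsilon)\Big),$$ where $$m_\epsilon=\max\Big\{\frac{16(N+\mathbf p-2)}{\mathbf p-1}\cdot\frac{C_x}{|p_x|}\cdot\frac{2s-1}{1-s}\cdot\frac{r_x^{2-2s}-\epsilon^{2-2s}}{\epsilon^{1-2s}-r_x^{1-2s}},\ \kappa_\epsilon\Big\},$$ $$\kappa_\epsilon=\sup\Big\{m:\ m\in[0,2]\ \text{ and }\ m^2\le\frac{N+\mathbf p-2}{\mathbf p-1}\c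dot\frac{8\omega_u(m)}{|p_x|}\cdot\frac{\frac{2s-1}{2s}r_x^{-2s}+r_x^{1-2s}}{\epsilon^{1-2s}-r_x^{1-2s}}\Big\}.$$
   Context: Fix an integer $N\ge 2$, $\mathbf p\in[2,\infty)$ and $s\in(\frac12,1)$. $B_r(x)$ is the open ball, $e_1,e_2,\dots$ the standard basis of $\mathbb{R}^N$, $\angle(y,z)$ the angle between vectors. Define the measure $\mathrm{d}\mu_s^N(z)=\frac{C(N,s)}{|z|^{N+2s}}\,\mathrm{d}z$ on Borel subsets of $\mathbb{R}^N$, with $C(N,s)=\frac{4^s s\,\Gamma(\frac N2+s)}{\pi^{N/2}\Gamma(1-s)}$. Let $\alpha_{\mathbf p}\in(0,\frac\pi2]$ be the angle such that, with $A_{\mathbf p}=\{|z|=1:\ \angle(e_1,z)<\alpha_{\mathbf p}\}$ and $\sigma$ the surface measure on the unit sphere, $\mathbf p-1=\int_{A_{\mathbf p}}\langle z,e_1\rangle^2\,\mathrm{d}\sigma(z)\big/\int_{A_{\mathbf p}}\langle z,e_2\rangle^2\,\mathrm{d}\sigma(z)$; $|A_{\mathbf p}|=\sigma(A_{\mathbf p})$. For $0\le a\le b\le\infty$ and $|y|=1$ let $T_{\mathbf p}^{a,b}(y)=\{z\in\mathbb{R}^N:\ \angle(y,z)<\alpha_{\mathbf p},\ a<|z|<b\}$. For bounded Borel $u$ and $\epsilon>0$ define $$\mathcal{A}_\epsilon u(x)=\frac12\Big(\sup_{|y|=1}⨍_{T_{\mathbf p}^{\epsilon,\infty}(y)}u(x+z)\,\mathrm{d}\mu_s^N(z)+\inf_{|y|=1}⨍_{T_{\mathbf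 p}^{\epsilon,\infty}(y)}u(x+z)\,\mathrm{d}\mu_s^N(z)\Big),$$ where $⨍_T f\,\mathrm{d}\mu_s^N=\frac{1}{\mu_s^N(T)}\int_T f\,\mathrm{d}\mu_s^N$. For $p_x=\nabla u(x)\ne0$ (with $u$ being $C^2$ near $x$) define $$\mathcal{L}_{s,\mathbf p}[u](x)=\int_{T_{\mathbf p}^{0,\infty}(p_x/|p_x|)}\big(u(x+z)+u(x-z)-2u(x)\big)\,\mathrm{d}\mu_s^N(z).$$ *)

(* Defs.v *)
From HB Require Import structures.
From mathcomp Require Import all_boot all_order all_algebra.
From mathcomp Require Import all_classical all_reals all_analysis measurable_realfun.

Set Implicit Arguments.
Unset Strict Implicit.
Unset Printing Implicit Defensive.

Import Order.TTheory GRing.Theory Num.Theory.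
Import numFieldNormedType.Exports.

Local Open Scope classical_set_scope.
Local Open Scope ring_scope.

(* Points of R^N are row vectors 'rV[R]_N.  The library norm and balls on
   'rV[R]_N are those of the sup norm; they are used here only through the
   topology, and the Euclidean norm and balls are defined separately below. *)

Section borel_matrix.
Context {R : realType} (m n : nat).

Definition borel_mx : set (set 'M[R]_(m, n)) := <<s @open 'M[R]_(m, n) >>.

HB.instance Definition _ :=
  @isMeasurable.Build default_measure_display 'M[R]_(m, n) borel_mx
    (@sigma_algebra0 _ setT _) (@sigma_algebraC _ _)
    (@sigma_algebra_bigcup _ setT _).

Lemma open_measurable_mx (A : set 'M[R]_(m, n)) : open A -> measurable A.
Proof. exact: sub_sigma_algebra. Qed.

End borel_matrix.

Section measurable_rV.
Context {R : realType}.

Lemma continuous_measurable_rV n (f : 'rV[R]_n -> R) :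
  continuous f -> measurable_fun setT f.
Proof.
move=> cf; apply: (measurability _ (RGenOpens.measurableE R)).
move=> _ [_ [a [b ->]] <-]; rewrite setTI; apply: open_measurable_mx.
by move/continuousP : cf; apply; exact: interval_open.
Qed.

Lemma measurable_coord n (i : 'I_n) :
  measurable_fun setT (fun v : 'rV[R]_n => v ord0 i).
Proof. by apply: continuous_measurable_rV; exact: coord_continuous. Qed.

Lemma open_bigcup_ball n (U : set 'rV[R]_n) : open U ->
  U = \bigcup_(q in [set q : 'rV[rat]_n * nat |
                       ball (map_mx ratr q.1 : 'rV[R]_n) q.2.+1%:R^-1 `<=` U])
        ball (map_mx ratr q.1 : 'rV[R]_n) q.2.+1%:R^-1.
Proof.
move=> oU; apply/seteqP; split=> [x Ux|x [q /= qU]]; last exact: qU.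
move: oU; rewrite openE => /(_ x Ux); rewrite /interior => /nbhs_ballP[e /= e0 eU].
have [k ke] : exists k, k.+1%:R^-1 < e / 2.
  exists (Num.truncn (e / 2)^-1).
  by rewrite invf_plt ?posrE ?divr_gt0// truncnS_gt.
have qx i : exists q : rat, ball (x ord0 i) k.+1%:R^-1 (ratr q : R).
  have := @rat_in_itvoo R (x ord0 i - k.+1%:R^-1) (x ord0 i + k.+1%:R^-1).
  rewrite ltrBlDr -addrA ltrDl addr_gt0// => /(_ isT)[q].
  rewrite in_itv/= => /andP[h1 h2]; exists q.
  by rewrite /ball/= ltr_distlC; apply/andP; split.
pose c : 'rV[rat]_n := \row_i sval (cid (qx i)).
have xc : ball (map_mx ratr c : 'rV[R]_n) k.+1%:R^-1 x.
  split => // i j; rewrite (ord1 i) !mxE; apply: ball_sym.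
  by case: cid.
exists (c, k) => //= y cy; apply: eU.
rewrite [e]splitr; apply: (@ball_triangle _ _ (map_mx ratr c : 'rV[R]_n)).
  by apply: ball_sym; apply: le_ball xc; exact: ltW.
by apply: le_ball cy; exact: ltW.
Qed.

Lemma measurable_fun_rV d (T : measurableType d) n (f : T -> 'rV[R]_n) :
  (forall i, measurable_fun setT (fun t => f t ord0 i)) -> measurable_fun setT f.
Proof.
move=> mf; apply: (@measurability _ _ _ _ _ _ (@open 'rV[R]_n)) => //.
move=> _ [U oU <-]; rewrite setTI (open_bigcup_ball oU) preimage_bigcup bigcup_mkcond.
apply: countable_bigcupT_measurable => // q; case: ifPn => // _.
rewrite (_ : _ @^-1` _ = \bigcap_(i in [set: 'I_n])
    (fun t => f t ord0 i) @^-1` ball (ratr (q.1 ord0 i) : R) q.2.+1%:R^-1).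
  apply: fin_bigcap_measurable => // i _; rewrite -[X in measurable X]setTI.
  by apply: mf => //; exact: measurable_ball.
apply/seteqP; split=> [t [_ h] i _|t h] /=.
  by have := h ord0 i; rewrite mxE.
by split => // i j; rewrite ord1 mxE; exact: h.
Qed.

End measurable_rV.

Section lebesgue_rV.
Context {R : realType}.
Local Open Scope ereal_scope.

Definition rVcons n (p : R * 'rV[R]_n) : 'rV[R]_n.+1 :=
  \row_i oapp (fun j => p.2 ord0 j) p.1 (unlift ord0 i).

Definition rVuncons n (v : 'rV[R]_n.+1) : R * 'rV[R]_n :=
  (v ord0 ord0, \row_j v ord0 (lift ord0 j)).

Lemma rVconsK n : cancel (@rVcons n) (@rVuncons n).
Proof.
move=> [a v]; rewrite /rVuncons /rVcons !mxE unlift_none/=; congr pair.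
by apply/rowP => j; rewrite !mxE liftK.
Qed.

Lemma rVunconsK n : cancel (@rVuncons n) (@rVcons n).
Proof.
by move=> v; apply/rowP => i; rewrite mxE; case: unliftP => [j|] ->/=; rewrite ?mxE.
Qed.

Lemma measurable_rVcons n : measurable_fun setT (@rVcons n).
Proof.
apply: measurable_fun_rV => i.
rewrite [X in measurable_fun _ X](_ : _ =
    fun p : R * 'rV[R]_n => oapp (fun j => p.2 ord0 j) p.1 (unlift ord0 i)).
  case: unliftP => [j|] _ /=; last exact: measurable_fst.
  exact: (measurableT_comp (measurable_coord j) measurable_snd).
by apply/funext => p; rewrite mxE.
Qed.

Lemma measurable_rVuncons n : measurable_fun setT (@rVuncons n).
Proof.
apply: measurable_fun_pair; first exact: measurable_coord.
apply: measurable_fun_rV => i.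
rewrite [X in measurable_fun _ X](_ : _ =
    fun v : 'rV[R]_n.+1 => v ord0 (lift ord0 i)); first exact: measurable_coord.
by apply/funext => p; rewrite mxE.
Qed.

Section step.
Variables (n : nat) (mu : {sigma_finite_measure set 'rV[R]_n -> \bar R}).

Definition lebesgue_rV_step : set 'rV[R]_n.+1 -> \bar R :=
  pushforward (@lebesgue_measure R \x mu) (@rVcons n).

Let mcons := @measurable_rVcons n.

Let step0 : lebesgue_rV_step set0 = 0. Proof. exact: measure0. Qed.

Let step_ge0 A : 0 <= lebesgue_rV_step A. Proof. exact: measure_ge0. Qed.

Let step_sigma_additive : semi_sigma_additive lebesgue_rV_step.
Proof. exact: measure_semi_sigma_additive. Qed.

HB.instance Definition _ := isMeasure.Build _ _ _ lebesgue_rV_step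
  step0 step_ge0 step_sigma_additive.

Let step_sigma_finite : sigma_finite setT lebesgue_rV_step.
Proof.
have /sigma_finiteP[F [FT ndF mF]] := sigma_finiteT (@lebesgue_measure R).
have /sigma_finiteP[G [GT ndG mG]] := sigma_finiteT mu.
exists (fun k => @rVuncons n @^-1` (F k `*` G k)).
  apply/seteqP; split => // v _.
  have [i _ Fi] : (\bigcup_i F i) (v ord0 ord0) by rewrite -FT.
  have [j _ Gj] : (\bigcup_i G i) (rVuncons v).2 by rewrite -GT.
  exists (maxn i j) => //; split => /=.
    by apply: (subsetPset _ _ (ndF _ _ (leq_maxl i j))).
  by apply: (subsetPset _ _ (ndG _ _ (leq_maxr i j))).
move=> k; have [mFk Fkoo] := mF k; have [mGk Gkoo] := mG k; split.
  rewrite -[X in measurable X]setTI; apply: measurable_rVuncons => //.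
  exact: measurableX.
rewrite /lebesgue_rV_step /pushforward -comp_preimage.
rewrite (_ : _ \o _ = id); last by apply/funext => p /=; rewrite rVconsK.
by rewrite preimage_id product_measure1E// lte_mul_pinfty// ge0_fin_numE.
Qed.

HB.instance Definition _ := Measure_isSigmaFinite.Build _ _ _ lebesgue_rV_step
  step_sigma_finite.

End step.

Fixpoint lebesgue_rV n : {sigma_finite_measure set 'rV[R]_n -> \bar R} :=
  match n with
  | 0%N => \d_(0%R : 'rV[R]_0)
  | m.+1 => lebesgue_rV_step (lebesgue_rV m)
  end.

End lebesgue_rV.
Arguments lebesgue_rV {R} n.

Section euclidean.
Context {R : realType} {N : nat}.
Implicit Types (x y z : 'rV[R]_N) (r : R).

Definition dotp y z : R := \sum_i y ord0 i * z ord0 i.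

Definition enorm z : R := Num.sqrt (dotp z z).

Definition angle y z : R := acos (dotp y z / (enorm y * enorm z)).

(* e_(k+1) in the usual numbering *)
Definition stdbasis (k : nat) : 'rV[R]_N := \row_(j < N) (j == k :> nat)%:R.

Definition eball x r : set 'rV[R]_N := [set y | enorm (y - x) < r].

Definition ecball x r : set 'rV[R]_N := [set y | enorm (y - x) <= r].

Lemma measurable_enorm_sub x : measurable_fun setT (fun y => enorm (y - x)).
Proof.
apply: (measurableT_comp (measurable_realfun.continuous_measurable_fun _)) => /=.
  exact: (@sqrt_continuous R).
apply: measurable_sum => i; have mi : measurable_fun setT
    (fun y : 'rV[R]_N => (y - x) ord0 i); last exact: measurable_funM.
rewrite [X in measurable_fun _ X](_ : _ =
    fun y : 'rV[R]_N => y ord0 i - x ord0 i); last first.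
  by apply/funext => y; rewrite !mxE.
by apply: measurable_funB => //; exact: measurable_coord.
Qed.

Lemma measurable_enorm : measurable_fun setT enorm.
Proof.
rewrite (_ : enorm = fun y => enorm (y - 0)); first exact: measurable_enorm_sub.
by apply/funext => y; rewrite subr0.
Qed.

Lemma measurable_eball x r : measurable (eball x r).
Proof.
rewrite -[X in measurable X]setTI.
rewrite (_ : eball x r = (fun y => enorm (y - x)) @^-1` `]-oo, r[); last first.
  by apply/seteqP; split => y /=; rewrite in_itv.
by apply: measurable_enorm_sub => //; exact: measurable_itv.
Qed.

End euclidean.

(* The surface measure of the unit sphere in polar coordinates: sigma(A) is N
   times the volume of the part of the unit ball lying over A.  It is a measure
   on R^N that is concentrated on the sphere. *)
Section surface_measure.
Context {R : realType} {N : nat}.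
Local Open Scope ereal_scope.

Let normalize (z : 'rV[R]_N) : 'rV[R]_N := (enorm z)^-1 *: z.

Definition punctured_ball : set 'rV[R]_N := [set z | (0 < enorm z < 1)%R].

Definition surface_measure (A : set 'rV[R]_N) : \bar R :=
  N%:R%:E * lebesgue_rV N
    ([set z | A ((enorm z)^-1 *: z)] `&` punctured_ball).

Let measurable_normalize : measurable_fun setT normalize.
Proof.
apply: measurable_fun_rV => i.
rewrite [X in measurable_fun _ X](_ : _ =
    fun z : 'rV[R]_N => (enorm z `^ (-1) * z ord0 i)%R); last first.
  by apply/funext => z; rewrite mxE powR_inv1 ?sqrtr_ge0.
apply: measurable_funM; last exact: measurable_coord.
exact: (measurableT_comp (@measurable_powR R _) measurable_enorm).
Qed.

Lemma measurable_punctured_ball : measurable punctured_ball.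
Proof.
rewrite -[X in measurable X]setTI.
rewrite (_ : punctured_ball = enorm @^-1` `]0%R, 1%R[); last first.
  by apply/seteqP; split => y /=; rewrite in_itv.
by apply: measurable_enorm => //; exact: measurable_itv.
Qed.

Let sigma0 :=
  pushforward (mrestr (lebesgue_rV N) measurable_punctured_ball) normalize.

Let surface0 : surface_measure set0 = 0.
Proof. exact: (@measure0 _ _ _ (mscale (N%:R%:nng : {nonneg R})%R sigma0)). Qed.

Let surface_ge0 A : 0 <= surface_measure A.
Proof. exact: (@measure_ge0 _ _ _ (mscale (N%:R%:nng : {nonneg R})%R sigma0)). Qed.

Let surface_sigma_additive : semi_sigma_additive surface_measure.
Proof.
exact: (@measure_semi_sigma_additive _ _ _ (mscale (N%:R%:nng : {nonneg R})%R sigma0)).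
Qed.

HB.instance Definition _ := isMeasure.Build _ _ _ surface_measure
  surface0 surface_ge0 surface_sigma_additive.

End surface_measure.

Section fractional_measure.
Context {R : realType}.

Definition Gamma (a : R) : R :=
  \int[lebesgue_measure]_(t in `]0, +oo[) (t `^ (a - 1) * expR (- t)).

Definition cNs (N : nat) (s : R) : R :=
  4 `^ s * s * Gamma (N%:R / 2 + s) / (pi `^ (N%:R / 2) * Gamma (1 - s)).

Variables (N : nat) (s : R).
Local Open Scope ereal_scope.

Let density (z : 'rV[R]_N) : \bar R :=
  (cNs N s / enorm z `^ (N%:R + 2 * s))%:E.

(* the positive part only serves to get a measure for every real s: it has no
   effect for 0 <= s, see mu_sE *)
Definition mu_s (A : set 'rV[R]_N) : \bar R :=
  \int[lebesgue_rV N]_(z in A)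
     maxe (cNs N s / enorm z `^ (N%:R + 2 * s))%:E 0.

Let measurable_density : measurable_fun setT (fun z => maxe (density z) 0).
Proof.
have md : measurable_fun setT density; last exact: measurable_maxe.
apply/measurable_EFinP.
rewrite [X in measurable_fun _ X](_ : _ = fun z : 'rV[R]_N =>
    (cNs N s * enorm z `^ (- (N%:R + 2 * s)))%R); last first.
  by apply/funext => z; rewrite powRN.
apply: measurable_funM => //.
exact: (measurableT_comp (@measurable_powR R _) measurable_enorm).
Qed.

Let mu_s0 : mu_s set0 = 0. Proof. exact: integral_set0. Qed.

Let mu_s_ge0 A : 0 <= mu_s A.
Proof. by apply: integral_ge0 => z _; rewrite le_max lexx orbT. Qed.

Let mu_s_sigma_additive : semi_sigma_additive mu_s.
Proof.
apply: semi_sigma_additive_nng_induced => //.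
by move=> z; rewrite le_max lexx orbT.
Qed.

HB.instance Definition _ := isMeasure.Build _ _ _ mu_s
  mu_s0 mu_s_ge0 mu_s_sigma_additive.

Lemma Gamma_ge0 (a : R) : (0 <= Gamma a)%R.
Proof.
by apply: Rintegral_ge0 => t _; rewrite mulr_ge0 ?powR_ge0 ?expR_ge0.
Qed.

Lemma mu_sE (A : set 'rV[R]_N) : (0 <= s)%R ->
  mu_s A =
  \int[lebesgue_rV N]_(z in A) (cNs N s / enorm z `^ (N%:R + 2 * s))%:E.
Proof.
move=> s0; apply: eq_integral => z _; apply/max_idPl; rewrite lee_fin.
by rewrite divr_ge0 ?powR_ge0// divr_ge0 ?mulr_ge0 ?powR_ge0 ?Gamma_ge0.
Qed.

End fractional_measure.

Section cone.
Context {R : realType} {N : nat}.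
Implicit Types (alpha p s : R) (x y : 'rV[R]_N).

Definition cap alpha : set 'rV[R]_N :=
  [set z | enorm z = 1 /\ angle (stdbasis 0) z < alpha].

(* angle y 0 is meaningless, but the condition on |z| excludes z = 0 *)
Definition cone alpha (a b : \bar R) y : set 'rV[R]_N :=
  [set z | angle y z < alpha /\ (a < (enorm z)%:E < b)%E].

Definition is_alpha p alpha : Prop :=
  0 < alpha <= pi / 2 /\
  p - 1 = (\int[@surface_measure R N]_(z in cap alpha) dotp z (stdbasis 0) ^+ 2)
        / (\int[@surface_measure R N]_(z in cap alpha) dotp z (stdbasis 1) ^+ 2).

Definition cap_area alpha : R := fine (surface_measure (cap alpha)).

End cone.

Section operators.
Context {R : realType} {N : nat}.
Implicit Types (alpha s eps r : R) (x y : 'rV[R]_N) (u : 'rV[R]_N -> R).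

Definition mean s (T : set 'rV[R]_N) (f : 'rV[R]_N -> R) : R :=
  (\int[@mu_s R N s]_(z in T) f z) / fine (mu_s s T).

Definition Aeps alpha s eps u x : R :=
  2^-1 * (sup [set mean s (cone alpha eps%:E +oo y) (fun z => u (x + z))
              | y in [set y | enorm y = 1]]
        + inf [set mean s (cone alpha eps%:E +oo y) (fun z => u (x + z))
              | y in [set y | enorm y = 1]]).

Definition gradient u x : 'rV[R]_N := \row_i 'D_(delta_mx 0 i) u x.

Definition hessian u x : 'M[R]_N :=
  \matrix_(i, j) 'D_(delta_mx 0 j) ('D_(delta_mx 0 i) u) x.

Definition Lsp alpha s u x : R :=
  let p := gradient u x in
  \int[@mu_s R N s]_(z in cone alpha 0 +oo ((enorm p)^-1 *: p))
     (u (x + z) + u (x - z) - 2 * u x).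

(* for the symmetric matrix hessian u x, the spectral norm *)
Definition opnorm (H : 'M[R]_N) : R :=
  sup [set enorm (v *m H) | v in [set v : 'rV[R]_N | enorm v = 1]].

(* u is C^2 on the closed ball: the derivatives of u up to order 2 exist in
   the open ball and extend continuously to the closed ball *)
Definition C2_ecball u x r : Prop :=
  [/\ {within ecball x r, continuous u},
      forall i : 'I_N, exists2 g : 'rV[R]_N -> R,
        {within ecball x r, continuous g} &
        forall y, eball x r y ->
          derivable u y (delta_mx 0 i) /\ 'D_(delta_mx 0 i) u y = g y
    & forall i j : 'I_N, exists2 g : 'rV[R]_N -> R,
        {within ecball x r, continuous g} &
        forall y, eball x r y ->
          derivable ('D_(delta_mx 0 i) u) y (delta_mx 0 j) /\
          'D_(delta_mx 0 j) ('D_(delta_mx 0 i) u) y = g y].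

Definition hessian_bound u x r : R :=
  2^-1 * fine ('N[mrestr (lebesgue_rV N) (measurable_eball x r)]_+oo
                 [EFin \o (fun y => opnorm (hessian u y))])%E.

Definition modulus u (D : set 'rV[R]_N) (a : R) : R :=
  sup [set t : R | exists z z',
        [/\ D z, D z', enorm (z - z') <= a & t = `|u z - u z'|]].

Definition kappa (p s : R) u x r eps : R :=
  sup [set m : R | 0 <= m <= 2 /\
    m ^+ 2 <= (N%:R + p - 2) / (p - 1)
            * (8 * modulus u (~` ecball x r) m / enorm (gradient u x))
            * (((2 * s - 1) / (2 * s) * r `^ (- 2 * s) + r `^ (1 - 2 * s))
               / (eps `^ (1 - 2 * s) - r `^ (1 - 2 * s)))].

Definition m_eps (p s : R) u x r eps : R :=
  Num.max
    (16 * (N%:R + p - 2) / (p - 1)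
       * (hessian_bound u x r / enorm (gradient u x))
       * ((2 * s - 1) / (1 - s))
       * ((r `^ (2 - 2 * s) - eps `^ (2 - 2 * s))
          / (eps `^ (1 - 2 * s) - r `^ (1 - 2 * s))))
    (kappa p s u x r eps).

End operators.

(* Main.v *)
Require Import Defs.
From HB Require Import structures.
From mathcomp Require Import all_boot all_order all_algebra fingroup perm.
From mathcomp Require Import all_classical all_reals all_analysis.
From mathcomp Require Import measurable_realfun ess_sup_inf ring lra.

(** Write [F y] for the mean of [u (x + z)] over the cone [T(y)] of directions
    around the unit vector [y] with [|z| > eps], let [q] be the gradient at
    [x] and [v = q / |q|].  In polar coordinates the cone has measure
    [C |A| eps^(-2s) / (2s)], so the prefactor of the operator L is half the
    inverse of that measure: the part of the integral over [|z| > eps]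
    contributes exactly [(F v + F (-v)) / 2 - u x], and for [|z| <= eps] the
    second difference is at most [2 C_x |z|^2], which integrates to the term in
    [eps^2] ([Lsp_expansion]).  It remains to compare [sup F] with [F v] and
    [inf F] with [F (-v)]; the second comparison is the first one for [- u].

    Let [R] be the rotation, in the plane of [v] and [y], that maps [v] to [y],
    and [d = |y - v|].  Since [R] preserves the measure, [F y - F v] is the mean
    over [T(v)] of [u (x + R z) - u (x + z)].  For [|z| < r] this increment is
    [<q, R z - z>] up to an error [2 C_x d |z|^2].  The integral of the linear
    part is [- |q| d^2 / 2] times the first moment of the cone, because the
    component of [R z] orthogonal to [v] averages to zero; and the first moment
    is bounded below by the second moment in the direction [v], which is known
    from the definition of the angle.  For [|z| > r] the points [x + z] and
    [x + R z] are joined by an arc outside the ball, which costs at most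
    [2 (1 + |z|)] times the modulus of continuity at [d]
    ([integral_cone_difference_le]).  So the difference [F y - F v] is a negative
    quadratic term in [d] plus a linear one plus one in the modulus.  Where it
    is positive, one of the last two terms dominates half of the first, and this
    is what the two entries of the maximum [m_eps] express: [d <= m_eps].
    Dropping the quadratic term and using monotonicity gives the claim
    ([mean_cone_le]).

    The integral calculus behind this rests on a uniqueness argument: two
    translation-invariant measures are proportional, by exchanging two integrals
    ([translation_invariant_unique]).  Comparing both on the unit ball shows
    that orthogonal maps preserve Lebesgue measure, comparing both on a cube
    gives its scaling, and the scaling gives polar coordinates: the volume of a
    sector truncated at radius [t] is proportional to [t^N]
    ([integral_sector_radial]). *)

Set Implicit Arguments.
Unset Strict Implicit.
Unset Printing Implicit Defensive.

Import Order.TTheory GRing.Theory Num.Theory.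
Import numFieldNormedType.Exports.

Local Open Scope classical_set_scope.
Local Open Scope ring_scope.

(** * Measures with a density *)

Section density.
Context d (T : measurableType d) (R : realType).
Variables (lam mu : {measure set T -> \bar R}) (h : T -> R).
Hypothesis mh : measurable_fun setT h.
Hypothesis h0 : forall x, 0 <= h x.
Hypothesis muE : forall A, measurable A -> mu A = (\int[lam]_(x in A) (h x)%:E)%E.
Local Open Scope ereal_scope.
Import HBNNSimple.

(** Simple functions reduce the identity to the measure of a set. *)
Lemma ge0_integral_density (D : set T) (f : T -> \bar R) : measurable D ->
  measurable_fun D f -> (forall x, D x -> 0 <= f x) ->
  \int[mu]_(x in D) f x = \int[lam]_(x in D) (f x * (h x)%:E).
Proof.
move=> mD mf f0.
have mhD : measurable_fun D (EFin \o h).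
  by apply/measurable_EFinP; exact: measurable_funTS.
pose f_ := nnsfun_approx mD mf.
transitivity (limn (fun n => \int[mu]_(x in D) (f_ n x)%:E)).
  rewrite -monotone_convergence//.
  - apply: eq_integral => y /[!inE] yD; apply/esym/cvg_lim => //.
    by apply: cvg_nnsfun_approx => // *; exact: f0.
  - by move=> n; apply/measurable_EFinP; exact: measurable_funTS.
  - by move=> n y _; rewrite lee_fin.
  - by move=> y _ m n mn; rewrite lee_fin; exact/lefP/nd_nnsfun_approx.
transitivity (limn (fun n => \int[lam]_(x in D) ((f_ n x)%:E * (h x)%:E))); last first.
  rewrite -monotone_convergence//.
  - apply: eq_integral => y /[!inE] yD; apply/cvg_lim => //.
    apply: cvgeZr => //; last first.
      by apply: cvg_nnsfun_approx => // *; exact: f0.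
  - move=> n; apply: emeasurable_funM => //.
    by apply/measurable_EFinP; exact: measurable_funTS.
  - by move=> n y _; rewrite mule_ge0// ?lee_fin.
  - move=> y _ m n mn; rewrite lee_wpmul2r ?lee_fin//.
    exact/lefP/nd_nnsfun_approx.
congr (limn _); apply/funext => n.
have mi r : measurable (f_ n @^-1` [set r]).
  by rewrite -[X in measurable X]setTI; exact: measurable_funP.
transitivity (\int[mu]_(x in D)
   (\sum_(y \in range (f_ n)) (y * \1_(f_ n @^-1` [set y]) x)%:E)).
  by apply: eq_integral => t tD; rewrite /= fimfunE -fsumEFin.
transitivity (\int[lam]_(x in D)
   (\sum_(y \in range (f_ n)) ((y * \1_(f_ n @^-1` [set y]) x)%:E * (h x)%:E))); last first.
  apply: eq_integral => t tD.
  rewrite fimfunE -fsumEFin// ge0_mule_fsuml// => y; exact: nnfun_muleindic_ge0.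
rewrite ge0_integral_fsum//; last 2 first.
  - by move=> y; apply/measurable_EFinP; exact/measurable_funTS/measurable_funM.
  - by move=> m y Ey; exact: nnfun_muleindic_ge0.
rewrite ge0_integral_fsum//; last 2 first.
  - move=> y; apply: emeasurable_funM => //.
    by apply/measurable_EFinP; exact/measurable_funTS/measurable_funM.
  - by move=> m y Ey; rewrite mule_ge0 ?lee_fin// -lee_fin nnfun_muleindic_ge0.
apply: eq_fsbigr => y /[!inE] -[t _ <-].
under eq_integral do rewrite EFinM.
rewrite ge0_integralZl//; last 2 first.
  - by apply/measurable_EFinP; exact/measurable_funTS.
  - by rewrite lee_fin.
under [RHS]eq_integral do rewrite EFinM -muleA.
rewrite ge0_integralZl//; last 3 first.
  - apply: emeasurable_funM => //.
    by apply/measurable_EFinP; exact/measurable_funTS.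
  - by move=> x _; rewrite mule_ge0// lee_fin.
  - by rewrite lee_fin.
congr (_ * _); rewrite integral_indic// muE; last exact: measurableI.
rewrite integral_mkcondl; apply: eq_integral => x _.
by rewrite epatch_indic muleC.
Qed.
End density.

Section density_measure.
Context d (T : measurableType d) (R : realType).
Variables (lam : {measure set T -> \bar R}) (h : T -> R).
Hypothesis mh : measurable_fun setT h.
Hypothesis h0 : forall x, 0 <= h x.
Local Open Scope ereal_scope.

Definition density_measure (A : set T) : \bar R := \int[lam]_(x in A) (h x)%:E.

Let density0 : density_measure set0 = 0. Proof. exact: integral_set0. Qed.

Let density_ge0 A : 0 <= density_measure A.
Proof. by apply: integral_ge0 => z _; rewrite lee_fin. Qed.

Let density_sigma_additive : semi_sigma_additive density_measure.
Proof.
apply: semi_sigma_additive_nng_induced => [|x]; last by rewrite lee_fin.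
exact/measurable_EFinP.
Qed.

HB.instance Definition _ := isMeasure.Build _ _ _ density_measure
  density0 density_ge0 density_sigma_additive.

Lemma integral_density_measure (D : set T) (f : T -> \bar R) : measurable D ->
  measurable_fun D f -> (forall x, D x -> 0 <= f x) ->
  \int[density_measure]_(x in D) f x = \int[lam]_(x in D) (f x * (h x)%:E).
Proof. by move=> mD mf f0; apply: ge0_integral_density. Qed.

End density_measure.

(** * Translation-invariant measures on R^N *)

Section measurable_linear.
Context {R : realType} {N : nat}.

Lemma measurable_rVD d (T : measurableType d) (f g : T -> 'rV[R]_N) :
  measurable_fun setT f -> measurable_fun setT g ->
  measurable_fun setT (fun t => f t + g t).
Proof.
move=> mf mg; apply: measurable_fun_rV => i.
rewrite [X in measurable_fun _ X](_ : _ =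
    fun t => f t ord0 i + g t ord0 i); last by apply/funext => t; rewrite mxE.
apply: measurable_funD.
  exact: (measurableT_comp (measurable_coord i) mf).
exact: (measurableT_comp (measurable_coord i) mg).
Qed.

Lemma measurable_rVmulmx m (M : 'M[R]_(N, m)) :
  measurable_fun setT (fun z : 'rV[R]_N => z *m M).
Proof.
apply: measurable_fun_rV => i.
rewrite [X in measurable_fun _ X](_ : _ = fun z : 'rV[R]_N =>
    \sum_(j < N) z ord0 j * M j i); last by apply/funext => t; rewrite mxE.
apply: measurable_sum => j; apply: measurable_funM => //.
exact: measurable_coord.
Qed.

Lemma measurable_rVN : measurable_fun setT (fun z : 'rV[R]_N => - z).
Proof.
rewrite [X in measurable_fun _ X](_ : _ = fun z : 'rV[R]_N => z *m (-1)%:M).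
  exact: measurable_rVmulmx.
by apply/funext => z; rewrite mul_mx_scalar scaleN1r.
Qed.

End measurable_linear.

Lemma measurable_preimage d d' (T : measurableType d) (T' : measurableType d')
  (f : T -> T') (A : set T') :
  measurable_fun setT f -> measurable A -> measurable (f @^-1` A).
Proof. by move=> mf mA; rewrite -[X in measurable X]setTI; exact: mf. Qed.

Section translation.
Context {R : realType}.
Local Open Scope ereal_scope.

Definition translation_invariant N (nu : set 'rV[R]_N -> \bar R) :=
  forall (a : 'rV[R]_N) (A : set 'rV[R]_N), measurable A ->
  nu ((fun z => z + a)%R @^-1` A) = nu A.

Lemma lebesgue_measureD (a : R) (A : set R) : measurable A ->
  lebesgue_measure ((fun t => t + a)%R @^-1` A) = lebesgue_measure A.
Proof.
move=> mA.
have mD : measurable_fun setT (fun t : R => t + a)%R by exact: measurable_funD.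
transitivity (pushforward lebesgue_measure
   ((fun t : R => t + a)%R : _ -> measurableTypeR R) A) => //.
apply/esym; apply: (@lebesgue_measure_unique _ (pushforward lebesgue_measure
   ((fun t : R => t + a)%R : _ -> measurableTypeR R))) => //= _ [[b c]] _ <-.
rewrite /pushforward (_ : _ @^-1` _ = `]b - a, c - a]%classic)%R; last first.
  by apply/seteqP; split => t /=; rewrite !in_itv/= ltrBlDr lerBrDr.
rewrite !lebesgue_measure_itv/= !lte_fin ltrD2r.
by case: ifP => // _; rewrite -!EFinB; congr _%:E; ring.
Qed.

Lemma translation_invariant_lebesgue_rV N :
  translation_invariant (@lebesgue_rV R N).
Proof.
elim: N => [|N IH] a A mA.
  by congr (_ _); apply/seteqP; split=> z /=; rewrite (thinmx0 (z + a)%R) (thinmx0 z).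
rewrite /= /lebesgue_rV_step /pushforward.
have mrA := measurable_preimage (@measurable_rVcons R N) mA.
set a' := rVuncons a.
have mt : measurable_fun setT (fun p : R * 'rV[R]_N => (p.1 + a'.1, p.2 + a'.2)%R).
  apply: measurable_fun_pair; first exact: measurable_funD.
  by apply: measurable_rVD => //; exact: measurable_snd.
transitivity (pushforward (@lebesgue_measure R \x @lebesgue_rV R N)
  (fun p : R * 'rV[R]_N => (p.1 + a'.1, p.2 + a'.2)%R) (@rVcons R N @^-1` A)).
  rewrite /pushforward -comp_preimage; congr (_ _); apply/seteqP.
  by split=> p /=; rewrite (_ : rVcons (_, _) = rVcons p + a)%R //;
    apply/rowP => i; rewrite !mxE; case: unliftP => [j|] -> /=; rewrite ?mxE.
apply/esym.
pose sh (p : measurableTypeR R * 'rV[R]_N) : measurableTypeR R * 'rV[R]_N :=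
  (p.1 + a'.1, p.2 + a'.2)%R.
apply: (@product_measure_unique _ _ _ _ _ (@lebesgue_measure R) (@lebesgue_rV R N)
  (pushforward (@lebesgue_measure R \x @lebesgue_rV R N) sh)) => // B C mB mC.
rewrite /= /pushforward.
transitivity ((lebesgue_measure \x @lebesgue_rV R N)
   (((fun t => t + a'.1)%R @^-1` B) `*` ((fun z => z + a'.2)%R @^-1` C))) => //.
rewrite product_measure1E.
- by congr (_ * _); [exact: lebesgue_measureD|exact: IH].
- by apply: (@measurable_preimage _ _ (measurableTypeR R) (measurableTypeR R)) mB;
    exact: (@measurable_funD _ _ R).
- apply: measurable_preimage mC; exact: measurable_rVD.
Qed.

(** The measure of the set of pairs [(x, y)] with [x] in [A] and [x + y] in [B]
    is [nu A * lam B] when the slices at fixed [x] are taken.  At fixed [y], translating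
    the first variable by [y] turns the conditions into [x - y] in [A] and [x]
    in [B], and the slices at fixed [x] now give [nu B * lam (- A)]. *)
Lemma translation_invariant_unique N
    (nu lam : {sigma_finite_measure set 'rV[R]_N -> \bar R}) (A B : set 'rV[R]_N) :
  translation_invariant nu -> translation_invariant lam ->
  measurable A -> measurable B ->
  nu A * lam B = nu B * lam (-%R @^-1` A).
Proof.
move=> nuT lamT mA mB.
pose T := ('rV[R]_N * 'rV[R]_N)%type.
have mfst : measurable_fun setT (@fst 'rV[R]_N 'rV[R]_N) := measurable_fst.
have msnd : measurable_fun setT (@snd 'rV[R]_N 'rV[R]_N) := measurable_snd.
have madd : measurable_fun setT (fun p : T => p.1 + p.2)%R by exact: measurable_rVD.
have msub : measurable_fun setT (fun p : T => p.1 - p.2)%R.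
  by apply: measurable_rVD => //; exact: (measurableT_comp measurable_rVN).
pose E : set T := (fst @^-1` A) `&` ((fun p : T => p.1 + p.2)%R @^-1` B).
pose E' : set T := ((fun p : T => p.1 - p.2)%R @^-1` A) `&` (fst @^-1` B).
have mE : measurable E by apply: measurableI; exact: measurable_preimage.
have mE' : measurable E' by apply: measurableI; exact: measurable_preimage.
have prodE (X : set T) : measurable X -> (nu \x lam) X = (nu \x^ lam) X.
  apply: product_measure_unique => C D mC mD.
  by rewrite /= product_measure2E.
have : (nu \x lam) E = (nu \x lam) E'.
  rewrite !prodE//; apply: eq_integral => y _ /=.
  rewrite -(nuT y (ysection E' y)); last exact: measurable_ysection.
  congr (nu _); apply/seteqP; split => x; rewrite /ysection /= !inE /E /E' /=.
    by rewrite addrK.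
  by rewrite addrK.
have -> : (nu \x lam) E = nu A * lam B.
  rewrite /product_measure1.
  transitivity (\int[nu]_(x in A) cst (lam B) x); last first.
    by rewrite integral_cst// muleC.
  rewrite [RHS]integral_mkcond; apply: eq_integral => x _ /=.
  rewrite patchE; case: ifPn => [/set_mem|/negP] Ax.
    rewrite /= -(lamT x B)//; congr (lam _); apply/seteqP.
    by split=> y; rewrite /xsection /= !inE /E /= addrC //; case.
  rewrite (_ : xsection _ _ = set0) ?measure0//.
  by rewrite -subset0 => y; rewrite /xsection /= inE => -[/mem_set].
move=> ->; rewrite /product_measure1.
transitivity (\int[nu]_(x in B) cst (lam (-%R @^-1` A)) x); last first.
  by rewrite integral_cst// muleC.
rewrite [RHS]integral_mkcond; apply: eq_integral => x _ /=.
rewrite patchE; case: ifPn => [/set_mem|/negP] Bx.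
  rewrite /= -(lamT (- x)%R (-%R @^-1` A))//; last by apply: measurable_preimage mA; exact: measurable_rVN.
  congr (lam _); apply/seteqP.
  by split=> y; rewrite /xsection /= !inE /E' /= opprD opprK addrC //; case.
rewrite (_ : xsection _ _ = set0) ?measure0//.
by rewrite -subset0 => y; rewrite /xsection /= inE => -[_ /mem_set].
Qed.

End translation.

(** * Euclidean geometry *)

Section dot_product.
Context {R : realType} {N : nat}.
Implicit Types (x y z : 'rV[R]_N) (c : R).

Lemma dotpC y z : dotp y z = dotp z y.
Proof. by apply: eq_bigr => i _; rewrite mulrC. Qed.

Lemma dotpDl x y z : dotp (x + y) z = dotp x z + dotp y z.
Proof. by rewrite -big_split; apply: eq_bigr => i _; rewrite mxE mulrDl. Qed.

Lemma dotpZl c y z : dotp (c *: y) z = c * dotp y z.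
Proof. by rewrite mulr_sumr; apply: eq_bigr => i _; rewrite mxE mulrA. Qed.

Lemma dotpDr x y z : dotp z (x + y) = dotp z x + dotp z y.
Proof. by rewrite dotpC dotpDl !(dotpC z). Qed.

Lemma dotpZr c y z : dotp z (c *: y) = c * dotp z y.
Proof. by rewrite dotpC dotpZl (dotpC z). Qed.

Lemma dotpNl y z : dotp (- y) z = - dotp y z.
Proof. by rewrite -scaleN1r dotpZl mulN1r. Qed.

Lemma dotpNr y z : dotp z (- y) = - dotp z y.
Proof. by rewrite dotpC dotpNl dotpC. Qed.

Definition dotpE := (dotpDl, dotpDr, dotpNl, dotpNr, dotpZl, dotpZr).

Lemma dotpzz_ge0 z : 0 <= dotp z z.
Proof. by apply: sumr_ge0 => i _; rewrite -expr2 sqr_ge0. Qed.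

Lemma enorm_ge0 z : 0 <= enorm z.
Proof. exact: sqrtr_ge0. Qed.

Lemma enorm_sqr z : enorm z ^+ 2 = dotp z z.
Proof. by rewrite sqr_sqrtr// dotpzz_ge0. Qed.

Lemma enormN z : enorm (- z) = enorm z.
Proof. by rewrite /enorm !dotpE opprK. Qed.

Lemma enormZ c z : enorm (c *: z) = `|c| * enorm z.
Proof. by rewrite /enorm !dotpE mulrA -expr2 sqrtrM ?sqr_ge0// sqrtr_sqr. Qed.

Lemma enorm0 : enorm (0 : 'rV[R]_N) = 0.
Proof. by rewrite -(scale0r 0) enormZ normr0 mul0r. Qed.

Lemma coord_le_enorm z i : `|z ord0 i| <= enorm z.
Proof.
rewrite -sqrtr_sqr ler_wsqrtr// /dotp (bigD1 i)//= -expr2 lerDl.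
by apply: sumr_ge0 => j _; rewrite -expr2 sqr_ge0.
Qed.

Lemma enorm_eq0 z : (enorm z == 0) = (z == 0).
Proof.
apply/eqP/eqP => [z0|->]; last exact: enorm0.
apply/rowP => i; apply/eqP; rewrite mxE -normr_le0 -z0.
exact: coord_le_enorm.
Qed.

Lemma enorm_gt0 z : (0 < enorm z) = (z != 0).
Proof. by rewrite lt_neqAle enorm_ge0 andbT eq_sym enorm_eq0. Qed.

(** The square of [|y|^2 z - <y, z> y] is nonnegative. *)
Lemma dotp_le_enorm y z : `|dotp y z| <= enorm y * enorm z.
Proof.
rewrite -ler_sqr ?nnegrE ?mulr_ge0 ?enorm_ge0// exprMn !enorm_sqr real_normK ?num_real//.
have := dotpzz_ge0 (dotp y y *: z - dotp y z *: y).
rewrite !dotpE (dotpC z y) => h.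
have [y0|y0] := eqVneq (dotp y y) 0.
  have /eqP : enorm y = 0 by rewrite /enorm y0 sqrtr0.
  rewrite enorm_eq0 => /eqP yE.
  rewrite [X in X ^+ 2](_ : _ = 0) ?expr0n ?mulr_ge0 ?dotpzz_ge0//.
  by rewrite yE /dotp big1// => i _; rewrite mxE mul0r.
have y1 : 0 < dotp y y by rewrite lt_neqAle eq_sym y0 dotpzz_ge0.
rewrite -subr_ge0 -(pmulr_rge0 _ y1); move: h; congr (0 <= _); ring.
Qed.

Lemma dotp_le y z : dotp y z <= enorm y * enorm z.
Proof. exact: le_trans (ler_norm _) (dotp_le_enorm _ _). Qed.

Lemma enormD y z : enorm (y + z) <= enorm y + enorm z.
Proof.
rewrite -ler_sqr ?nnegrE ?addr_ge0 ?enorm_ge0// sqrrD !enorm_sqr !dotpE (dotpC z y).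
by have := dotp_le y z; lra.
Qed.

Lemma enorm_le_sum z : enorm z <= \sum_i `|z ord0 i|.
Proof.
have s0 : 0 <= \sum_i `|z ord0 i| by exact: sumr_ge0.
rewrite -ler_sqr ?nnegrE ?enorm_ge0// enorm_sqr expr2 mulr_suml.
apply: ler_sum => i _.
rewrite -expr2 -real_normK ?num_real// expr2 ler_wpM2l// (bigD1 i)//= lerDl.
exact: sumr_ge0.
Qed.

Lemma dotp_stdbasis z (i : 'I_N) : dotp z (stdbasis i) = z ord0 i.
Proof.
rewrite /dotp (bigD1 i)//= mxE eqxx mulr1 big1 ?addr0// => j ji.
by rewrite mxE val_eqE (negbTE ji) mulr0.
Qed.

(** The topology is that of the sup norm, whence the detour through coordinates. *)
Lemma continuous_enorm : continuous (@enorm R N).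
Proof.
suff dc : continuous (fun z : 'rV[R]_N => dotp z z).
  by move=> z; apply: continuous_comp; [exact: dc|exact: sqrt_continuous].
rewrite /dotp; elim: (index_enum _) => [|i s IH] z.
  by rewrite [X in continuous_at _ X](_ : _ = cst 0); [exact: cst_continuous|
     apply/funext => y; rewrite big_nil].
rewrite [X in continuous_at _ X](_ : _ = fun y => y ord0 i * y ord0 i +
    \sum_(j <- s) y ord0 j * y ord0 j); last by apply/funext => y; rewrite big_cons.
have ci : continuous (fun y : 'rV[R]_N => y ord0 i) by exact: coord_continuous.
have FF : Filter (nbhs (z : 'rV[R]_N)) by exact: nbhs_filter.
by apply: cvgD; [exact: (cvgM (ci z) (ci z))|exact: IH].
Qed.

Definition orthogonal (M : 'M[R]_N) := M *m M^T = 1%:M.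

Lemma dotp_mx y z : dotp y z = (y *m z^T) ord0 ord0.
Proof. by rewrite mxE; apply: eq_bigr => i _; rewrite mxE. Qed.

Lemma dotp_orthogonal M y z : orthogonal M -> dotp (y *m M) (z *m M) = dotp y z.
Proof.
by move=> oM; rewrite !dotp_mx trmx_mul mulmxA -(mulmxA y) oM mulmx1.
Qed.

Lemma enorm_orthogonal M z : orthogonal M -> enorm (z *m M) = enorm z.
Proof. by move=> oM; rewrite /enorm dotp_orthogonal. Qed.

Lemma orthogonal_unit M : orthogonal M -> M \in unitmx.
Proof. by move/mulmx1_unit => []. Qed.

End dot_product.

(** * Linear images of Lebesgue measure *)

Section linear_image.
Context {R : realType} {N : nat}.
Local Open Scope ereal_scope.

Section image.
Variables (M : 'M[R]_N) (uM : M \in unitmx).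

Definition lebesgue_rV_mx : set 'rV[R]_N -> \bar R :=
  pushforward (lebesgue_rV N) (fun z : 'rV[R]_N => z *m M).

Let mM := measurable_rVmulmx M.

Let image0 : lebesgue_rV_mx set0 = 0. Proof. exact: measure0. Qed.

Let image_ge0 A : 0 <= lebesgue_rV_mx A. Proof. exact: measure_ge0. Qed.

Let image_sigma_additive : semi_sigma_additive lebesgue_rV_mx.
Proof. exact: measure_semi_sigma_additive. Qed.

HB.instance Definition _ := isMeasure.Build _ _ _ lebesgue_rV_mx
  image0 image_ge0 image_sigma_additive.

Let image_sigma_finite : sigma_finite setT lebesgue_rV_mx.
Proof.
have /sigma_finiteP[F [FT ndF mF]] := sigma_finiteT (@lebesgue_rV R N).
exists (fun k => (fun z : 'rV[R]_N => z *m invmx M) @^-1` F k).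
  apply/seteqP; split => // v _.
  have [i _ Fi] : (\bigcup_i F i) (v *m invmx M) by rewrite -FT.
  by exists i.
move=> k; have [mFk Fkoo] := mF k; split.
  exact: (measurable_preimage (measurable_rVmulmx _)).
rewrite /lebesgue_rV_mx /pushforward -comp_preimage.
rewrite (_ : _ \o _ = id); last by apply/funext => p /=; rewrite mulmxK.
by rewrite preimage_id.
Qed.

HB.instance Definition _ := Measure_isSigmaFinite.Build _ _ _ lebesgue_rV_mx
  image_sigma_finite.

Lemma translation_invariant_mx : translation_invariant lebesgue_rV_mx.
Proof.
move=> a A mA; rewrite /lebesgue_rV_mx /pushforward.
rewrite -[RHS](@translation_invariant_lebesgue_rV R N (a *m invmx M)); last first.
  exact: (measurable_preimage (measurable_rVmulmx _)).
by congr (_ _); apply/seteqP; split=> z /=; rewrite mulmxDl mulmxKV.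
Qed.

(** Two sets on which both measures are known determine the ratio of the image
    of Lebesgue measure to Lebesgue measure. *)
Lemma lebesgue_rV_mx_proportional A B : measurable A -> measurable B ->
  lebesgue_rV_mx A * lebesgue_rV N B = lebesgue_rV_mx B * lebesgue_rV N (-%R @^-1` A).
Proof.
apply: translation_invariant_unique; first exact: translation_invariant_mx.
exact: translation_invariant_lebesgue_rV.
Qed.

End image.

Definition cube (t : R) : set 'rV[R]_N := [set z | forall i, (`|z ord0 i| < t)%R].

Lemma cubeN t : -%R @^-1` cube t = cube t.
Proof.
by apply/seteqP; split=> z /= h i; have := h i; rewrite mxE normrN.
Qed.

End linear_image.

Lemma lebesgue_rV_cube (R : realType) N (t : R) : 0 < t ->
  measurable (@cube R N t) /\ lebesgue_rV N (@cube R N t) = ((2 * t) ^+ N)%:E.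
Proof.
move=> t0; elim: N => [|N [mc IH]].
  have -> : @cube R 0 t = setT by apply/seteqP; split=> // z _ [].
  by split => //; rewrite /= diracT.
have mcS : measurable (@cube R N.+1 t).
  rewrite (_ : cube t = \bigcap_(i in [set: 'I_N.+1])
     ((fun v : 'rV[R]_N.+1 => v ord0 i) @^-1` `]-t, t[)); last first.
    apply/seteqP; split=> [z h i _ /=|z h i].
      by rewrite in_itv/= -ltr_norml.
    by have := h i I; rewrite /= in_itv/= -ltr_norml.
  apply: fin_bigcap_measurable => // i _.
  by apply: (measurable_preimage (measurable_coord i)); exact: measurable_itv.
split => //.
rewrite /= /lebesgue_rV_step /pushforward.
rewrite (_ : _ @^-1` _ = `]-t, t[ `*` @cube R N t); last first.
  apply/seteqP; split => [[a v] h|[a v] /= [h1 h2] i]; rewrite /=.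
    split; first by have := h ord0; rewrite /= mxE unlift_none/= in_itv/= -ltr_norml.
    by move=> i; have := h (lift ord0 i); rewrite mxE liftK.
  by rewrite mxE; case: unliftP => [j|] _ /=; [exact: h2|move: h1; rewrite in_itv/= -ltr_norml].
rewrite product_measure1E//.
rewrite [X in (_ * X)%E]IH [X in (X * _)%E]lebesgue_measure_itv/= lte_fin gtrN//.
by rewrite -EFinB -EFinM exprS; congr (_ * _)%:E; ring.
Qed.

Lemma pmuleI (R : realType) (a x y : \bar R) : (0 < a < +oo)%E ->
  (a * x = a * y -> x = y)%E.
Proof.
case: a => [a| |] //; last by rewrite ltxx andbF.
rewrite lte_fin => /andP[a0 _] /(congr1 (fun z => a^-1%:E * z)%E).
by rewrite !muleA -EFinM mulVf ?gt_eqF// !mul1e.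
Qed.

Section invariance.
Context {R : realType} {N : nat}.
Local Open Scope ereal_scope.

(** The unit ball lies between the cubes of half-sides [1/N] and [1]. *)
Lemma eball_unit_bounds : (0 < N)%N ->
  0 < lebesgue_rV N (@eball R N 0 1) < +oo.
Proof.
move=> N0; have mb := @measurable_eball R N 0 1.
have n1 : (0 < N%:R^-1 :> R)%R by rewrite invr_gt0 ltr0n.
have [mc cE] := @lebesgue_rV_cube R N _ n1.
have [mc1 cE1] := @lebesgue_rV_cube R N _ (@ltr01 R).
apply/andP; split.
  apply: (@lt_le_trans _ _ (lebesgue_rV N (@cube R N N%:R^-1))).
    by rewrite cE lte_fin exprn_gt0// mulr_gt0.
  apply: le_measure; rewrite ?inE// => z h; rewrite /eball/= subr0.
  apply: le_lt_trans (enorm_le_sum z) _.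
  have -> : (1 = \sum_(i < N) N%:R^-1 :> R)%R.
    by rewrite sumr_const card_ord -[RHS]mulr_natr mulVf// pnatr_eq0 -lt0n.
  by apply: ltr_sum => //; apply/hasP; exists (Ordinal N0) => //; rewrite mem_index_enum.
apply: (@le_lt_trans _ _ (lebesgue_rV N (@cube R N 1))); last by rewrite cE1 ltry.
apply: le_measure; rewrite ?inE// => z; rewrite /eball/= subr0 => h i.
exact: le_lt_trans (coord_le_enorm _ _) h.
Qed.

(** The unit ball is invariant under orthogonal maps and has positive finite
    measure, so that the proportionality factor is one. *)
Lemma lebesgue_rV_orthogonal (M : 'M[R]_N) A : orthogonal M -> measurable A ->
  lebesgue_rV N ((fun z => z *m M) @^-1` A) = lebesgue_rV N A.
Proof.
move=> oM mA; have uM := orthogonal_unit oM.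
have [N0|N0] := posnP N.
  move: M oM uM A mA; rewrite N0 => M _ _ A _.
  congr (_ _); apply/seteqP; split => z /=; by rewrite (thinmx0 (z *m M)) (thinmx0 z).
have := lebesgue_rV_mx_proportional uM (@measurable_eball R N 0 1) mA.
have -> : -%R @^-1` (@eball R N 0 1) = @eball R N 0 1.
  by apply/seteqP; split=> z /=; rewrite /eball/= !subr0 enormN.
have -> : lebesgue_rV_mx M (eball 0 1) = lebesgue_rV N (@eball R N 0 1).
  rewrite /lebesgue_rV_mx /pushforward; congr (_ _); apply/seteqP.
  by split=> z /=; rewrite /eball/= !subr0 enorm_orthogonal.
have /andP[b0 boo] := eball_unit_bounds N0.
by rewrite [RHS]muleC => /pmuleI -> //; rewrite b0.
Qed.

(** The proportionality factor is read off on the cube of half-side one. *)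
Lemma lebesgue_rV_scale (c : R) (A : set 'rV[R]_N) : (0 < c)%R -> measurable A ->
  lebesgue_rV N ((fun z : 'rV[R]_N => c *: z)%R @^-1` A) = ((c ^- N)%:E * lebesgue_rV N A).
Proof.
move=> c0 mA.
have uM : (c%:M : 'M[R]_N) \in unitmx.
  by rewrite unitmxE det_scalar unitrX// unitfE gt_eqF.
have [mc cE] := @lebesgue_rV_cube R N _ (@ltr01 R).
have c0' : (0 < c^-1)%R by rewrite invr_gt0.
have [mc' cE'] := @lebesgue_rV_cube R N _ c0'.
have := lebesgue_rV_mx_proportional uM mc mA; rewrite cubeN cE.
have imE (B : set 'rV[R]_N) : lebesgue_rV_mx c%:M B = lebesgue_rV N ((fun z : 'rV[R]_N => c *: z)%R @^-1` B).
  by rewrite /lebesgue_rV_mx /pushforward; congr (_ _); apply/seteqP;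
    split=> z /=; rewrite mul_mx_scalar.
rewrite !imE (_ : _ @^-1` cube 1 = cube c^-1)%R; last first.
  by apply/seteqP; split=> z h i /=; have := h i;
    rewrite /= mxE normrM (gtr0_norm c0) -ltr_pdivlMl// mulr1.
rewrite cE' mulr1 exprMn EFinM -muleA [RHS]muleC => /pmuleI.
by rewrite exprVn => <- //; rewrite lte_fin exprn_gt0//= ltry.
Qed.

End invariance.

(** * Integrals of powers and positivity of C(N, s) *)

Section power_integrals.
Context {R : realType}.
Implicit Types (a b q g : R).
Local Notation leb := (@lebesgue_measure R).

Lemma integral_powR a b q : q != 0 -> 0 < a -> a <= b ->
  (\int[leb]_(t in `]a, b]) (t `^ (q - 1))%:E = ((b `^ q - a `^ q) / q)%:E)%E.
Proof.
move=> q0 a0; rewrite le_eqVlt => /predU1P[<-|ab].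
  by rewrite subrr mul0r set_itvoc0 integral_set0.
have cpow (x : R) : 0 < x -> {for x, continuous (fun t : R => t `^ (q - 1))}.
  move=> x0; apply: differentiable_continuous; apply/derivable1_diffP.
  by apply: derivable_powR; rewrite in_itv/= x0.
have dF (x : R) : 0 < x -> is_derive x 1 (fun t : R => q^-1 * t `^ q) (x `^ (q - 1)).
  move=> x0; have := is_derive1_powR q x0 => dp.
  by apply: is_derive_eq; rewrite /GRing.scale/= mulrA mulVf// mul1r.
have cF (x : R) : 0 < x -> {for x, continuous (fun t : R => q^-1 * t `^ q)}.
  move=> x0; apply: differentiable_continuous; apply/derivable1_diffP.
  by have [] := dF x x0.
rewrite integral_itv_obnd_cbnd; last first.
  apply/measurable_EFinP; apply: measurable_funTS; exact: measurable_powR.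
rewrite (@continuous_FTC2 _ _ (fun t => q^-1 * t `^ q))//.
- by rewrite -EFinB -mulrBr mulrC.
- apply: continuous_in_subspaceT => x; rewrite inE/= in_itv/= => /andP[ax _].
  exact/cpow/(lt_le_trans a0).
- split.
  + move=> x; rewrite in_itv/= => /andP[ax _].
    by have [] := dF x (lt_trans a0 ax).
  + exact/cvg_at_right_filter/cF.
  + exact/cvg_at_left_filter/cF/(lt_trans a0).
- move=> x; rewrite in_itv/= => /andP[ax _].
  by have [_] := dF x (lt_trans a0 ax); rewrite derive1E.
Qed.

Lemma cvg_harmonic_powR g : 0 < g -> (n.+1%:R^-1 : R) `^ g @[n --> \oo] --> (0 : R).
Proof.
move=> g0; have := @powR_cvg0 R g g0; move/cvg_at_rightP => /(_ (fun n => n.+1%:R^-1)).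
by apply; split => [n|]; [rewrite invr_gt0|exact: cvg_harmonic].
Qed.

(** Monotone convergence along the intervals from [b / (n + 1)] to [b]. *)
Lemma integral_powR0 b q : 0 < q -> 0 < b ->
  (\int[leb]_(t in `]0%R, b]) (t `^ (q - 1))%:E = (b `^ q / q)%:E)%E.
Proof.
move=> q0 b0.
pose F n := `]b * n.+1%:R^-1, b]%classic.
have bn n : 0 < b * n.+1%:R^-1 by rewrite divr_gt0.
have -> : `]0, b]%classic = \bigcup_n F n.
  apply/seteqP; split => [x|x [n _]]; rewrite /F/= !in_itv/= => /andP[x0 xb]; last first.
    by rewrite xb (lt_trans (bn n)).
  exists (Num.truncn (b / x)) => //=.
  by rewrite in_itv/= xb andbT ltr_pdivrMr// mulrC -ltr_pdivrMr// truncnS_gt.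
apply/esym/(@cvg_unique _ (@ereal_hausdorff R) _ (fmap_proper_filter _ eventually_filter)); last first.
  apply: ge0_nondecreasing_set_cvg_integral => //.
  - move=> n m nm; apply/subsetPset => x; rewrite /F/= !in_itv/= => /andP[h ->].
    rewrite andbT; apply: le_lt_trans h.
    by rewrite ler_pM2l// lef_pV2 ?posrE// ler_nat.
  - by move=> n; exact: measurable_itv.
  - by move=> n; apply/measurable_EFinP/measurable_funTS; exact: measurable_powR.
  - by move=> n x _; rewrite lee_fin powR_ge0.
have -> : (fun n => \int[leb]_(t in F n) (t `^ (q - 1))%:E)%E =
   (fun n => ((b `^ q - b `^ q * (n.+1%:R^-1) `^ q) / q)%:E).
  apply/funext => n; rewrite /F integral_powR ?gt_eqF//.
    by rewrite powRM ?invr_ge0// ltW.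
  by rewrite ler_pdivrMr// ler_peMr ?ler1n// ltW.
apply: cvg_EFin; first by apply: nearW.
rewrite -[X in _ --> X](_ : (b `^ q - b `^ q * 0) / q = _); last by rewrite mulr0 subr0.
apply: cvgM; last exact: cvg_cst.
apply: cvgB; first exact: cvg_cst.
by apply: cvgM; [exact: cvg_cst|exact: cvg_harmonic_powR].
Qed.

(** Monotone convergence along the intervals from [a] to [a (n + 1)]. *)
Lemma integral_powRy a q : q < 0 -> 0 < a ->
  (\int[leb]_(t in `]a, +oo[) (t `^ (q - 1))%:E = (- (a `^ q) / q)%:E)%E.
Proof.
move=> q0 a0.
pose F n := `]a, a * n.+1%:R]%classic.
have -> : `]a, +oo[%classic = \bigcup_n F n.
  apply/seteqP; split => [x|x [n _]]; rewrite /F/= !in_itv/=; last by case/andP => ->.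
  rewrite andbT => ax; exists (Num.truncn (x / a)) => //=.
  by rewrite in_itv/= ax/= mulrC -ler_pdivrMr// ltW// truncnS_gt.
apply/esym/(@cvg_unique _ (@ereal_hausdorff R) _ (fmap_proper_filter _ eventually_filter)); last first.
  apply: ge0_nondecreasing_set_cvg_integral => //.
  - move=> n m nm; apply/subsetPset => x; rewrite /F/= !in_itv/= => /andP[-> h] /=.
    apply: le_trans h _.
    by rewrite ler_pM2l// ler_nat.
  - by move=> n; exact: measurable_itv.
  - by move=> n; apply/measurable_EFinP/measurable_funTS; exact: measurable_powR.
  - by move=> n x _; rewrite lee_fin powR_ge0.
have -> : (fun n => \int[leb]_(t in F n) (t `^ (q - 1))%:E)%E =
   (fun n => ((a `^ q * (n.+1%:R^-1) `^ (- q) - a `^ q) / q)%:E).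
  apply/funext => n; rewrite /F integral_powR ?lt_eqF//.
    rewrite powRM ?(ltW a0)//.
    by rewrite -[n.+1%:R^-1]powR_inv1// -powRrM mulN1r opprK.
  by rewrite ler_peMr ?ler1n// ltW.
apply: cvg_EFin; first by apply: nearW.
rewrite -[X in _ --> X](_ : (a `^ q * 0 - a `^ q) / q = _); last by rewrite mulr0 sub0r.
apply: cvgM; last exact: cvg_cst.
apply: cvgB; last exact: cvg_cst.
by apply: cvgM; [exact: cvg_cst|apply: cvg_harmonic_powR; rewrite oppr_gt0].
Qed.

End power_integrals.

Section gamma.
Context {R : realType}.
Implicit Types (a : R).
Local Notation leb := (@lebesgue_measure R).

(** A natural power of [t] is bounded by a multiple of [exp t], by its power series. *)
Lemma powR_le_expR a : exists2 K : R, 0 < K & forall t : R, 1 <= t -> t `^ a <= K * expR t.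
Proof.
pose n := Num.truncn a.
exists (n.+1)`!%:R => [|t t1]; first by rewrite ltr0n fact_gt0.
have t0 : 0 <= t by exact: le_trans t1.
have := expR_ge1Dxn n t0; set e := expR t => h.
apply: (@le_trans _ _ (t ^+ n.+1)).
  by rewrite -powR_mulrn// ler_powR// ltW// truncnS_gt.
rewrite mulrC -ler_pdivrMr ?ltr0n ?fact_gt0//; lra.
Qed.

(** The integrand is compared with [t^(a-1)] near zero and with a multiple of
    [t^(-2)] near infinity.  Finiteness matters for positivity, since the real
    value of an infinite integral is zero. *)
Lemma Gamma_gt0 a : 0 < a -> 0 < Gamma a.
Proof.
move=> a0; rewrite /Gamma /Rintegral.
set f : R -> R := fun t => t `^ (a - 1) * expR (- t).
have f0 t : 0 <= f t by rewrite mulr_ge0 ?powR_ge0 ?expR_ge0.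
have mp (q : R) : measurable_fun setT (fun t : R => t `^ q) by exact: measurable_powR.
have mf : measurable_fun setT (EFin \o f).
  apply/measurable_EFinP; apply: measurable_funM => //.
  by apply: measurableT_comp => //; exact: measurable_expR.
have mfD (D : set R) : measurable_fun D (EFin \o f) by exact: measurable_funTS.
have [K K0 Kt] := powR_le_expR (a + 1).
have D1 : (\int[leb]_(t in `]0%R, 1%R]) (f t)%:E <= (a^-1)%:E)%E.
  apply: (@le_trans _ _ (\int[leb]_(t in `]0%R, 1%R]) (t `^ (a - 1))%:E)%E).
    apply: ge0_le_integral => //.
    - by move=> x _; rewrite lee_fin.
    - by apply: mfD.
    - by apply/measurable_EFinP/measurable_funTS.
    - move=> x; rewrite /= in_itv/= => /andP[x0 _].
      by rewrite lee_fin ler_piMr ?powR_ge0// expR_le1 oppr_le0 ltW.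
  by rewrite integral_powR0// powR1 div1r.
have D2 : (\int[leb]_(t in `]1%R, +oo[) (f t)%:E <= K%:E)%E.
  apply: (@le_trans _ _ (\int[leb]_(t in `]1%R, +oo[) (K%:E * (t `^ (-1 - 1))%:E))%E).
    apply: ge0_le_integral => //.
    - by move=> x _; rewrite lee_fin.
    - by apply: mfD.
    - apply: emeasurable_funM => //.
      by apply/measurable_EFinP/measurable_funTS.
    - move=> x; rewrite /= in_itv/= andbT => x1; have x0 : 0 < x by exact: lt_trans x1.
      rewrite -EFinM lee_fin /f expRN ler_pdivrMr ?expR_gt0//.
      have := Kt _ (ltW x1).
      rewrite (_ : a + 1 = (a - 1) - (- 1 - 1)); last by ring.
      rewrite (@powRB _ x (a - 1) (-1 - 1)) ?(gt_eqF x0) ?implybT//.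
      by rewrite ler_pdivrMr ?powR_gt0// mulrAC.
  rewrite ge0_integralZl//.
  - by rewrite integral_powRy// ?ltrN10// powR1 -EFinM invrN1 mulrN1 opprK mulr1.
  - by apply/measurable_EFinP/measurable_funTS.
  - by move=> x _; rewrite lee_fin powR_ge0.
  - by rewrite lee_fin ltW.
have D3 : ((expR (-2) * ((2 `^ a - 1) / a))%:E <= \int[leb]_(t in `]1%R, 2%R]) (f t)%:E)%E.
  apply: (@le_trans _ _ (\int[leb]_(t in `]1%R, 2%R]) ((expR (- 2))%:E * (t `^ (a - 1))%:E))%E).
    rewrite ge0_integralZl//.
    - by rewrite integral_powR ?gt_eqF// ?ler1n// powR1 -EFinM.
    - by apply/measurable_EFinP/measurable_funTS.
    - by move=> x _; rewrite lee_fin powR_ge0.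
  apply: ge0_le_integral => //.
  - by move=> x _; rewrite -EFinM lee_fin mulr_ge0 ?expR_ge0 ?powR_ge0.
  - apply: emeasurable_funM => //.
    by apply/measurable_EFinP/measurable_funTS.
  - by apply: mfD.
  - move=> x; rewrite /= in_itv/= => /andP[x0 x2].
    by rewrite -EFinM lee_fin mulrC ler_wpM2l ?powR_ge0// ler_expR lerN2.
set I := (\int[leb]_(t in `]0%R, +oo[) (f t)%:E)%E.
have m01 : measurable (`]0%R, 1%R] : set R) by exact: measurable_itv.
have m12 : measurable (`]1%R, 2%R] : set R) by exact: measurable_itv.
have m1y : measurable (`]1%R, +oo[ : set R) by exact: measurable_itv.
have I1 : (I <= (a^-1 + K)%:E)%E.
  rewrite EFinD /I (@itv_bndbnd_setU _ _ _ (BRight 1)) ?bnd_simp//.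
  rewrite ge0_integral_setU//.
  - exact: leeD.
  - exact: mfD.
  - by move=> x _; rewrite lee_fin.
  - rewrite disj_set2E; apply/eqP/seteqP; split=> // x [] /=.
    by rewrite !in_itv/= => /andP[_ /le_lt_trans h]; rewrite andbT => /h; rewrite ltxx.
have I2 : ((expR (-2) * ((2 `^ a - 1) / a))%:E <= I)%E.
  apply: le_trans D3 _; apply: ge0_subset_integral => //.
  - exact: mfD.
  - by move=> x _; rewrite lee_fin.
  - by move=> x /=; rewrite !in_itv/= => /andP[x1 _]; rewrite andbT (lt_trans _ x1).
have c0 : 0 < expR (-2) * ((2 `^ a - 1) / a) :> R.
  rewrite mulr_gt0 ?expR_gt0// divr_gt0// subr_gt0.
  rewrite -[X in X < _](powRr0 2) /powR !gt_eqF// mul0r ltr_expR mulr_gt0//.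
  by rewrite ln_gt0// ltr1n.
apply: fine_gt0; rewrite (le_lt_trans I1 (ltry _)) andbT.
by apply: lt_le_trans I2; rewrite lte_fin.
Qed.

Lemma cNs_gt0 N (s : R) : 0 < s < 1 -> 0 < cNs N s.
Proof.
move=> /andP[s0 s1]; rewrite /cNs divr_gt0// ?mulr_gt0 ?powR_gt0 ?pi_gt0//.
- by apply: Gamma_gt0; rewrite ltr_wpDl.
- by apply: Gamma_gt0; rewrite subr_gt0.
Qed.

End gamma.

(** * Polar coordinates *)

Section sectors.
Context {R : realType} {N : nat}.
Local Open Scope ereal_scope.
Notation leb := (@lebesgue_measure R).

Definition normalize (z : 'rV[R]_N) : 'rV[R]_N := ((enorm z)^-1 *: z)%R.

Lemma measurable_normalize : measurable_fun setT normalize.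
Proof.
apply: measurable_fun_rV => i.
rewrite [X in measurable_fun _ X](_ : _ =
    fun z : 'rV[R]_N => (enorm z `^ (-1) * z ord0 i)%R); last first.
  by apply/funext => z; rewrite mxE powR_inv1 ?enorm_ge0.
apply: measurable_funM; last exact: measurable_coord.
exact: (measurableT_comp (@measurable_powR R _) measurable_enorm).
Qed.

Lemma normalizeZ (c : R) z : (0 < c)%R -> normalize (c *: z)%R = normalize z.
Proof.
move=> c0; rewrite /normalize enormZ gtr0_norm// scalerA invfM.
by rewrite mulrAC mulVf ?gt_eqF// mul1r.
Qed.

(** The origin, whose direction is meaningless, is excluded. *)
Definition sector (K : set 'rV[R]_N) : set 'rV[R]_N :=
  [set z | (0 < enorm z)%R /\ K (normalize z)].

Lemma measurable_sector K : measurable K -> measurable (sector K).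
Proof.
move=> mK; apply: measurableI; last exact: (measurable_preimage measurable_normalize).
rewrite (_ : (fun _ => _) = enorm @^-1` `]0%R, +oo[); last first.
  by apply/seteqP; split => z /=; rewrite in_itv/= andbT.
by apply: (measurable_preimage measurable_enorm); exact: measurable_itv.
Qed.

Lemma surface_measureE K :
  surface_measure K = N%:R%:E * lebesgue_rV N (sector K `&` [set z | (enorm z < 1)%R]).
Proof.
congr (_ * lebesgue_rV N _); apply/seteqP; split=> z /=.
  by case=> Kz /andP[].
by case=> -[z0 Kz z1]; split=> //; apply/andP.
Qed.

Lemma measurable_enorm_lt t : measurable [set z : 'rV[R]_N | (enorm z < t)%R].
Proof.
rewrite (_ : [set _ | _] = enorm @^-1` `]-oo, t[); last first.
  by apply/seteqP; split => z /=; rewrite in_itv/=.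
by apply: (measurable_preimage measurable_enorm); exact: measurable_itv.
Qed.

Hypothesis N0 : (0 < N)%N.

Lemma surface_measure_fin (K : set 'rV[R]_N) : measurable K -> surface_measure K \is a fin_num.
Proof.
move=> mK; rewrite surface_measureE fin_numM//.
have /andP[_ boo] := @eball_unit_bounds R N N0.
rewrite ge0_fin_numE//; apply: le_lt_trans boo; apply: le_measure; rewrite ?inE.
- by apply: measurableI; [exact: measurable_sector|exact: measurable_enorm_lt].
- exact: measurable_eball.
- by move=> z [_ /=]; rewrite /eball/= subr0.
Qed.

(** Scaling by [t] preserves directions. *)
Lemma lebesgue_sector_ball K (t : R) : measurable K -> (0 < t)%R ->
  N%:R%:E * lebesgue_rV N (sector K `&` [set z | (enorm z < t)%R]) =
  (t ^+ N)%:E * surface_measure K.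
Proof.
move=> mK t0; rewrite surface_measureE.
set A := sector K `&` _.
have mA : measurable A.
  by apply: measurableI; [exact: measurable_sector|exact: measurable_enorm_lt].
have -> : sector K `&` [set z | (enorm z < 1)%R] = (fun z : 'rV[R]_N => t *: z)%R @^-1` A.
  apply/seteqP; split=> z; rewrite /A /sector /= normalizeZ// enormZ gtr0_norm//
    pmulr_rgt0// -ltr_pdivlMl// mulVf ?gt_eqF//.
rewrite lebesgue_rV_scale// !muleA; congr (_ * _).
by rewrite -!EFinM; congr _%:E; rewrite mulrAC mulfV ?mul1r// expf_neq0// gt_eqF.
Qed.

End sectors.

Lemma integral_mulr_indic d (T : measurableType d) (R : realType)
    (mu : {measure set T -> \bar R}) (D P : set T) (f : T -> \bar R) :
  (\int[mu]_(x in D) (f x * (\1_P x)%:E) = \int[mu]_(x in D `&` P) f x)%E.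
Proof.
rewrite integral_mkcondr; apply: eq_integral => x _.
by rewrite epatch_indic.
Qed.

Section polar.
Context {R : realType} {N : nat}.
Hypothesis N0 : (0 < N)%N.
Local Open Scope ereal_scope.
Notation leb := (@lebesgue_measure R).

Section fixed_sector.
Variables (K : set 'rV[R]_N) (mK : measurable K).
Let sig : R := fine (surface_measure K).

Let sigE : sig%:E = surface_measure K.
Proof. by rewrite fineK// surface_measure_fin. Qed.

Let sig0 : (0 <= sig)%R.
Proof. by rewrite fine_ge0. Qed.

Let mS : measurable (sector K) := measurable_sector mK.

Let w1 : 'rV[R]_N -> R := \1_(sector K).
Let mw1 : measurable_fun setT w1. Proof. exact: measurable_indic. Qed.
Let w10 z : (0 <= w1 z)%R. Proof. by rewrite /w1 indicE ler0n. Qed.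

Let w2 (t : measurableTypeR R) : R := (sig * (t : R) `^ (N%:R - 1) * \1_(`]0%R, +oo[) (t : R))%R.
Let mw2 : measurable_fun setT w2.
Proof.
apply: measurable_funM; last exact: measurable_indic.
apply: measurable_funM => //; exact: measurable_powR.
Qed.
Let w20 t : (0 <= w2 t)%R. Proof. by rewrite !mulr_ge0 ?powR_ge0// indicE ler0n. Qed.

Let enormR : 'rV[R]_N -> measurableTypeR R := enorm.
Let menormR : measurable_fun setT enormR. Proof. exact: measurable_enorm. Qed.

Let radial_eq (B : set (measurableTypeR R)) : measurable B ->
  pushforward (density_measure (lebesgue_rV N) w1) enormR B = density_measure leb w2 B.
Proof.
move=> mB.
pose g k := `]-oo, (k%:R : R)[%classic : set (measurableTypeR R).
have E (x : R) : pushforward (density_measure (lebesgue_rV N) w1) enormR `]-oo, x[%classic =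
    density_measure leb w2 `]-oo, x[%classic /\
    pushforward (density_measure (lebesgue_rV N) w1) enormR `]-oo, x[%classic < +oo.
  have -> : pushforward (density_measure (lebesgue_rV N) w1) enormR `]-oo, x[%classic =
      lebesgue_rV N (sector K `&` [set z | (enorm z < x)%R]).
    rewrite /pushforward /density_measure /w1 integral_indic//; last first.
      by apply: (measurable_preimage menormR); exact: measurable_itv.
  have [x0|x0] := leP x 0%R.
    have -> : sector K `&` [set z | (enorm z < x)%R] = set0.
      by apply/seteqP; split=> // z [_ /=]; rewrite ltNge (le_trans x0)// enorm_ge0.
    rewrite measure0; split=> //; rewrite /density_measure integral0_eq// => t /=.
    rewrite in_itv/= => tx; rewrite /w2 indicE memNset ?mulr0//= in_itv/= andbT.
    by apply/negP; rewrite -leNgt ltW// (lt_le_trans tx).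
  have N1 : (0 < N%:R :> R)%R by rewrite ltr0n.
  have -> : lebesgue_rV N (sector K `&` [set z | (enorm z < x)%R]) =
      (sig * (x ^+ N / N%:R))%:E.
    have := lebesgue_sector_ball mK x0; rewrite -sigE => h.
    apply: (@pmuleI _ N%:R%:E); first by rewrite lte_fin N1 ltry.
    rewrite h -!EFinM; congr _%:E.
    by field; rewrite gt_eqF.
  split; last by rewrite ltry.
  rewrite /density_measure /w2.
  under eq_integral do rewrite EFinM.
  rewrite integral_mulr_indic.
  have -> : (`]-oo, x[ `&` `]0%R, +oo[ = `]0%R, x[)%classic.
    by apply/seteqP; split=> t /=; rewrite !in_itv/= andbT andbC => /andP.
  rewrite integral_itv_bndo_bndc; last first.
    by apply/measurable_EFinP/measurable_funTS/measurable_funM => //; exact: measurable_powR.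
  under eq_integral do rewrite EFinM.
  rewrite ge0_integralZl//.
  - by rewrite integral_powR0// EFinM powR_mulrn// ltW.
  - by apply/measurable_EFinP/measurable_funTS; exact: measurable_powR.
  - by move=> t _; rewrite lee_fin powR_ge0.
apply: (@measure_unique _ R (measurableTypeR R)
  [set A | exists x : R, A = `]-oo, x[%classic] g _ _ _ _
  (pushforward (density_measure (lebesgue_rV N) w1) enormR)
  (density_measure leb w2)) => //.
- exact: RGenInftyO.measurableE.
- move=> _ _ [x ->] [y ->]; exists (Num.min x y).
  by apply/seteqP; split=> t /=; rewrite !in_itv/= lt_min => /andP.
- by move=> k; exists k%:R.
- apply/seteqP; split=> // t _; exists (Num.truncn t).+1 => //=.
  by rewrite /g/= in_itv/= truncnS_gt.
- by move=> _ [x ->]; have [] := E x.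
- by move=> k; have [] := E k%:R.
Qed.

(** The image under the norm of Lebesgue measure on the sector and the measure
    with density a multiple of [t^(N-1)] agree on the half-lines below each
    [t], by scaling, hence everywhere. *)
Lemma integral_sector_radial (f : R -> \bar R) :
  measurable_fun setT f -> (forall t, 0 <= f t) ->
  \int[lebesgue_rV N]_(z in sector K) f (enorm z) =
  surface_measure K *
  \int[leb]_(t in `]0%R, +oo[) (f t * (t `^ (N%:R - 1))%:E).
Proof.
move=> mf f0.
have mfR : measurable_fun setT (f : measurableTypeR R -> \bar R) by exact: mf.
transitivity (\int[pushforward (density_measure (lebesgue_rV N) w1) enormR]_t
   (f : measurableTypeR R -> \bar R) t).
  rewrite ge0_integral_pushforward// preimage_setT integral_density_measure//.
    rewrite -[in LHS](setTI (sector K)) -integral_mulr_indic.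
    by apply: eq_integral.
    exact: (measurableT_comp mf measurable_enorm).
  by move=> z _; exact: f0.
transitivity (\int[density_measure leb w2]_t (f : measurableTypeR R -> \bar R) t).
  by apply: eq_measure_integral => B mB _; exact: radial_eq.
rewrite integral_density_measure//.
rewrite -[in RHS](setTI `]0%R, +oo[%classic) -integral_mulr_indic -sigE.
rewrite -ge0_integralZl//.
- by apply: eq_integral => t _; rewrite /w2 !EFinM !muleA (muleC (f t)).
- apply: emeasurable_funM; last exact/measurable_EFinP/measurable_indic.
  apply: emeasurable_funM => //; apply/measurable_EFinP; exact: measurable_powR.
- by move=> t _; rewrite !mule_ge0 ?lee_fin ?powR_ge0// indicE.
Qed.

End fixed_sector.
End polar.

(** * Polar coordinates for the fractional measure *)

Section mu_s_polar.
Context {R : realType} {N : nat}.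
Variable s : R.
Hypothesis N0 : (0 < N)%N.
Hypothesis s01 : 0 < s < 1.
Local Open Scope ereal_scope.
Notation leb := (@lebesgue_measure R).

Let s0 : (0 <= s)%R. Proof. by case/andP: s01 => /ltW. Qed.

Let C0 : (0 <= cNs N s)%R. Proof. exact/ltW/cNs_gt0. Qed.

Definition mu_density (t : R) : R := (cNs N s / t `^ (N%:R + 2 * s))%R.

Lemma mu_density_ge0 t : (0 <= mu_density t)%R.
Proof. by rewrite divr_ge0 ?powR_ge0. Qed.

Lemma measurable_mu_density : measurable_fun setT mu_density.
Proof.
rewrite [X in measurable_fun _ X](_ : _ = fun t => (cNs N s * t `^ (- (N%:R + 2 * s)))%R).
  by apply: measurable_funM => //; exact: measurable_powR.
by apply/funext => t; rewrite powRN.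
Qed.

Lemma measurable_mu_density_enorm :
  measurable_fun setT (fun z : 'rV[R]_N => mu_density (enorm z)).
Proof. exact: (measurableT_comp measurable_mu_density measurable_enorm). Qed.

Lemma integral_mu_s (D : set 'rV[R]_N) (f : 'rV[R]_N -> \bar R) : measurable D ->
  measurable_fun D f -> (forall x, D x -> 0 <= f x) ->
  \int[@mu_s R N s]_(z in D) f z =
  \int[lebesgue_rV N]_(z in D) (f z * (mu_density (enorm z))%:E).
Proof.
move=> mD mf f0; apply: ge0_integral_density => //.
- exact: measurable_mu_density_enorm.
- by move=> z; exact: mu_density_ge0.
- by move=> A mA; exact: mu_sE.
Qed.

(** The density contributes [t^(-N-2s)] to the volume factor [t^(N-1)]. *)
Lemma integral_mu_s_sector (K : set 'rV[R]_N) (f : R -> \bar R) :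
  measurable K -> measurable_fun setT f -> (forall t, 0 <= f t) ->
  \int[@mu_s R N s]_(z in sector K) f (enorm z) =
  (cNs N s)%:E * surface_measure K *
  \int[leb]_(t in `]0%R, +oo[) (f t * (t `^ (- (2 * s) - 1))%:E).
Proof.
move=> mK mf f0.
rewrite integral_mu_s//; last 2 first.
- exact: measurable_sector.
- by apply: measurable_funTS; exact: (measurableT_comp mf measurable_enorm).
rewrite (@integral_sector_radial R N N0 K mK (fun t => f t * (mu_density t)%:E)); last 2 first.
- by apply: emeasurable_funM => //; apply/measurable_EFinP; exact: measurable_mu_density.
- by move=> t; rewrite mule_ge0// lee_fin mu_density_ge0.
rewrite (muleC (cNs N s)%:E) -[RHS]muleA; congr (_ * _).
rewrite -ge0_integralZl//.
- apply: eq_integral => t /[!inE]/=; rewrite in_itv/= andbT => t0.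
  rewrite muleCA -muleA; congr (_ * _); rewrite -!EFinM; congr (_%:E).
  rewrite /mu_density -mulrA; congr (_ * _)%R.
  have -> : (- (2 * s) - 1 = (N%:R - 1) - (N%:R + 2 * s))%R by ring.
  by rewrite [RHS](@powRB _ t (N%:R - 1)) ?(gt_eqF t0) ?implybT// mulrC.
- apply: emeasurable_funM; first exact: measurable_funTS.
  by apply/measurable_EFinP/measurable_funTS; exact: measurable_powR.
- by move=> t _; rewrite mule_ge0// lee_fin powR_ge0.
Qed.

Definition shell (K : set 'rV[R]_N) (B : set R) := sector K `&` enorm @^-1` B.

Lemma measurable_shell K B : measurable K -> measurable B -> measurable (shell K B).
Proof.
move=> mK mB; apply: measurableI; first exact: measurable_sector.
exact: (measurable_preimage measurable_enorm).
Qed.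

Lemma integral_mu_s_shell (K : set 'rV[R]_N) (B : set R) (k : R) :
  measurable K -> measurable B -> B `<=` `]0%R, +oo[ ->
  \int[@mu_s R N s]_(z in shell K B) (enorm z `^ k)%:E =
  (cNs N s)%:E * surface_measure K * \int[leb]_(t in B) (t `^ (k - 2 * s - 1))%:E.
Proof.
move=> mK mB B0; rewrite /shell -integral_mulr_indic.
rewrite (@integral_mu_s_sector K (fun t => (t `^ k)%:E * (\1_B t)%:E)) => //; last 2 first.
- apply: emeasurable_funM; last exact/measurable_EFinP/measurable_indic.
  by apply/measurable_EFinP; exact: measurable_powR.
- by move=> t; rewrite mule_ge0// lee_fin ?powR_ge0// indicE.
congr (_ * _); under eq_integral do rewrite muleAC.
rewrite integral_mulr_indic (setIidr B0); apply: eq_integral => t /[!inE] /B0/=.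
rewrite in_itv/= andbT => t0.
rewrite -EFinM -powRD ?(gt_eqF t0) ?implybT//; congr (_ `^ _)%:E; ring.
Qed.

(** For a fixed radial weight, both sides are integrals of [g] against a measure
    on directions; the case of an indicator [g] shows that these are the same
    measure. *)
Lemma integral_mu_s_shell_angular (K : set 'rV[R]_N) (B : set R) (k c : R) (g : 'rV[R]_N -> \bar R) :
  measurable K -> measurable B -> B `<=` `]0%R, +oo[ ->
  \int[leb]_(t in B) (t `^ (k - 2 * s - 1))%:E = c%:E ->
  measurable_fun setT g -> (forall z, 0 <= g z) ->
  \int[@mu_s R N s]_(z in shell K B) ((enorm z `^ k)%:E * g (normalize z)) =
  (cNs N s * c)%:E * \int[@surface_measure R N]_(z in K) g z.
Proof.
move=> mK mB B0 cE mg g0.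
have c0 : (0 <= c)%R by rewrite -lee_fin -cE integral_ge0// => t _; rewrite lee_fin powR_ge0.
have Cc0 : (0 <= cNs N s * c)%R by exact: mulr_ge0.
pose h (z : 'rV[R]_N) : R := (enorm z `^ k * \1_(shell setT B) z)%R.
have mh : measurable_fun setT h.
  apply: measurable_funM; last by apply: measurable_indic; apply: measurable_shell.
  exact: (measurableT_comp (@measurable_powR R _) measurable_enorm).
have h0 z : (0 <= h z)%R by rewrite mulr_ge0 ?powR_ge0// indicE.
have shellE L : normalize @^-1` L `&` shell setT B = shell L B.
  by apply/seteqP; split=> z /=; rewrite /shell/sector/= => -[]; tauto.
have mn := @measurable_normalize R N.
transitivity (\int[pushforward (density_measure (@mu_s R N s) h) (@normalize R N)]_(z in K) g z).
  rewrite ge0_integral_pushforward//; last exact: measurable_funTS.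
  rewrite integral_density_measure//.
  - rewrite -shellE -integral_mulr_indic; apply: eq_integral => z _.
    by rewrite /h EFinM muleA (muleC (g _)).
  - exact: (measurable_preimage mn).
  - by apply: measurable_funTS; exact: measurableT_comp.
  - by move=> z _; exact: g0.
transitivity (\int[mscale (NngNum Cc0) (@surface_measure R N)]_(z in K) g z); last first.
  by rewrite ge0_integral_mscale//; exact: measurable_funTS.
apply: eq_measure_integral => L mL _.
transitivity (\int[@mu_s R N s]_(z in normalize @^-1` L)
    ((enorm z `^ k)%:E * (\1_(shell setT B) z)%:E)).
  by apply: eq_integral => z _; rewrite -EFinM.
rewrite integral_mulr_indic shellE integral_mu_s_shell// cE /mscale/=.
by rewrite -muleA (muleC _ c%:E) muleA -EFinM.
Qed.

End mu_s_polar.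

(** * Cones and orthogonal invariance *)

Section caps.
Context {R : realType} {N : nat}.
Implicit Types (y z w : 'rV[R]_N) (al a b : R).

(** The spherical cap around [y], described by the cosine so that its
    measurability is visible. *)
Definition ccap al y : set 'rV[R]_N := [set w | enorm w = 1 /\ cos al < dotp y w].

Lemma measurable_dotp y : measurable_fun setT (dotp y).
Proof.
apply: measurable_sum => i; apply: measurable_funM => //.
exact: measurable_coord.
Qed.

Lemma measurable_ccap al y : measurable (ccap al y).
Proof.
apply: measurableI.
  rewrite (_ : (fun _ => _) = enorm @^-1` [set 1]); last by [].
  by apply: (measurable_preimage measurable_enorm); exact: measurable_set1.
rewrite (_ : (fun _ => _) = dotp y @^-1` `]cos al, +oo[); last first.
  by apply/seteqP; split=> z /=; rewrite in_itv/= andbT.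
by apply: (measurable_preimage (measurable_dotp y)); exact: measurable_itv.
Qed.

(** The arc cosine is strictly decreasing. *)
Lemma angle_lt al y w : 0 < al <= pi / 2 -> enorm y = 1 -> enorm w = 1 ->
  (angle y w < al) = (cos al < dotp y w).
Proof.
move=> /andP[al0 al1] y1 w1; rewrite /angle y1 w1 mulr1 divr1.
have := dotp_le_enorm y w; rewrite y1 w1 mulr1 ler_norml => dB.
have h1 : al \in `[0, pi].
  rewrite in_itv/= (ltW al0)/=; apply: le_trans al1 _.
  by rewrite ler_pdivrMr// ler_peMr ?pi_ge0// ler1n.
have h2 : acos (dotp y w) \in `[0, pi] by rewrite in_itv/= acos_ge0// acos_lepi.
by rewrite -ltr_cos// acosK// in_itv.
Qed.

Lemma enorm_normalize z : 0 < enorm z -> enorm (normalize z) = 1.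
Proof. by move=> z0; rewrite enormZ ger0_norm ?invr_ge0 ?enorm_ge0// mulVf ?gt_eqF. Qed.

Lemma angle_normalize y z : 0 < enorm z -> angle y (normalize z) = angle y z.
Proof.
move=> z0; rewrite /angle enorm_normalize// dotpZr; congr acos.
by rewrite mulr1 invfM; ring.
Qed.

Lemma cap_ccap al : (0 < N)%N -> 0 < al <= pi / 2 -> @cap R N al = ccap al (stdbasis 0).
Proof.
move=> N0 ha; have e1 : enorm (stdbasis 0 : 'rV[R]_N) = 1.
  by rewrite /enorm (dotp_stdbasis _ (Ordinal N0)) mxE eqxx sqrtr1.
by apply/seteqP; split=> w; rewrite /cap/ccap/= => -[w1]; rewrite angle_lt.
Qed.

(** Inside a cone the angle only depends on the direction. *)
Lemma coneE al a (b : \bar R) y : 0 < al <= pi / 2 -> 0 <= a -> enorm y = 1 ->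
  cone al a%:E b y = shell (ccap al y) [set t | a < t /\ (t%:E < b)%E].
Proof.
move=> ha a0 y1; apply/seteqP; split=> z /=.
  move=> [hz /andP[az zb]]; rewrite lte_fin in az.
  have z0 : 0 < enorm z by exact: le_lt_trans az.
  by rewrite /shell/sector/ccap/= -angle_lt ?enorm_normalize// angle_normalize.
move=> [[z0 [n1 cz]] [az zb]]; split; last by rewrite lte_fin az.
by rewrite -angle_normalize// angle_lt// n1.
Qed.

Lemma cone_unbounded al a y : 0 < al <= pi / 2 -> 0 <= a -> enorm y = 1 ->
  cone al a%:E +oo%E y = shell (ccap al y) `]a, +oo[.
Proof.
move=> ha a0 y1; rewrite coneE//; congr shell.
by apply/seteqP; split=> t /=; rewrite in_itv/= andbT ?ltry// => -[].
Qed.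

(** Orthogonal maps preserve norms and angles. *)
Lemma shell_orthogonal (M : 'M[R]_N) al y (B : set R) : orthogonal M ->
  (fun z => z *m M) @^-1` shell (ccap al (y *m M)) B = shell (ccap al y) B.
Proof.
move=> oM; apply/seteqP; split=> z;
  rewrite /shell/sector/ccap/normalize/=;
  by rewrite enorm_orthogonal// scalemxAl !enorm_orthogonal// dotp_orthogonal.
Qed.

End caps.

Section mu_s_orthogonal.
Context {R : realType} {N : nat}.
Variables (s : R) (M : 'M[R]_N).
Hypothesis s01 : 0 < s < 1.
Hypothesis oM : orthogonal M.
Local Open Scope ereal_scope.

Let mM := measurable_rVmulmx M.

(** The density is radial. *)
Lemma mu_s_orthogonal A : measurable A ->
  mu_s s ((fun z : 'rV[R]_N => z *m M) @^-1` A) = mu_s s A.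
Proof.
have s0 : (0 <= s)%R by case/andP: s01 => /ltW.
move=> mA; rewrite !mu_sE//.
transitivity (\int[pushforward (lebesgue_rV N) (fun z : 'rV[R]_N => z *m M)]_(z in A)
  (mu_density (N := N) s (enorm z))%:E).
  rewrite [RHS]ge0_integral_pushforward.
  - by apply: eq_integral => z _; rewrite /comp enorm_orthogonal.
  - exact: mM.
  - exact: mA.
  - by apply/measurable_EFinP/measurable_funTS; exact: measurable_mu_density_enorm.
  - by move=> z _; rewrite lee_fin; exact: mu_density_ge0.
apply: eq_measure_integral => B mB _; exact: lebesgue_rV_orthogonal.
Qed.

Lemma ge0_integral_mu_s_orthogonal (D : set 'rV[R]_N) (f : 'rV[R]_N -> \bar R) :
  measurable D -> measurable_fun D f -> (forall z, D z -> 0 <= f z) ->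
  \int[@mu_s R N s]_(z in D) f z =
  \int[@mu_s R N s]_(z in (fun z => z *m M) @^-1` D) f (z *m M).
Proof.
move=> mD mf f0.
transitivity (\int[pushforward (@mu_s R N s) (fun z : 'rV[R]_N => z *m M)]_(z in D) f z).
  by apply: eq_measure_integral => B mB _; exact/esym/mu_s_orthogonal.
rewrite ge0_integral_pushforward.
- by [].
- exact: mM.
- exact: mD.
- exact: mf.
- by move=> z /[!inE]; exact: f0.
Qed.

(** The formula for nonnegative integrands is applied to the positive and
    negative parts, so that no integrability is required. *)
Lemma integral_mu_s_orthogonal (D : set 'rV[R]_N) (f : 'rV[R]_N -> \bar R) :
  measurable D -> measurable_fun D f ->
  \int[@mu_s R N s]_(z in D) f z =
  \int[@mu_s R N s]_(z in (fun z => z *m M) @^-1` D) f (z *m M).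
Proof.
move=> mD mf; rewrite integralE [RHS]integralE; congr (_ - _).
- rewrite (@ge0_integral_mu_s_orthogonal D f^\+ mD (measurable_funepos mf)
    (fun z _ => funepos_ge0 f z)).
  by apply: eq_integral => z _; rewrite !unlock.
- rewrite (@ge0_integral_mu_s_orthogonal D f^\- mD (measurable_funeneg mf)
    (fun z _ => funeneg_ge0 f z)).
  by apply: eq_integral => z _; rewrite !unlock.
Qed.

End mu_s_orthogonal.

(** * Rotations of a plane *)

Section trigonometry.
Context {R : realType}.
Implicit Types t : R.

Lemma sin_le t : 0 <= t -> sin t <= t.
Proof.
move=> t0.
have ds (x : R) : x \in `]0, t[ -> is_derive x 1 sin (cos x) by move=> _; exact: is_derive_sin.
have cs : {within `[0, t], continuous (@sin R)}.
  by apply: continuous_subspaceT; exact: continuous_sin.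
have [c _] := MVT_segment t0 ds cs.
by rewrite sin0 !subr0 => ->; rewrite ler_piMl// cos_le1.
Qed.

(** A chord of the unit circle is shorter than its arc. *)
Lemma chord_le_arc t : 0 <= t <= pi -> 2 - 2 * cos t <= t ^+ 2.
Proof.
move=> /andP[t0 tpi].
have -> : cos t = 1 - 2 * sin (t / 2) ^+ 2.
  rewrite -[in LHS](mulr1 t) (_ : t * 1 = t / 2 *+ 2); last by rewrite -mulr_natr; field.
  by rewrite cos_mulr2n cos2sin2; ring.
have h0 : 0 <= t / 2 by rewrite divr_ge0.
have s0 : 0 <= sin (t / 2).
  by rewrite sin_ge0_pi// h0/= ler_pdivrMr// (le_trans tpi)// ler_peMr ?pi_ge0// ler1n.
have := sin_le h0; rewrite -(@ler_pXn2r _ 2)// => h.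
rewrite expr_div_n in h; have e4 : 2 ^+ 2 = 4 :> R by ring.
by move: h; rewrite e4; lra.
Qed.

(** [sin x = 2 sin (x/2) cos (x/2)], where [cos >= 1/sqrt 2] on [[0, pi/4]]
    bounds both factors from below. *)
Lemma sin_ge_half t : 0 <= t <= pi / 2 -> t / 2 <= sin t.
Proof.
move=> /andP[t0 tpi].
have p0 : 0 < pi :> R by exact: pi_gt0.
have h0 : 0 <= t / 2 by rewrite divr_ge0.
have hpi : t / 2 <= pi / 2 / 2 by rewrite ler_pM2r.
have cE : cos (pi / 2 / 2) ^+ 2 = 2^-1 :> R.
  have := @cos_mulr2n R (pi / 2 / 2).
  rewrite (_ : pi / 2 / 2 *+ 2 = pi / 2); last by rewrite -mulr_natr; field.
  by rewrite cos_pihalf -mulr_natr => h; lra.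
set c0 : R := cos (pi / 2 / 2) in cE.
have c00 : 0 <= c0 by rewrite cos_ge0_pihalf//; apply/andP; split; lra.
have cge (x : R) : 0 <= x <= t / 2 -> c0 <= cos x.
  move=> /andP[x0 xt]; rewrite /c0 le_eqVlt orbC -implyNb; apply/implyP.
  rewrite -leNgt le_eqVlt => /orP[/eqP->//|].
  by rewrite ltr_cos ?in_itv/=; [lra| |]; apply/andP; split; lra.
have ds (x : R) : x \in `]0, t / 2[ -> is_derive x 1 sin (cos x) by move=> _; exact: is_derive_sin.
have cs : {within `[0, t / 2], continuous (@sin R)}.
  by apply: continuous_subspaceT; exact: continuous_sin.
have [c ct] := MVT_segment h0 ds cs.
rewrite in_itv/= in ct; rewrite sin0 !subr0 => sE.
have -> : sin t = 2 * (cos (t / 2) * sin (t / 2)).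
  by rewrite -[in LHS](_ : t / 2 *+ 2 = t) ?sin_mulr2n -mulr_natr; [ring|field].
rewrite [X in X <= _](_ : _ = 2 * (c0 * (c0 * (t / 2)))); last first.
  by rewrite (mulrA c0) -expr2 cE; field.
rewrite ler_pM2l// ler_pM// ?mulr_ge0//.
  by apply: cge; rewrite h0 lexx.
by rewrite sE ler_wpM2r// cge.
Qed.

(** An arc of at most a half-circle is at most twice as long as its chord. *)
Lemma arc_le_chord t : 0 <= t <= pi -> t ^+ 2 <= 4 * (2 - 2 * cos t).
Proof.
move=> /andP[t0 tpi].
have -> : cos t = 1 - 2 * sin (t / 2) ^+ 2.
  rewrite -[in LHS](mulr1 t) (_ : t * 1 = t / 2 *+ 2); last by rewrite -mulr_natr; field.
  by rewrite cos_mulr2n cos2sin2; ring.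
have h0 : 0 <= t / 2 <= pi / 2 by rewrite divr_ge0//= ler_pM2r.
have := sin_ge_half h0; have t4 : 0 <= t / 2 / 2 by rewrite !divr_ge0.
move=> h; have := h; rewrite -(@ler_pXn2r _ 2) ?nnegrE// ?(le_trans t4)//.
rewrite !expr_div_n; have e4 : 2 ^+ 2 = 4 :> R by ring.
by rewrite e4; lra.
Qed.

End trigonometry.

Section plane_rotation.
Context {R : realType} {N : nat}.
Variables v w : 'rV[R]_N.
Hypotheses (v1 : dotp v v = 1) (w1 : dotp w w = 1) (vw : dotp v w = 0).
Implicit Types (z : 'rV[R]_N) (t : R).

(** The rotation by [t] of the plane spanned by the orthonormal pair [v], [w],
    extended by the identity on the orthogonal complement. *)
Definition rot_vec t z : 'rV[R]_N :=
  z + ((cos t - 1) * dotp z v - sin t * dotp z w) *: v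
    + (sin t * dotp z v + (cos t - 1) * dotp z w) *: w.

Definition rot_mx t : 'M[R]_N :=
  1%:M + ((cos t - 1) *: (v^T *m v) - sin t *: (w^T *m v))
       + (sin t *: (v^T *m w) + (cos t - 1) *: (w^T *m w)).

Let wv : dotp w v = 0. Proof. by rewrite dotpC. Qed.

Lemma mul_rot_mx t z : z *m rot_mx t = rot_vec t z.
Proof.
have E (a b : 'rV[R]_N) : z *m (a^T *m b) = dotp z a *: b.
  by rewrite mulmxA [z *m a^T]mx11_scalar mul_scalar_mx -dotp_mx.
rewrite /rot_mx /rot_vec !(mulmxDr, mulmxN, mulmxBr) mulmx1 -!scalemxAr !E !scalerA.
by rewrite -scalerBl -scalerDl.
Qed.

Lemma dotp_rot_vecv t z : dotp (rot_vec t z) v = cos t * dotp z v - sin t * dotp z w.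
Proof. by rewrite !dotpE v1 wv; ring. Qed.

Lemma dotp_rot_vecw t z : dotp (rot_vec t z) w = sin t * dotp z v + cos t * dotp z w.
Proof. by rewrite !dotpE w1 vw; ring. Qed.

Lemma rot_vecK t z : rot_vec (- t) (rot_vec t z) = z.
Proof.
rewrite {1}/rot_vec dotp_rot_vecv dotp_rot_vecw cosN sinN /rot_vec.
apply/rowP => i; rewrite !mxE.
transitivity (z ord0 i + (cos t ^+ 2 + sin t ^+ 2 - 1) *
  (dotp z v * v ord0 i + dotp z w * w ord0 i)); first by ring.
by rewrite cos2Dsin2 subrr mul0r addr0.
Qed.

Lemma trmx_rot_mx t : (rot_mx t)^T = rot_mx (- t).
Proof.
apply/matrixP => i j; rewrite /rot_mx cosN sinN !mxE !big_ord1 !mxE (eq_sym j).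
by ring.
Qed.

Lemma orthogonal_rot_mx t : orthogonal (rot_mx t).
Proof.
rewrite /orthogonal trmx_rot_mx; apply/row_matrixP => i.
by rewrite row_mul mul_rot_mx rowE mul_rot_mx rot_vecK rowE mulmx1.
Qed.

(** Bessel's inequality for the pair [v], [w]. *)
Lemma dotp_bessel z : dotp z v ^+ 2 + dotp z w ^+ 2 <= enorm z ^+ 2.
Proof.
have := dotpzz_ge0 (z - dotp z v *: v - dotp z w *: w).
rewrite !dotpE v1 w1 vw wv (dotpC v z) (dotpC w z) enorm_sqr; set a := dotp z v; set b := dotp z w.
by move=> h; rewrite -subr_ge0; move: h; congr (0 <= _); ring.
Qed.

Lemma rot_vec_dist_sqr t t' z :
  enorm (rot_vec t z - rot_vec t' z) ^+ 2 <= (2 - 2 * cos (t - t')) * enorm z ^+ 2.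
Proof.
rewrite (_ : rot_vec t z - rot_vec t' z =
   ((cos t - cos t') * dotp z v - (sin t - sin t') * dotp z w) *: v +
   ((sin t - sin t') * dotp z v + (cos t - cos t') * dotp z w) *: w); last first.
  by rewrite /rot_vec; apply/rowP => i; rewrite !mxE; ring.
rewrite enorm_sqr !dotpE v1 w1 vw wv cosB; set a := dotp z v; set b := dotp z w.
set lhs := (X in X <= _).
have -> : lhs = ((cos t ^+ 2 + sin t ^+ 2) + (cos t' ^+ 2 + sin t' ^+ 2)
    - 2 * (cos t * cos t' + sin t * sin t')) * (a ^+ 2 + b ^+ 2) by rewrite /lhs; ring.
rewrite !cos2Dsin2 (_ : 1 + 1 = 2)// ler_wpM2l ?dotp_bessel//.
by rewrite -cosB; have := cos_le1 (t - t'); lra.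
Qed.

End plane_rotation.

Section rotation_between.
Context {R : realType} {N : nat}.
Implicit Types (v w y z : 'rV[R]_N).

Lemma dotp_enorm1 v : enorm v = 1 -> dotp v v = 1.
Proof. by move=> v1; rewrite -enorm_sqr v1 expr1n. Qed.

(** Some standard basis vector is not proportional to [v]: two of them being
    orthogonal, they cannot both be. *)
Lemma exists_unit_orthogonal v : (2 <= N)%N -> enorm v = 1 ->
  exists2 w, enorm w = 1 & dotp v w = 0.
Proof.
move=> N2 v1; have vv := dotp_enorm1 v1.
have unit_proj (e : 'rV[R]_N) : e - dotp e v *: v != 0 ->
    exists2 w, enorm w = 1 & dotp v w = 0.
  set q := _ - _ => q0; exists ((enorm q)^-1 *: q).
    by rewrite enormZ ger0_norm ?invr_ge0 ?enorm_ge0// mulVf// enorm_eq0.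
  by rewrite dotpZr /q !dotpE vv mulr1 (dotpC v e) subrr mulr0.
have [i0 [i1 ne]] : exists i0 i1 : 'I_N, i0 != i1.
  by exists (Ordinal (ltn_trans (ltnSn 0) N2)), (Ordinal N2).
pose e0 : 'rV[R]_N := stdbasis i0; pose e1 : 'rV[R]_N := stdbasis i1.
have [h0|/unit_proj//] := eqVneq (e0 - dotp e0 v *: v) 0.
have [h1|/unit_proj//] := eqVneq (e1 - dotp e1 v *: v) 0.
have E0 : dotp e0 e0 = 1 by rewrite dotp_stdbasis mxE eqxx.
have E1 : dotp e1 e1 = 1 by rewrite dotp_stdbasis mxE eqxx.
have E01 : dotp e0 e1 = 0.
  by rewrite dotp_stdbasis mxE val_eqE eq_sym (negbTE ne).
move/eqP: h0; rewrite subr_eq0 => /eqP h0; move/eqP: h1; rewrite subr_eq0 => /eqP h1.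
have a0 : dotp e0 v * dotp e0 v = 1 by rewrite -[in RHS]E0 [in RHS]h0 !dotpE vv mulr1.
have a1 : dotp e1 v * dotp e1 v = 1 by rewrite -[in RHS]E1 [in RHS]h1 !dotpE vv mulr1.
have a01 : dotp e0 v * dotp e1 v = 0 by rewrite -[in RHS]E01 [in RHS]h0 [in RHS]h1 !dotpE vv mulr1.
suff h : 1 = 0 :> R by have := oner_neq0 R; rewrite h eqxx.
by rewrite -[LHS]mulr1 -{1}a0 -a1 mulrACA a01 mul0r.
Qed.

Lemma polar_decomposition v y : (2 <= N)%N -> enorm v = 1 -> enorm y = 1 ->
  exists w (t : R), [/\ enorm w = 1, dotp v w = 0, 0 <= t <= pi &
    y = cos t *: v + sin t *: w].
Proof.
move=> N2 v1 y1; have vv := dotp_enorm1 v1; have yy := dotp_enorm1 y1.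
set c := dotp v y.
have c1 : -1 <= c <= 1 by rewrite -ler_norml; have := dotp_le_enorm v y; rewrite v1 y1 mulr1.
have tpi : 0 <= acos c <= pi by rewrite acos_ge0//= acos_lepi.
set q := y - c *: v.
have qv : dotp v q = 0 by rewrite /q !dotpE vv mulr1 subrr.
have qq : dotp q q = sin (acos c) ^+ 2.
  rewrite sin2cos2 acosK ?in_itv// /q !dotpE vv yy (dotpC y v) -/c; ring.
have qs : enorm q = sin (acos c).
  by apply/eqP; rewrite -(@eqrXn2 _ 2) ?enorm_ge0 ?sin_ge0_pi// enorm_sqr qq.
have [q0|q0] := eqVneq q 0.
  have [w w1 vw] := exists_unit_orthogonal N2 v1.
  exists w, (acos c); split=> //; rewrite -qs q0 enorm0 scale0r addr0 acosK ?in_itv//.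
  by apply/eqP; rewrite -subr_eq0 -/q q0.
exists ((enorm q)^-1 *: q), (acos c); split => //.
- by rewrite enormZ ger0_norm ?invr_ge0 ?enorm_ge0// mulVf// enorm_eq0.
- by rewrite dotpZr qv mulr0.
- by rewrite -qs scalerA mulfV ?enorm_eq0// scale1r acosK ?in_itv// /q addrC subrK.
Qed.

(** The rotations [rho t] of the plane of [v] and [y], with angle [a] from [v] to
    [y].  The bound of [a] by twice the chord limits the number of steps needed
    to cover the arc.  In the component of [z rho(a) - z] along [v], the factor
    [1 - cos a] is half the square of the chord. *)
Lemma rotation_between v y : (2 <= N)%N -> enorm v = 1 -> enorm y = 1 ->
  exists (rho : R -> 'M[R]_N) (a : R) w,
  [/\ forall t, orthogonal (rho t),
      rho 0 = 1%:M, v *m rho a = y &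
      [/\ 0 <= a, a <= 2 * enorm (y - v) /\ a <= pi,
          forall t t' z, 0 <= t - t' <= pi ->
            enorm (z *m rho t - z *m rho t') <= (t - t') * enorm z,
          forall z, enorm (z *m rho a - z) <= enorm (y - v) * enorm z &
          [/\ enorm w = 1, dotp v w = 0 & forall z,
            dotp (z *m rho a - z) v =
            - (enorm (y - v) ^+ 2 / 2) * dotp z v - sin a * dotp z w]]].
Proof.
move=> N2 v1 y1; have [w [a [w1 vw /andP[a0 api] yE]]] := polar_decomposition N2 v1 y1.
have vv := dotp_enorm1 v1; have ww := dotp_enorm1 w1.
have wv : dotp w v = 0 by rewrite dotpC.
have mE t z := mul_rot_mx v w t z.
have r0 : rot_mx v w 0 = 1%:M.
  by rewrite /rot_mx cos0 sin0 subrr !scale0r subr0 !addr0.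
have dE : enorm (y - v) ^+ 2 = 2 - 2 * cos a.
  rewrite yE enorm_sqr !dotpE vv ww vw wv.
  transitivity (cos a ^+ 2 + sin a ^+ 2 + 1 - 2 * cos a); first by ring.
  by rewrite cos2Dsin2; ring.
exists (rot_mx v w), a, w; split => //.
- by move=> t; exact: orthogonal_rot_mx.
- rewrite mE /rot_vec vv vw !mulr0 subr0 addr0 !mulr1 yE; congr (_ + _).
  by rewrite scalerBl scale1r addrC subrK.
split=> //.
- split=> //; rewrite -(@ler_pXn2r _ 2) ?nnegrE ?mulr_ge0 ?enorm_ge0//.
  rewrite exprMn dE; have e4 : 2 ^+ 2 = 4 :> R by ring.
  by rewrite e4 arc_le_chord// a0.
- move=> t t' z htt; rewrite !mE -(@ler_pXn2r _ 2) ?nnegrE ?mulr_ge0 ?enorm_ge0//.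
    apply: le_trans (rot_vec_dist_sqr vv ww vw _ _ _) _.
    by rewrite exprMn ler_wpM2r ?sqr_ge0// chord_le_arc.
  by case/andP: htt.
- move=> z; rewrite -[X in _ - X]mulmx1 -r0 !mE.
  rewrite -(@ler_pXn2r _ 2) ?nnegrE ?mulr_ge0 ?enorm_ge0//.
  apply: le_trans (rot_vec_dist_sqr vv ww vw _ _ _) _.
  by rewrite subr0 exprMn dE.
- by split=> // z; rewrite dotpDl dotpNl mE dotp_rot_vecv// dE; field.
Qed.

Lemma exists_orthogonal v y : (2 <= N)%N -> enorm v = 1 -> enorm y = 1 ->
  exists2 M : 'M[R]_N, orthogonal M & v *m M = y.
Proof.
move=> N2 v1 y1; have [rho [a [w [h1 _ h2 _]]]] := rotation_between N2 v1 y1.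
by exists (rho a).
Qed.

End rotation_between.

(** * Moments over cones *)

Section cap_moments.
Context {R : realType} {N : nat}.
Variables (s al : R).
Hypothesis N2 : (2 <= N)%N.
Hypothesis s01 : 0 < s < 1.
Hypothesis hal : 0 < al <= pi / 2.
Implicit Types (y z w : 'rV[R]_N).
Local Open Scope ereal_scope.
Notation leb := (@lebesgue_measure R).
Notation sigma := (@surface_measure R N).
Notation e0 := (stdbasis 0 : 'rV[R]_N).
Notation C := (cNs N s).
Notation area := (@cap_area R N al).

Let N0 : (0 < N)%N. Proof. exact: leq_trans N2. Qed.

Let i0 : 'I_N := Ordinal N0.

Lemma enorm_stdbasis (k : 'I_N) : enorm (stdbasis k : 'rV[R]_N) = 1%R.
Proof. by rewrite /enorm dotp_stdbasis mxE eqxx sqrtr1. Qed.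

Let capE : @cap R N al = ccap al e0. Proof. exact: cap_ccap. Qed.

Lemma measurable_cap : measurable (@cap R N al).
Proof. by rewrite capE; exact: measurable_ccap. Qed.

Lemma cap_areaE : sigma (cap al) = area%:E.
Proof. by rewrite fineK// surface_measure_fin//; exact: measurable_cap. Qed.

(** Orthogonal maps act transitively on the sphere, so that integrals over the
    cone around [y] of functions of [|z|] and [<z, y>] do not depend on [y]. *)
Lemma ge0_integral_shell_transport y (B : set R) (f : R -> R -> \bar R) :
  enorm y = 1%R -> measurable B ->
  measurable_fun setT (fun z : 'rV[R]_N => f (enorm z) (dotp z y)) ->
  (forall a b, 0 <= f a b) ->
  \int[@mu_s R N s]_(z in shell (ccap al y) B) f (enorm z) (dotp z y) =
  \int[@mu_s R N s]_(z in shell (ccap al e0) B) f (enorm z) (dotp z e0).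
Proof.
move=> y1 mB mf f0.
have [M oM ME] := exists_orthogonal N2 (enorm_stdbasis i0) y1.
have mS : measurable (shell (ccap al y) B) by apply: measurable_shell => //; exact: measurable_ccap.
rewrite (ge0_integral_mu_s_orthogonal s01 oM)//; last exact: measurable_funTS.
rewrite -{1}ME shell_orthogonal//; apply: eq_integral => z _.
by rewrite enorm_orthogonal// -ME dotp_orthogonal.
Qed.

Lemma radial_moment y (B : set R) (k c : R) : enorm y = 1%R ->
  measurable B -> B `<=` `]0%R, +oo[ ->
  \int[leb]_(t in B) (t `^ (k - 2 * s - 1))%:E = c%:E ->
  \int[@mu_s R N s]_(z in shell (ccap al y) B) (enorm z `^ k)%:E = (C * area * c)%:E.
Proof.
move=> y1 mB B0 cE.
rewrite (@ge0_integral_shell_transport y B (fun a _ => (a `^ k)%:E))//; last 2 first.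
- apply/measurable_EFinP.
  exact: (measurableT_comp (@measurable_powR R _) measurable_enorm).
- by move=> a _; rewrite lee_fin powR_ge0.
rewrite integral_mu_s_shell//; last exact: measurable_ccap.
by rewrite -capE cap_areaE cE -!EFinM.
Qed.

Definition cap_moment (k : nat) : \bar R :=
  \int[sigma]_(w in cap al) (dotp w (stdbasis k) ^+ 2)%:E.

Let meas_dotp2 (y : 'rV[R]_N) : measurable_fun setT (fun w => (dotp w y ^+ 2)%:E).
Proof.
apply/measurable_EFinP; apply: measurable_funX.
have -> : (fun w : 'rV[R]_N => dotp w y) = dotp y by apply/funext => w; exact: dotpC.
exact: measurable_dotp.
Qed.

Lemma angular_moment_stdbasis (B : set R) (k c : R) (j : nat) :
  measurable B -> B `<=` `]0%R, +oo[ ->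
  \int[leb]_(t in B) (t `^ (k - 2 * s - 1))%:E = c%:E ->
  \int[@mu_s R N s]_(z in shell (ccap al e0) B)
     ((enorm z `^ k)%:E * (dotp (normalize z) (stdbasis j) ^+ 2)%:E) =
  (C * c)%:E * cap_moment j.
Proof.
move=> mB B0 cE.
rewrite (@integral_mu_s_shell_angular R N s N0 s01 (ccap al e0) B k c
  (fun z => (dotp z (stdbasis j) ^+ 2)%:E))//.
- by rewrite /cap_moment capE.
- exact: measurable_ccap.
- by move=> z; rewrite lee_fin sqr_ge0.
Qed.

Lemma cap_moment_fin k : (k < N)%N -> 0 <= cap_moment k <= area%:E.
Proof.
move=> kN; apply/andP; split; first by apply: integral_ge0 => z _; rewrite lee_fin sqr_ge0.
rewrite -cap_areaE -[leRHS]mul1e -integral_cst//; last exact: measurable_cap.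
apply: ge0_le_integral => //.
- exact: measurable_cap.
- by move=> z _; rewrite lee_fin sqr_ge0.
- exact: measurable_funTS.
- move=> z [z1 _]; rewrite lee_fin -real_normK ?num_real// expr_le1//.
  by rewrite (@dotp_stdbasis R N z (Ordinal kN)) -z1 coord_le_enorm.
Qed.

(** Transposing two coordinates other than the first one preserves the cap. *)
Lemma cap_moment_sym k : (0 < k < N)%N -> cap_moment k = cap_moment 1.
Proof.
move=> /andP[k0 kN]; pose i1 : 'I_N := Ordinal N2; pose ik : 'I_N := Ordinal kN.
(* Any set of radii with a positive finite integral would do: the moments are
   recovered from the integrals over the shell, on which isometries act. *)
pose B : set R := `]1%R, 2%R]%classic.
have mB : measurable B by exact: measurable_itv.
have B0 : B `<=` `]0%R, +oo[.
  by move=> t; rewrite /B/= !in_itv/= andbT => /andP[/(lt_trans ltr01)].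
have s1 : (0 < 2 * s)%R by case/andP: s01 => s0 _; rewrite mulr_gt0.
pose c : R := ((2 `^ (0 - 2 * s) - 1 `^ (0 - 2 * s)) / (0 - 2 * s))%R.
have cE : \int[leb]_(t in B) (t `^ (0 - 2 * s - 1))%:E = c%:E.
  by apply: integral_powR => //; [rewrite sub0r oppr_eq0 gt_eqF|rewrite ler1n].
have c0 : (0 < c)%R.
  rewrite /c powR1 sub0r -mulrNN -invrN opprK opprB divr_gt0//.
  rewrite subr_gt0 powRN invf_lt1 ?powR_gt0//.
  by rewrite -[X in (X < _)%R](powRr0 2) /powR !gt_eqF// mul0r ltr_expR mulr_gt0// ln_gt0// ltr1n.
pose M : 'M[R]_N := perm_mx (tperm i1 ik).
have oM : orthogonal M.
  by rewrite /orthogonal tr_perm_mx -perm_mxM mulgV perm_mx1.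
have zM z (j : 'I_N) : (z *m M) ord0 j = z ord0 (tperm i1 ik j).
  by rewrite /M -[X in perm_mx X]invgK -col_permE mxE tpermV.
have e0M : e0 *m M = e0.
  apply/rowP => j; rewrite zM !mxE; case: tpermP => // ->; rewrite /= ?(gtn_eqF k0)//.
have C1 : (0 < C * c)%R by rewrite mulr_gt0// cNs_gt0.
apply: (@pmuleI _ (C * c)%:E); first by rewrite lte_fin C1 ltry.
rewrite -!(angular_moment_stdbasis _ mB B0 cE).
have mS : measurable (shell (ccap al e0) B) by apply: measurable_shell => //; exact: measurable_ccap.
have mF j : measurable_fun setT (fun z : 'rV[R]_N =>
    (enorm z `^ 0)%:E * (dotp (normalize z) (stdbasis j) ^+ 2)%:E).
  apply: emeasurable_funM.
    apply/measurable_EFinP.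
    exact: (measurableT_comp (@measurable_powR R _) measurable_enorm).
  exact: (measurableT_comp (meas_dotp2 (stdbasis j)) (@measurable_normalize R N)).
rewrite (ge0_integral_mu_s_orthogonal s01 oM mS); last 2 first.
- exact: measurable_funTS.
- by move=> z _; rewrite mule_ge0 ?lee_fin ?powR_ge0 ?sqr_ge0.
rewrite -{1}e0M shell_orthogonal//; apply: eq_integral => z _.
rewrite !powRr0 /normalize enorm_orthogonal// scalemxAl.
rewrite (@dotp_stdbasis _ _ _ ik) (@dotp_stdbasis _ _ _ i1).
by rewrite zM tpermR.
Qed.

(** The squares of the coordinates add up to one on the sphere. *)
Lemma cap_moment_sum : cap_moment 0 + (N.-1)%:R%:E * cap_moment 1 = area%:E.
Proof.
have -> : (N.-1)%:R%:E * cap_moment 1 = \sum_(1 <= k < N) cap_moment k.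
  rewrite (eq_big_nat _ _ (F2 := fun=> cap_moment 1)); last first.
    by move=> k /andP[k1 kN]; apply: cap_moment_sym; rewrite k1.
  by rewrite sumr_const_nat subn1; exact: mule_natl.
rewrite -big_ltn// big_mkord /cap_moment -ge0_integral_sum; [|exact: measurable_cap|
  by move=> k; exact: measurable_funTS|by move=> k z _; rewrite lee_fin sqr_ge0].
rewrite -cap_areaE -[RHS]mul1e -integral_cst//; last exact: measurable_cap.
apply: eq_integral => z /[!inE] -[z1 _].
rewrite sumEFin /=; congr _%:E.
under eq_bigr do rewrite dotp_stdbasis expr2.
by have := enorm_sqr z; rewrite z1 expr1n.
Qed.

(** The equation for the angle says that the first moment is [p - 1] times the
    second one; together with the value of the sum of all moments, of which
    all but the first are equal, it determines both.  It also forces the cap to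
    have positive area: a vanishing denominator would make [p - 1] zero. *)
Lemma cap_area_gt0 p : (2 <= p)%R -> @is_alpha R N p al ->
  (0 < area)%R /\ cap_moment 0 = (area * ((p - 1) / (N%:R + p - 2)))%:E.
Proof.
move=> p2 [_]; rewrite /Rintegral -!/(cap_moment _).
have := cap_moment_sum.
have /andP[m00 m01] := cap_moment_fin N0; have /andP[m10 m11] := cap_moment_fin N2.
have f0 : cap_moment 0 \is a fin_num by rewrite ge0_fin_numE// (le_lt_trans m01)// ltry.
have f1 : cap_moment 1 \is a fin_num by rewrite ge0_fin_numE// (le_lt_trans m11)// ltry.
rewrite -(fineK f0) -(fineK f1) -EFinM -EFinD => -[].
have : (0 <= fine (cap_moment 1))%R by rewrite fine_ge0.
set a := fine (cap_moment 0); set b := fine (cap_moment 1) => b0 sE pE.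
have b1 : (0 < b)%R.
  rewrite lt_neqAle b0 andbT; apply/eqP => bE.
  by move: pE; rewrite -bE invr0 mulr0; lra.
have aE : (a = (p - 1) * b)%R by rewrite pE divfK// gt_eqF.
have NE : (N.-1%:R = N%:R - 1 :> R)%R.
  by rewrite -[in RHS](prednK N0) -natr1 addrK.
have N1 : (2 <= N%:R :> R)%R by rewrite ler_nat.
rewrite NE in sE.
split; first by rewrite -sE aE -mulrDl mulr_gt0//; lra.
congr _%:E; rewrite -sE aE; field; rewrite gt_eqF//; lra.
Qed.

End cap_moments.

Section first_moment.
Context {R : realType} {N : nat}.
Variables (s al : R).
Hypothesis N2 : (2 <= N)%N.
Hypothesis s01 : 0 < s < 1.
Hypothesis hal : 0 < al <= pi / 2.
Implicit Types (y z w : 'rV[R]_N).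
Notation leb := (@lebesgue_measure R).
Notation C := (cNs N s).
Notation area := (@cap_area R N al).
Notation mu := (@mu_s R N s).
Notation sec y B := (shell (ccap al y) B).

Lemma measurable_sec y (B : set R) : measurable B -> measurable (sec y B).
Proof. by move=> mB; apply: measurable_shell => //; exact: measurable_ccap. Qed.

Lemma measurable_enormX n : measurable_fun setT (fun z : 'rV[R]_N => enorm z ^+ n).
Proof. by apply: measurable_funX; exact: measurable_enorm. Qed.

Lemma integral_enormX y (B : set R) n c : enorm y = 1 -> measurable B ->
  B `<=` `]0%R, +oo[ ->
  (\int[leb]_(t in B) (t `^ (n%:R - 2 * s - 1))%:E = c%:E)%E ->
  (\int[mu]_(z in sec y B) (enorm z ^+ n)%:E = (C * area * c)%:E)%E.
Proof.
move=> y1 mB B0 cE; rewrite -(radial_moment N2 s01 hal y1 mB B0 cE).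
by apply: eq_integral => z _; rewrite powR_mulrn// enorm_ge0.
Qed.

Lemma integrable_enormX y (B : set R) n c : enorm y = 1 -> measurable B ->
  B `<=` `]0%R, +oo[ ->
  (\int[leb]_(t in B) (t `^ (n%:R - 2 * s - 1))%:E = c%:E)%E ->
  mu.-integrable (sec y B) (fun z => (enorm z ^+ n)%:E).
Proof.
move=> y1 mB B0 cE; apply/integrableP; split.
  by apply/measurable_EFinP/measurable_funTS; exact: measurable_enormX.
under eq_integral do rewrite gee0_abs ?lee_fin ?exprn_ge0 ?enorm_ge0//.
by rewrite (integral_enormX y1 mB B0 cE) ltry.
Qed.

Lemma measurable_dotpl y : measurable_fun setT (fun z => dotp z y).
Proof.
have -> : (fun z : 'rV[R]_N => dotp z y) = dotp y by apply/funext => w; exact: dotpC.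
exact: measurable_dotp.
Qed.

Section with_shell.
Variables (v : 'rV[R]_N) (B : set R) (c : R).
Hypothesis v1 : enorm v = 1.
Hypothesis mB : measurable B.
Hypothesis B0 : B `<=` `]0%R, +oo[.
Hypothesis cE : (\int[leb]_(t in B) (t `^ (1%:R - 2 * s - 1))%:E = c%:E)%E.

Let mS : measurable (sec v B) := measurable_sec v mB.

Let int1 : mu.-integrable (sec v B) (fun z => (enorm z)%:E).
Proof. exact: (integrable_enormX v1 mB B0 cE). Qed.

Lemma integrable_dotp w : mu.-integrable (sec v B) (fun z => (dotp z w)%:E).
Proof.
have h : mu.-integrable (sec v B) (fun z => (enorm w)%:E * (enorm z)%:E)%E.
  exact: integrableZl.
apply: le_integrable h => //.
  by apply/measurable_EFinP/measurable_funTS; exact: measurable_dotpl.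
move=> z _; rewrite abse_EFin -EFinM abse_EFin lee_fin [leRHS]ger0_norm ?mulr_ge0 ?enorm_ge0//.
by rewrite mulrC dotp_le_enorm.
Qed.

(** The reflection across the hyperplane orthogonal to [w] preserves the cone
    around [v] and changes the sign of the integrand. *)
Lemma integral_dotp_orthogonal w : enorm w = 1 -> dotp v w = 0 ->
  \int[mu]_(z in sec v B) dotp z w = 0.
Proof.
move=> w1 vw; have ww := dotp_enorm1 w1.
pose M : 'M[R]_N := 1%:M - 2 *: (w^T *m w).
have zM z : z *m M = z - (2 * dotp z w) *: w.
  rewrite mulmxBr mulmx1 -scalemxAr mulmxA [z *m w^T]mx11_scalar mul_scalar_mx -dotp_mx.
  by rewrite scalerA.
have MT : M^T = M.
  by rewrite /M linearB/= trmx1 linearZ/= trmx_mul trmxK.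
have oM : orthogonal M.
  rewrite /orthogonal MT; apply/row_matrixP => i.
  rewrite row_mul !rowE mulmx1 !zM !dotpE ww; apply/rowP => j; rewrite !mxE; ring.
have vM : v *m M = v by rewrite zM vw mulr0 scale0r subr0.
have int := integrable_dotp w.
set I := \int[mu]_(z in _) _.
have : I = - I.
  rewrite {1}/I /Rintegral (integral_mu_s_orthogonal s01 oM mS); last first.
    by apply/measurable_EFinP/measurable_funTS; exact: measurable_dotpl.
  rewrite -{1}vM shell_orthogonal//.
  rewrite -mulN1r /I -RintegralZl//; congr fine; apply: eq_integral => z _.
  by congr _%:E; rewrite zM !dotpE ww; ring.
lra.
Qed.

(** On the cone [0 <= <z, v> <= |z|], because its aperture is at most a right
    angle; hence [<z, v>] dominates [<z, v>^2 / |z|], whose integral is the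
    second moment. *)
Lemma integral_dotp_ge p : 2 <= p -> @is_alpha R N p al ->
  C * area * c * ((p - 1) / (N%:R + p - 2)) <= \int[mu]_(z in sec v B) dotp z v.
Proof.
move=> p2 halpha; have [area0 m0] := cap_area_gt0 N2 s01 hal p2 halpha.
have mn : measurable_fun setT (fun z : 'rV[R]_N => (enorm z)^-1).
  rewrite (_ : (fun _ => _) = fun z : 'rV[R]_N => enorm z `^ (-1)).
    exact: (measurableT_comp (@measurable_powR R _) measurable_enorm).
  by apply/funext => z; rewrite powR_inv1// enorm_ge0.
pose f (a b : R) : \bar R := ((a `^ 1)%:E * (((a^-1 * b) ^+ 2))%:E)%E.
have mf y : measurable_fun setT (fun z : 'rV[R]_N => f (enorm z) (dotp z y)).
  apply: emeasurable_funM; apply/measurable_EFinP.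
    exact: (measurableT_comp (@measurable_powR R _) measurable_enorm).
  apply: measurable_funX; apply: measurable_funM => //; exact: measurable_dotpl.
have fE : (\int[mu]_(z in sec v B) f (enorm z) (dotp z v) =
    (C * area * c * ((p - 1) / (N%:R + p - 2)))%:E)%E.
  rewrite (ge0_integral_shell_transport al N2 s01 v1)//; last first.
    by move=> a b; rewrite mule_ge0// lee_fin ?powR_ge0 ?sqr_ge0.
  under eq_integral do rewrite /f -dotpZl.
  rewrite (angular_moment_stdbasis N2 s01 hal 0 mB B0 cE) m0 -EFinM.
  by congr _%:E; ring.
rewrite -[leLHS]/(fine (_%:E)) -fE /Rintegral fine_le//.
- by rewrite fE.
- by apply: integrable_fin_num => //; exact: integrable_dotp.
apply: ge0_le_integral => //.
- by move=> z _; rewrite mule_ge0// lee_fin ?powR_ge0 ?sqr_ge0.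
- exact: measurable_funTS.
- by apply/measurable_EFinP/measurable_funTS; exact: measurable_dotpl.
- move=> z [[z0 [n1 nc]] _]; rewrite /f -EFinM lee_fin powRr1 ?enorm_ge0//.
  have d1 : dotp v (normalize z) <= 1 by have := dotp_le v (normalize z); rewrite v1 n1 mulr1.
  have cos0 : 0 <= cos al.
    by rewrite cos_ge0_pihalf//; case/andP: hal => h1 h2; rewrite h2 andbT; have := pi_gt0 R; lra.
  rewrite -dotpZl -/(normalize z) (dotpC (normalize z)).
  have zE : dotp z v = enorm z * dotp v (normalize z).
    by rewrite dotpZr mulrA mulfV ?gt_eqF// mul1r dotpC.
  rewrite zE ler_pM2l// expr2 ler_piMl//; lra.
Qed.

End with_shell.
End first_moment.

(** * Comparison of the integrals over two cones *)

Section shell_constants.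
Context {R : realType}.
Variables (s eps r : R).
Hypothesis hs : 2^-1 < s < 1.
Hypothesis heps : 0 < eps < r.
Notation leb := (@lebesgue_measure R).

Let s1 : 1 - 2 * s < 0. Proof. case/andP: hs; lra. Qed.
Let s2 : 0 < 2 - 2 * s. Proof. case/andP: hs; lra. Qed.
Let s3 : - (2 * s) < 0. Proof. case/andP: hs; lra. Qed.
Let e0 : 0 < eps. Proof. by case/andP: heps. Qed.
Let er : eps < r. Proof. by case/andP: heps. Qed.
Let r0 : 0 < r. Proof. exact: lt_trans er. Qed.

Lemma integral_annulus (q : R) : q != 0 ->
  (\int[leb]_(t in `]eps, r[) (t `^ (q - 1))%:E = ((r `^ q - eps `^ q) / q)%:E)%E.
Proof.
move=> q0; rewrite integral_itv_bndo_bndc; last first.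
  by apply/measurable_EFinP/measurable_funTS; exact: measurable_powR.
by rewrite integral_powR// ltW.
Qed.

(** The exponents are written with [0%:R], [1%:R], [2%:R] so as to match the
    integrals of the powers of [|z|] over shells. *)
Lemma integral_annulus_linear : (\int[leb]_(t in `]eps, r[) (t `^ (1%:R - 2 * s - 1))%:E =
  ((eps `^ (1 - 2 * s) - r `^ (1 - 2 * s)) / (2 * s - 1))%:E)%E.
Proof.
rewrite integral_annulus ?lt_eqF//; congr _%:E.
rewrite mulr1n -[RHS]mulrNN -invrN !opprB; congr (_ / _); ring.
Qed.

Lemma integral_annulus_quadratic : (\int[leb]_(t in `]eps, r[) (t `^ (2%:R - 2 * s - 1))%:E =
  ((r `^ (2 - 2 * s) - eps `^ (2 - 2 * s)) / (2 - 2 * s))%:E)%E.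
Proof. by rewrite integral_annulus ?gt_eqF. Qed.

Lemma integral_core_quadratic : (\int[leb]_(t in `]0%R, eps]) (t `^ (2%:R - 2 * s - 1))%:E =
  (eps `^ (2 - 2 * s) / (2 - 2 * s))%:E)%E.
Proof. by rewrite integral_powR0. Qed.

Lemma integral_tail_const a : 0 < a -> (\int[leb]_(t in `]a, +oo[) (t `^ (0%:R - 2 * s - 1))%:E =
  (a `^ (- (2 * s)) / (2 * s))%:E)%E.
Proof.
move=> a0; rewrite sub0r integral_powRy//; congr _%:E.
by rewrite mulNr invrN mulrN opprK.
Qed.

Lemma integral_tail_linear : (\int[leb]_(t in `]r, +oo[) (t `^ (1%:R - 2 * s - 1))%:E =
  (r `^ (1 - 2 * s) / (2 * s - 1))%:E)%E.
Proof.
rewrite integral_powRy//; congr _%:E.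
by rewrite mulNr -mulrN -invrN opprB.
Qed.

Lemma integral_radius_const : (\int[leb]_(t in [set r]) (t `^ (0%:R - 2 * s - 1))%:E = 0%:E)%E.
Proof. by rewrite integral_set1. Qed.

Lemma annulus_gt0 : `]eps, r[%classic `<=` `](0 : R), +oo[%classic.
Proof. by move=> t /=; rewrite !in_itv/= andbT => /andP[/(lt_trans e0)]. Qed.

Lemma core_gt0 : `]0, eps]%classic `<=` `](0 : R), +oo[%classic.
Proof. by move=> t /=; rewrite !in_itv/= andbT => /andP[]. Qed.

Lemma tail_gt0 (a : R) : 0 < a -> `]a, +oo[%classic `<=` `](0 : R), +oo[%classic.
Proof. by move=> a0 t /=; rewrite !in_itv/= !andbT => /(lt_trans a0). Qed.

Lemma radius_gt0 : [set r] `<=` `](0 : R), +oo[%classic.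
Proof. by move=> t /= ->; rewrite in_itv/= andbT. Qed.

End shell_constants.

Section chain.
Context {R : realType} {N : nat}.
Variables (u : 'rV[R]_N -> R) (x : 'rV[R]_N) (r d W : R).
Hypothesis N2 : (2 <= N)%N.
Hypothesis d0 : 0 < d.
Hypothesis W0 : 0 <= W.
Hypothesis far : forall a b, r < enorm (a - x) -> r < enorm (b - x) ->
  enorm (a - b) <= d -> u a - u b <= W.

(** The segment from [x + z] to its image may cross the ball; the arc does not.
    It is covered by at most [2 (1 + |z|)] steps of length at most [d]. *)
Lemma arc_difference_le (rho : R -> 'M[R]_N) (a : R) (z : 'rV[R]_N) :
  (forall t, orthogonal (rho t)) -> rho 0 = 1%:M ->
  0 <= a -> a <= 2 * d -> a <= pi ->
  (forall t t' z, 0 <= t - t' <= pi ->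
     enorm (z *m rho t - z *m rho t') <= (t - t') * enorm z) ->
  r < enorm z ->
  u (x + z *m rho a) - u (x + z) <= 2 * (1 + enorm z) * W.
Proof.
move=> orho rho0 a0 ad api step rz.
have z0 : 0 <= enorm z := enorm_ge0 z.
(* Covering an arc of length a |z| by steps of length d takes q steps. *)
pose q := a * enorm z / d.
have q0 : 0 <= q by rewrite divr_ge0 ?mulr_ge0// ltW.
pose n := (Num.truncn q).+1.
have n0 : 0 < n%:R :> R by rewrite ltr0n.
have qn : q < n%:R by exact: truncnS_gt.
have nq : n%:R <= q + 1 by rewrite /n -natr1 lerD2r truncn_le.
have n1 : 1 <= n%:R :> R by rewrite ler1n.
pose g k := u (x + z *m rho (a / n%:R * k%:R)).
have -> : u (x + z *m rho a) - u (x + z) = \sum_(0 <= k < n) (g k.+1 - g k).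
  by rewrite telescope_sumr// /g mulr0 rho0 mulmx1 divfK ?gt_eqF.
apply: (@le_trans _ _ (\sum_(0 <= k < n) W)).
  apply: ler_sum => k _; apply: far.
  - by rewrite addrC addKr enorm_orthogonal.
  - by rewrite addrC addKr enorm_orthogonal.
  - rewrite opprD addrACA subrr add0r.
    have tE : a / n%:R * k.+1%:R - a / n%:R * k%:R = a / n%:R.
      by rewrite -mulrBr -natr1 addrAC subrr add0r mulr1.
    have tpi : 0 <= a / n%:R <= pi.
      rewrite divr_ge0 ?(ltW n0)//=; apply: le_trans api.
      by rewrite ler_pdivrMr// ler_peMr.
    apply: le_trans (step _ _ _ _) _; rewrite tE//.
    by rewrite mulrAC ler_pdivrMr// (mulrC d) -ler_pdivrMr// ltW.
rewrite sumr_const_nat subn0 -[X in X <= _]mulr_natl ler_wpM2r// (le_trans nq)//.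
have : q <= 2 * enorm z.
  by rewrite /q ler_pdivrMr// mulrAC ler_wpM2r.
lra.
Qed.

End chain.

Section integrable_real.
Context d (T : measurableType d) (R : realType) (mu : {measure set T -> \bar R}).
Variables (D : set T) (mD : measurable D).
Implicit Types f g : T -> R.

Lemma integrable_realD f g : mu.-integrable D (EFin \o f) ->
  mu.-integrable D (EFin \o g) -> mu.-integrable D (EFin \o (fun z => f z + g z)).
Proof. by move=> i1 i2; exact: (integrableD mD i1 i2). Qed.

Lemma integrable_realZ c f : mu.-integrable D (EFin \o f) ->
  mu.-integrable D (EFin \o (fun z => c * f z)).
Proof. by move=> i1; exact: (integrableZl mD c i1). Qed.

End integrable_real.

Section core.
Context {R : realType} {N : nat}.
Variables (s al p eps r : R).
Hypothesis N2 : (2 <= N)%N.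
Hypothesis hs : 2^-1 < s < 1.
Hypothesis hal : 0 < al <= pi / 2.
Hypothesis p2 : 2 <= p.
Hypothesis halpha : @is_alpha R N p al.
Hypothesis heps : 0 < eps < r.
Implicit Types (y z w : 'rV[R]_N).
Notation C := (cNs N s).
Notation area := (@cap_area R N al).
Notation mu := (@mu_s R N s).
Notation sec y B := (shell (ccap al y) B).
Notation gamma := ((p - 1) / (N%:R + p - 2)).

Let s01 : 0 < s < 1. Proof. by case/andP: hs => h1 ->; rewrite andbT; lra. Qed.
Let e0 : 0 < eps. Proof. by case/andP: heps. Qed.
Let er : eps < r. Proof. by case/andP: heps. Qed.
Let r0 : 0 < r. Proof. exact: lt_trans er. Qed.

Lemma bounded_integrable_sec y a (f : 'rV[R]_N -> R) (b : R) : enorm y = 1 -> 0 < a ->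
  measurable_fun setT f -> (forall z, `|f z| <= b) ->
  mu.-integrable (sec y `]a, +oo[) (EFin \o f).
Proof.
move=> y1 a0 mf fb.
have h := integrable_enormX N2 s01 hal y1 (measurable_itv `]a, +oo[) (tail_gt0 a0) (integral_tail_const hs a0).
have hb : mu.-integrable (sec y `]a, +oo[) (fun z => b%:E * (enorm z ^+ 0)%:E)%E.
  by apply: integrableZl h; apply: measurable_sec.
apply: le_integrable hb.
- by apply: measurable_sec; exact: measurable_itv.
- exact/measurable_EFinP/measurable_funTS.
- move=> z _; rewrite -EFinM expr0 mulr1 /= lee_fin.
  exact: le_trans (fb z) (ler_norm b).
Qed.

Lemma sphere_negligible y : enorm y = 1 -> mu (sec y [set r]) = 0%E.
Proof.
move=> y1; have := integral_enormX N2 s01 hal y1 (measurable_set1 r)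
  (radius_gt0 heps) (integral_radius_const s r).
rewrite mulr0; under eq_integral do rewrite expr0.
by rewrite integral_cst ?mul1e//; apply: measurable_sec; exact: measurable_set1.
Qed.

Lemma sec_split y : sec y `]eps, +oo[ =
  sec y `]eps, r[ `|` (sec y [set r] `|` sec y `]r, +oo[).
Proof.
rewrite -!setIUr -!preimage_setU; congr (_ `&` _ @^-1` _).
apply/seteqP; split=> t /=; rewrite !in_itv/= !andbT.
  by move=> ->; case: (ltgtP t r); [left|right; right|right; left].
by case=> [/andP[]//|[->//|/(lt_trans er)]].
Qed.

Variables (u : 'rV[R]_N -> R) (x : 'rV[R]_N) (Mb K W : R) (q v y : 'rV[R]_N).
Hypothesis mu_u : measurable_fun setT u.
Hypothesis u_bound : forall z, `|u z| <= Mb.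
Hypothesis v1 : enorm v = 1.
Hypothesis y1 : enorm y = 1.
Hypothesis qE : q = enorm q *: v.
Let d := enorm (y - v).
Hypothesis d0 : 0 < d.
Hypothesis W0 : 0 <= W.
Hypothesis near : forall z z', enorm z < r -> enorm z' = enorm z ->
  u (x + z') - u (x + z) - dotp (z' - z) q <= 2 * K * enorm z * enorm (z' - z).
Hypothesis far : forall a b, r < enorm (a - x) -> r < enorm (b - x) ->
  enorm (a - b) <= d -> u a - u b <= W.
Hypothesis K0 : 0 <= K.

Let F y := \int[mu]_(z in sec y `]eps, +oo[) u (x + z).

Let mux (M : 'M[R]_N) : measurable_fun setT (fun z : 'rV[R]_N => u (x + z *m M)).
Proof.
apply: (measurableT_comp mu_u); apply: measurable_rVD => //.
exact: measurable_rVmulmx.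
Qed.

Let mux1 : measurable_fun setT (fun z : 'rV[R]_N => u (x + z)).
Proof.
apply: (measurableT_comp mu_u); exact: measurable_rVD.
Qed.

(** After rotating the cone around [y] onto the one around [v], the increment of [u]
    is estimated on the annulus by the expansion at [x], where the part linear
    in [z] has a negative integral of order [d^2], and on the tail by steps
    along the arc. *)
Lemma integral_cone_difference_le :
  F y - F v <= C * area *
    (- (enorm q * (d ^+ 2 / 2) * (gamma * ((eps `^ (1 - 2 * s) - r `^ (1 - 2 * s)) / (2 * s - 1))))
     + 2 * K * d * ((r `^ (2 - 2 * s) - eps `^ (2 - 2 * s)) / (2 - 2 * s))
     + 2 * W * (r `^ (- (2 * s)) / (2 * s) + r `^ (1 - 2 * s) / (2 * s - 1))).
Proof.
have [rho [a [w [orho rho0 va [a0 [ad api] step chord [w1 vw dv]]]]]] :=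
  rotation_between N2 v1 y1.
have mS B : measurable B -> measurable (sec v B) := @measurable_sec R N al v B.
set Be := `]eps, +oo[%classic; set Bn := `]eps, r[%classic; set Bf := `]r, +oo[%classic.
have mBe : measurable Be by exact: measurable_itv.
have mBn : measurable Bn by exact: measurable_itv.
have mBf : measurable Bf by exact: measurable_itv.
pose D z := u (x + z *m rho a) - u (x + z).
have FyE : F y = \int[mu]_(z in sec v Be) u (x + z *m rho a).
  rewrite /F /Rintegral -va (integral_mu_s_orthogonal s01 (orho a)).
  - by rewrite shell_orthogonal.
  - exact: measurable_sec.
  - by apply/measurable_EFinP/measurable_funTS.
have iu1 : mu.-integrable (sec v Be) (EFin \o fun z => u (x + z *m rho a)).
  exact: (bounded_integrable_sec v1 e0).
have iu2 : mu.-integrable (sec v Be) (EFin \o fun z => u (x + z)).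
  exact: (bounded_integrable_sec v1 e0).
have iD : mu.-integrable (sec v Be) (EFin \o D).
  by rewrite /D; apply: (integrableB (mS _ mBe) iu1 iu2).
have -> : F y - F v = \int[mu]_(z in sec v Be) D z.
  by rewrite FyE -RintegralB//; exact: mS.
have iDS B : measurable B -> B `<=` Be -> mu.-integrable (sec v B) (EFin \o D).
  move=> mB BB; apply: integrableS iD; [exact: mS|exact: mS|].
  by move=> z [h1 h2]; split=> //; exact: BB.
have BnBe : Bn `<=` Be by move=> t; rewrite /Bn /Be/= !in_itv/= andbT => /andP[].
have BfBe : Bf `<=` Be by move=> t; rewrite /Bf /Be/= !in_itv/= !andbT; exact: lt_trans.
have BrBe : [set r] `<=` Be by move=> t ->; rewrite /Be/= in_itv/= andbT.
have mS1 : measurable (sec v [set r]) by apply: mS; exact: measurable_set1.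
have split3 : \int[mu]_(z in sec v Be) D z =
    \int[mu]_(z in sec v Bn) D z + \int[mu]_(z in sec v Bf) D z.
  rewrite {1}/Be sec_split Rintegral_setU.
  - congr (_ + _); rewrite Rintegral_setU//.
    + rewrite [X in X + _](_ : _ = 0) ?add0r//.
      rewrite /Rintegral null_set_integral//; last exact: sphere_negligible.
      by apply: (measurable_int mu); apply: iDS => //; exact: measurable_set1.
    + exact: mS.
    + apply: integrableS iD; [exact: mS| |].
        by apply: measurableU => //; exact: mS.
      by move=> z [] [h1 h2]; split=> //; [exact: BrBe|exact: BfBe].
    + rewrite disj_set2E; apply/eqP/seteqP; split=> // z [[_ /= zE] [_ /=]].
      by rewrite in_itv/= zE ltxx.
  - exact: mS.
  - by apply: measurableU => //; exact: mS.
  - by rewrite -sec_split.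
  - rewrite disj_set2E; apply/eqP/seteqP; split=> // z [[_ /=]]; rewrite in_itv/= => /andP[_ zr].
    by case=> -[_ /=]; [move=> zE; move: zr; rewrite zE ltxx|rewrite in_itv/= andbT => /(lt_trans zr); rewrite ltxx].
rewrite split3.
have n2 := integral_enormX N2 s01 hal v1 mBn (annulus_gt0 heps) (integral_annulus_quadratic hs heps).
have i2 := integrable_enormX N2 s01 hal v1 mBn (annulus_gt0 heps) (integral_annulus_quadratic hs heps).
have f0 := integral_enormX N2 s01 hal v1 mBf (tail_gt0 r0) (integral_tail_const hs r0).
have if0 := integrable_enormX N2 s01 hal v1 mBf (tail_gt0 r0) (integral_tail_const hs r0).
have f1 := integral_enormX N2 s01 hal v1 mBf (tail_gt0 r0) (integral_tail_linear hs heps).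
have if1 := integrable_enormX N2 s01 hal v1 mBf (tail_gt0 r0) (integral_tail_linear hs heps).
have idot b := integrable_dotp N2 s01 hal v1 mBn (annulus_gt0 heps) (integral_annulus_linear hs heps) b.
have J0 := integral_dotp_orthogonal N2 s01 hal v1 mBn (annulus_gt0 heps) (integral_annulus_linear hs heps) w1 vw.
have J1 := integral_dotp_ge N2 s01 hal v1 mBn (annulus_gt0 heps) (integral_annulus_linear hs heps) p2 halpha.
have ia : mu.-integrable (sec v Bn) (EFin \o fun z => - (enorm q * (d ^+ 2 / 2)) * dotp z v).
  by apply: (integrable_realZ (mS _ mBn)); exact: idot.
have ib : mu.-integrable (sec v Bn) (EFin \o fun z => - (enorm q * sin a) * dotp z w).
  by apply: (integrable_realZ (mS _ mBn)); exact: idot.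
have ic : mu.-integrable (sec v Bn) (EFin \o fun z => 2 * K * d * enorm z ^+ 2).
  exact: (integrable_realZ (mS _ mBn) _ i2).
have ibc := integrable_realD (mS _ mBn) ib ic.
have in0 := integrable_realD (mS _ mBn) ia ibc.
have if01 := integrable_realD (mS _ mBf) if0 if1.
(* The term in <z, w> integrates to zero. *)
have nearB : \int[mu]_(z in sec v Bn) D z <= \int[mu]_(z in sec v Bn)
   (- (enorm q * (d ^+ 2 / 2)) * dotp z v + (- (enorm q * sin a) * dotp z w
     + 2 * K * d * enorm z ^+ 2)).
  apply: le_Rintegral => //.
  - exact: mS.
  - exact: iDS.
  - move=> z [[z0 _]]; rewrite /Bn/= in_itv/= => /andP[_ zr].
    have := near zr (enorm_orthogonal z (orho a)).
    rewrite -/(D z) {1}qE dotpZr dv -/d => h.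
    have : 2 * K * enorm z * enorm (z *m rho a - z) <= 2 * K * d * enorm z ^+ 2.
      rewrite (_ : 2 * K * d * enorm z ^+ 2 = 2 * K * enorm z * (d * enorm z)); last by ring.
      by rewrite ler_wpM2l ?chord// !mulr_ge0 ?enorm_ge0.
    lra.
have farB : \int[mu]_(z in sec v Bf) D z <= \int[mu]_(z in sec v Bf)
   (2 * W * (enorm z ^+ 0 + enorm z ^+ 1)).
  apply: le_Rintegral => //.
  - exact: mS.
  - exact: iDS.
  - exact: (integrable_realZ (mS _ mBf) _ if01).
  - move=> z [[z0 _]]; rewrite /Bf/= in_itv/= andbT => zr.
    have := arc_difference_le d0 W0 far orho rho0 a0 ad api step zr.
    by rewrite -/(D z) expr0 expr1 mulrAC.
apply: (le_trans (lerD nearB farB)).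
rewrite [X in _ + X](RintegralZl _ (mS _ mBf) if01).
rewrite (RintegralD (mS _ mBf) if0 if1).
rewrite (RintegralD (mS _ mBn) ia ibc) (RintegralD (mS _ mBn) ib ic).
rewrite (RintegralZl _ (mS _ mBn) (idot v)) (RintegralZl _ (mS _ mBn) (idot w)).
rewrite (RintegralZl _ (mS _ mBn) i2).
rewrite J0 mulr0 add0r.
have -> : \int[mu]_(z in sec v Bn) enorm z ^+ 2 = _ := congr1 fine n2.
have -> : \int[mu]_(z in sec v Bf) enorm z ^+ 0 = _ := congr1 fine f0.
have -> : \int[mu]_(z in sec v Bf) enorm z ^+ 1 = _ := congr1 fine f1.
rewrite /=.
set P1 := (eps `^ (1 - 2 * s) - _) / _ in J1 *.
have : enorm q * (d ^+ 2 / 2) * (C * area * P1 * gamma) <=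
  enorm q * (d ^+ 2 / 2) * (\int[mu]_(z in sec v Bn) dotp z v).
  by rewrite ler_wpM2l// mulr_ge0 ?enorm_ge0// divr_ge0// sqr_ge0.
lra.
Qed.

End core.

(** * Twice continuously differentiable functions *)

Section euclidean_topology.
Context {R : realType} {N : nat}.
Implicit Types (x y z : 'rV[R]_N) (r : R).

Lemma continuous_enorm_sub x : continuous (fun y => enorm (y - x)).
Proof.
move=> y; have FF : Filter (nbhs (y : 'rV[R]_N)) by exact: nbhs_filter.
apply: (@continuous_comp _ _ _ (fun y => y - x) (@enorm R N)).
  by apply: cvgB; [exact: cvg_id|exact: cvg_cst].
exact: continuous_enorm.
Qed.

Lemma open_eball x r : open (eball x r).
Proof.
have c := @continuous_enorm_sub x.
rewrite (_ : eball x r = (fun y => enorm (y - x)) @^-1` [set t | t < r]) //.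
by apply: open_comp; [move=> y _; exact: c|exact: open_lt].
Qed.

Lemma closed_ecball x r : closed (ecball x r).
Proof.
have c := @continuous_enorm_sub x.
rewrite (_ : ecball x r = (fun y => enorm (y - x)) @^-1` [set t | t <= r]) //.
by apply: closed_comp; [move=> y _; exact: c|exact: closed_le].
Qed.

Lemma nbhs_eball x (P : set 'rV[R]_N) : nbhs x P -> exists2 e : R, 0 < e & eball x e `<=` P.
Proof.
move=> /nbhs_ballP[e /= e0 eP]; exists e => // y ye; apply: eP.
split=> // i j; rewrite ord1; apply: ball_sym.
have := coord_le_enorm (y - x) j; rewrite !mxE => h.
exact: le_lt_trans h ye.
Qed.

Lemma eball_center x r : 0 < r -> eball x r x.
Proof. by rewrite /eball/= subrr enorm0. Qed.

Lemma eball_convex x r (a b : 'rV[R]_N) (t : R) : 0 <= t <= 1 ->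
  eball x r a -> eball x r b -> eball x r (b + t *: (a - b)).
Proof.
move=> /andP[t0 t1]; rewrite /eball/= => ar br.
have [->|tn] := eqVneq t 0; first by rewrite scale0r addr0.
rewrite (_ : b + t *: (a - b) - x = (1 - t) *: (b - x) + t *: (a - x)); last first.
  by apply/rowP => i; rewrite !mxE; ring.
apply: le_lt_trans (enormD _ _) _; rewrite !enormZ !ger0_norm ?subr_ge0//.
have : t * enorm (a - x) < t * r by rewrite ltr_pM2l// lt_neqAle eq_sym tn.
have : (1 - t) * enorm (b - x) <= (1 - t) * r by rewrite ler_wpM2l ?subr_ge0// ltW.
lra.
Qed.

End euclidean_topology.

Section directional.
Context {R : realType} {N : nat}.
Implicit Types (f : 'rV[R]_N -> R) (x y h v : 'rV[R]_N).

Lemma is_derive_line f (p v : 'rV[R]_N) (t df : R) :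
  is_derive (p + t *: v) v f df -> is_derive t 1 (fun t => f (p + t *: v)) df.
Proof.
have E : (fun k : R => k^-1 *: (((fun t => f (p + t *: v)) \o shift t) (k *: 1) - f (p + t *: v)))
    = (fun k : R => k^-1 *: ((f \o shift (p + t *: v)) (k *: v) - f (p + t *: v))).
  apply/funext => k /=; congr (_ *: (f _ - _)).
  by rewrite [k *: 1]mulr1 scalerDl addrCA.
move=> [d1 d2]; split.
  by rewrite /derivable E.
by rewrite /derive E.
Qed.

(** The increment [c] may have either sign. *)
Lemma mvt_line f (p v : 'rV[R]_N) (c : R) (g : R -> R) :
  (forall t, `|t| <= `|c| -> is_derive (p + t *: v) v f (g t)) ->
  exists2 t, `|t| <= `|c| & f (p + c *: v) - f p = c * g t.
Proof.
move=> df.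
pose phi t := f (p + t *: v).
have dphi (t : R) : `|t| <= `|c| -> is_derive t 1 phi (g t) by move=> /df; exact: is_derive_line.
have fp : f p = phi 0 by rewrite /phi scale0r addr0.
have key a b : a <= b -> (forall t, a <= t <= b -> `|t| <= `|c|) ->
    exists2 t, `|t| <= `|c| & phi b - phi a = (b - a) * g t.
  move=> ab tc.
  have [||t ht E] := @MVT_segment R phi g a b ab.
  - by move=> t; rewrite in_itv/= => /andP[h1 h2]; apply: dphi; apply: tc; rewrite !ltW.
  - apply: derivable_within_continuous => t; rewrite in_itv/= => ht.
    by have [] := dphi _ (tc _ ht).
  - by exists t; [apply: tc; move: ht; rewrite in_itv|rewrite E mulrC].
have [c0|c0] := leP 0 c.
  have [|t tc E] := key 0 c c0.
    by move=> t /andP[t0 tc]; rewrite !ger0_norm.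
  by exists t; rewrite // fp -/(phi c) E subr0.
have [|t tc E] := key c 0 (ltW c0).
  by move=> t /andP[ct t0]; rewrite !ler0_norm ?lerN2// ltW.
exists t => //; rewrite fp -/(phi c) -[LHS]opprB E; ring.
Qed.

(** The increment along [h] is decomposed into increments along the coordinate
    axes, to each of which the mean value theorem applies. *)
Lemma is_derive_partial f (U : set 'rV[R]_N) y h (g : 'I_N -> 'rV[R]_N -> R) :
  open U -> U y ->
  (forall i z, U z -> is_derive z (delta_mx 0 i) f (g i z)) ->
  (forall i, {for y, continuous (g i)}) ->
  is_derive y h f (\sum_i h ord0 i * g i y).
Proof.
move=> oU Uy dg cg; set L := \sum_i _.
suff cvgL : (fun k => k^-1 *: ((f \o shift y) (k *: h) - f y)) @ 0^' --> L.
  by split; [apply/cvg_ex; exists L|apply/cvg_lim].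
pose S := \sum_i `|h ord0 i|.
have S0 : 0 <= S by exact: sumr_ge0.
have S1 : 0 < S + 1 by rewrite ltr_wpDl.
apply/cvgrPdist_le => e e0.
(* S may vanish, whence the denominator S + 1. *)
pose e' := e / (S + 1); have e'0 : 0 < e' by rewrite divr_gt0.
have [eta eta0 etaP] : exists2 eta : R, 0 < eta & forall z, enorm (z - y) < eta ->
    U z /\ forall i, `|g i z - g i y| <= e'.
  have nU : nbhs y U by exact: open_nbhs_nbhs.
  have ng i : nbhs y [set z | `|g i y - g i z| <= e'].
    by have /cvgrPdist_le/(_ _ e'0) := cg i.
  have nall : nbhs y [set z | forall i, `|g i y - g i z| <= e'].
    have FF : Filter (nbhs (y : 'rV[R]_N)) by exact: nbhs_filter.
    exact: (@filter_forall _ _ _ _ FF ng).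
  have [eta eta0 etaP] := nbhs_eball (filterI nU nall).
  exists eta => // z /etaP[Uz gz]; split => // i; rewrite distrC; exact: gz.
near=> k.
have k0 : k != 0 by near: k; exact: nbhs_dnbhs_neq.
have kS : `|k| * S < eta.
  have : `|k| < eta / (S + 1).
    near: k; apply: dnbhs0_lt; exact: divr_gt0.
  rewrite ltr_pdivlMr// => kk; apply: le_lt_trans kk.
  by rewrite ler_wpM2l// lerDl.
(* The first j coordinates of h, the others being zero. *)
pose hj (j : nat) : 'rV[R]_N := \row_i (if (i < j)%N then h ord0 i else 0).
have hjS j (jN : (j < N)%N) : hj j.+1 = hj j + h ord0 (Ordinal jN) *: delta_mx 0 (Ordinal jN).
  apply/rowP => i; rewrite !mxE eqxx/= ltnS leq_eqVlt.
  have [ij|ij] := eqVneq i (Ordinal jN).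
    by rewrite ij /= eqxx ltnn mulr1 add0r.
  have -> : (i == j :> nat) = false.
    by apply: contraNF ij => /eqP ij; apply/eqP/val_inj.
  by rewrite mulr0 addr0.
have hjle j (i : 'I_N) : `|hj j ord0 i| <= `|h ord0 i|.
  by rewrite mxE; case: ifP => //; rewrite normr0.
have bnd j (jN : (j < N)%N) (t : R) : `|t| <= `|k * h ord0 (Ordinal jN)| ->
    enorm (y + k *: hj j + t *: delta_mx 0 (Ordinal jN) - y) < eta.
  move=> tk; rewrite -(addrA y) (addrC y) addrK.
  apply: le_lt_trans kS; apply: le_trans (enorm_le_sum _) _.
  rewrite mulr_sumr; apply: ler_sum => i _; rewrite !mxE eqxx/=.
  have [ij|ij] := eqVneq i (Ordinal jN).
    by rewrite ij /= ltnn mulr0 add0r mulr1 -normrM.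
  rewrite mulr0 addr0 normrM ler_wpM2l//.
  by have := hjle j i; rewrite mxE.
pose P j := f (y + k *: hj j).
have incr j (jN : (j < N)%N) :
    `|P j.+1 - P j - k * (h ord0 (Ordinal jN) * g (Ordinal jN) y)| <= `|k| * `|h ord0 (Ordinal jN)| * e'.
  have [t tk E] := @mvt_line f (y + k *: hj j) (delta_mx 0 (Ordinal jN)) (k * h ord0 (Ordinal jN))
    (fun t => g (Ordinal jN) (y + k *: hj j + t *: delta_mx 0 (Ordinal jN)))
    (fun t tk => dg _ _ (etaP _ (bnd _ _ _ tk)).1).
  rewrite /P hjS scalerDr scalerA addrA E mulrA -mulrBr normrM (normrM k) ler_wpM2l//.
  exact: (etaP _ (bnd _ _ _ tk)).2.
have P0 : P 0%N = f y.
  by rewrite /P (_ : hj 0%N = 0) ?scaler0 ?addr0//; apply/rowP => i; rewrite !mxE.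
have PN : P N = f (k *: h + y).
  by rewrite /P (_ : hj N = h) 1?addrC//; apply/rowP => i; rewrite !mxE ltn_ord.
have sumE : f (k *: h + y) - f y - k * L =
    \sum_(i < N) (P i.+1 - P i - k * (h ord0 i * g i y)).
  rewrite big_split/= sumrN -mulr_sumr -/L; congr (_ - _).
  by rewrite -(big_mkord xpredT (fun i => P i.+1 - P i)) telescope_sumr// P0 PN.
have main : `|f (k *: h + y) - f y - k * L| <= `|k| * S * e'.
  rewrite sumE; apply: le_trans (ler_norm_sum _ _ _) _.
  rewrite /S mulr_sumr mulr_suml; apply: ler_sum => i _.
  have := incr i (ltn_ord i).
  by rewrite (_ : Ordinal (ltn_ord i) = i)//; exact: val_inj.
rewrite /= distrC.
have -> : k^-1 *: (f (k *: h + y) - f y) - L = k^-1 * (f (k *: h + y) - f y - k * L).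
  by rewrite mulrBr mulKf.
rewrite normrM normfV mulrC ler_pdivrMr ?normr_gt0//; apply: le_trans main _.
rewrite -mulrA mulrC ler_wpM2r// /e' mulrA ler_pdivrMr// mulrC ler_pM2l//.
by rewrite lerDl.
Unshelve. all: by end_near. Qed.

End directional.

Section c2_functions.
Context {R : realType} {N : nat}.
Implicit Types (f g : 'rV[R]_N -> R) (y z a b h : 'rV[R]_N).

Lemma lebesgue_eball_gt0 y (e : R) : (0 < N)%N -> 0 < e ->
  (0 < lebesgue_rV N (eball y e))%E.
Proof.
move=> N0 e0; have /andP[b0 _] := @eball_unit_bounds R N N0.
have -> : lebesgue_rV N (eball y e) = lebesgue_rV N (eball 0 e).
  rewrite -(@translation_invariant_lebesgue_rV R N y (eball y e)); last exact: measurable_eball.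
  by congr (_ _); apply/seteqP; split=> z; rewrite /eball/= addrK subr0.
move: b0; have -> : eball 0 1 = (fun z : 'rV[R]_N => e *: z) @^-1` (eball 0 e).
  apply/seteqP; split=> z; rewrite /eball/= !subr0 enormZ gtr0_norm// -ltr_pdivlMl// mulVf ?gt_eqF//.
rewrite lebesgue_rV_scale//; last exact: measurable_eball.
by rewrite pmule_rgt0// lte_fin invr_gt0 exprn_gt0.
Qed.

Variables (u : 'rV[R]_N -> R) (x : 'rV[R]_N) (r : R).
Hypothesis r0 : 0 < r.
Hypothesis u_C2 : C2_ecball u x r.

Let d1 (i : 'I_N) y := 'D_(delta_mx 0 i) u y.
Let d2 (i j : 'I_N) y := 'D_(delta_mx 0 j) ('D_(delta_mx 0 i) u) y.

Lemma continuous_interior f g : {within ecball x r, continuous g} ->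
  (forall z, eball x r z -> f z = g z) ->
  forall y, eball x r y -> {for y, continuous f}.
Proof.
move=> cg fg y yr.
have sub : eball x r `<=` ecball x r by move=> z; exact: ltW.
have : {within eball x r, continuous g} by exact: continuous_subspaceW cg.
rewrite continuous_open_subspace; last exact: open_eball.
move=> /(_ y (mem_set yr)) cgy.
have FF : Filter (nbhs (y : 'rV[R]_N)) by exact: nbhs_filter.
have ny : nbhs y (eball x r) by apply: open_nbhs_nbhs; split => //; exact: open_eball.
rewrite /prop_for /continuous_at fg//.
apply: cvg_trans cgy; apply: near_eq_cvg.
by apply: filterS ny => z zr; rewrite fg.
Qed.

Lemma is_derive_C2 y h : eball x r y -> is_derive y h u (\sum_i h ord0 i * d1 i y).
Proof.
have [_ H _] := u_C2; move=> yr.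
apply: (@is_derive_partial _ _ u _ y h d1 (@open_eball _ _ x r) yr) => i.
  by move=> z zr; have [g _ /(_ z zr) [dz _]] := H i; split.
have [g cg gE] := H i.
by apply: (continuous_interior cg) => // z /gE[].
Qed.

Lemma is_derive_C2_partial i y h : eball x r y ->
  is_derive y h (d1 i) (\sum_j h ord0 j * d2 i j y).
Proof.
have [_ _ H] := u_C2; move=> yr.
apply: (@is_derive_partial _ _ (d1 i) _ y h (d2 i) (@open_eball _ _ x r) yr) => j.
  by move=> z zr; have [g _ /(_ z zr) [dz _]] := H i j; split.
have [g cg gE] := H i j.
by apply: (continuous_interior cg) => // z /gE[].
Qed.

Lemma continuous_hessian i j y : eball x r y -> {for y, continuous (d2 i j)}.
Proof.
have [_ _ H] := u_C2; have [g cg gE] := H i j; move=> yr.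
by apply: (continuous_interior cg) => // z /gE[].
Qed.

Lemma compact_ecball : compact (ecball x r).
Proof.
have cK : compact [set v : 'rV[R]_N | forall i,
    `[x ord0 i - r, x ord0 i + r]%classic (v ord0 i)].
  apply: (@rV_compact R N (fun i => `[x ord0 i - r, x ord0 i + r]%classic)).
  by move=> i; exact: segment_compact.
apply: subclosed_compact cK _; first exact: closed_ecball.
move=> y; rewrite /ecball/= => yr i; rewrite in_itv/= -ler_distlC.
have := coord_le_enorm (y - x) i; rewrite !mxE distrC => h.
exact: le_trans h yr.
Qed.

(** The second derivatives extend continuously to the closed ball, which is
    compact.  This makes the essential supremum finite, so that its real value
    is meaningful. *)
Lemma hessian_entry_bounded : exists B : R, forall i j y, eball x r y -> `|d2 i j y| <= B.
Proof.
have [_ _ H] := u_C2.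
have bd (k : 'I_N * 'I_N) : exists B : R, forall y, eball x r y -> `|d2 k.1 k.2 y| <= B.
  have [g cg gE] := H k.1 k.2.
  have [M [_ MP]] := compact_bounded (continuous_compact cg compact_ecball).
  exists (M + 1) => y yr; rewrite /d2 (gE y yr).2; apply: (MP (M + 1)); first by rewrite ltrDl.
  by exists y => //; exact: ltW.
pose B k := sval (cid (bd k)).
exists (\sum_k `|B k|) => i j y yr.
have h : `|d2 i j y| <= B (i, j) by rewrite /B; case: cid => b /= /(_ y yr).
apply: le_trans h _; apply: le_trans (ler_norm _) _.
by rewrite (bigD1 (i, j))//= lerDl sumr_ge0.
Qed.

Lemma enorm_mulmx_le (v : 'rV[R]_N) (H : 'M[R]_N) (B : R) : enorm v = 1 ->
  (forall i j, `|H i j| <= B) -> enorm (v *m H) <= \sum_(j < N) \sum_(i < N) B.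
Proof.
move=> v1 HB; apply: le_trans (enorm_le_sum _) _; apply: ler_sum => j _.
rewrite mxE; apply: le_trans (ler_norm_sum _ _ _) _; apply: ler_sum => i _.
have B0 : 0 <= B by apply: le_trans (HB i j).
rewrite normrM -[leRHS]mul1r; apply: ler_pM => //.
by rewrite -v1 coord_le_enorm.
Qed.

Lemma le_opnorm (v : 'rV[R]_N) (H : 'M[R]_N) : enorm v = 1 -> enorm (v *m H) <= opnorm H.
Proof.
move=> v1; apply: ub_le_sup; last by exists v.
pose B : R := \sum_i \sum_j `|H i j|.
exists (\sum_(j < N) \sum_(i < N) B) => _ [w w1 <-].
apply: enorm_mulmx_le => // i j.
rewrite /B (bigD1 i)//= (bigD1 j)//= -addrA lerDl addr_ge0// sumr_ge0// => k _.
by rewrite sumr_ge0.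
Qed.

Lemma opnorm_le (H : 'M[R]_N) (B : R) : (0 < N)%N ->
  (forall i j, `|H i j| <= B) -> opnorm H <= \sum_(j < N) \sum_(i < N) B.
Proof.
move=> N0 HB; apply: ge_sup.
  exists (enorm ((stdbasis 0 : 'rV[R]_N) *m H)), (stdbasis 0) => //.
  by rewrite /= /enorm (dotp_stdbasis _ (Ordinal N0)) mxE eqxx sqrtr1.
by move=> _ [w w1 <-]; exact: enorm_mulmx_le.
Qed.

Lemma opnorm_ge0 (H : 'M[R]_N) : (0 < N)%N -> 0 <= opnorm H.
Proof.
move=> N0; apply: le_trans (@le_opnorm (stdbasis 0) H _); first exact: enorm_ge0.
by rewrite /enorm (dotp_stdbasis _ (Ordinal N0)) mxE eqxx sqrtr1.
Qed.

(** Continuity is obtained for a fixed vector, which spares the continuity of the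
    operator norm. *)
Lemma continuous_hessian_row (v : 'rV[R]_N) y : eball x r y ->
  {for y, continuous (fun z => enorm (v *m hessian u z))}.
Proof.
move=> yr; have FF : Filter (nbhs (y : 'rV[R]_N)) by exact: nbhs_filter.
rewrite (_ : (fun z => _) = fun z => Num.sqrt (\sum_j (\sum_i v ord0 i * d2 i j z) *
    (\sum_i v ord0 i * d2 i j z))); last first.
  apply/funext => z; rewrite /enorm /dotp; congr Num.sqrt; apply: eq_bigr => j _.
  by rewrite !mxE; congr (_ * _); apply: eq_bigr => i _; rewrite mxE.
apply: continuous_comp; last exact: sqrt_continuous.
have sumc (I : Type) (s : seq I) (F : I -> 'rV[R]_N -> R) :
    (forall i, {for y, continuous (F i)}) -> {for y, continuous (fun z => \sum_(i <- s) F i z)}.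
  move=> cF; elim: s => [|i s IH].
    rewrite (_ : (fun z => _) = cst 0); first exact: cst_continuous.
    by apply/funext => z; rewrite big_nil.
  rewrite (_ : (fun z => _) = fun z => F i z + \sum_(j <- s) F j z); last first.
    by apply/funext => z; rewrite big_cons.
  by apply: cvgD; [exact: cF|exact: IH].
have rowc j : {for y, continuous (fun z => \sum_i v ord0 i * d2 i j z)}.
  apply: sumc => i; have ch : {for y, continuous (d2 i j)} by exact: continuous_hessian.
  exact: (cvgM (cvg_cst _) ch).
by apply: sumc => j; exact: (cvgM (rowc j) (rowc j)).
Qed.

(** The operator norm is bounded by its essential supremum almost everywhere.  If
    the inequality failed at a point of the ball it would fail, by continuity, on a
    ball around it, and nonempty balls have positive measure. *)
Lemma hessian_row_le (v : 'rV[R]_N) y : (0 < N)%N -> enorm v = 1 -> eball x r y ->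
  enorm (v *m hessian u y) <= 2 * hessian_bound u x r.
Proof.
move=> N0 v1 yr.
set nu := mrestr (lebesgue_rV N) (measurable_eball x r).
have nuT : (0 < nu setT)%E.
  by rewrite /nu /mrestr setTI; exact: lebesgue_eball_gt0.
pose f (z : 'rV[R]_N) : \bar R := `|(opnorm (hessian u z))%:E|%E.
have LE : ('N[nu]_+oo [EFin \o (fun z => opnorm (hessian u z))] = ess_sup nu f)%E.
  by rewrite unlock nuT.
have fae := ess_sup_ge nu f.
have [B BP] := hessian_entry_bounded.
have supB : (ess_sup nu f <= (\sum_(j < N) \sum_(i < N) B)%:E)%E.
  apply/ess_supP; exists (~` eball x r); split.
  - by apply: measurableC; exact: measurable_eball.
  - by rewrite -[LHS]/(lebesgue_rV N (~` eball x r `&` eball x r)) setICl measure0.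
  - move=> z; apply: contra_not => /= zr.
    rewrite /f abse_EFin lee_fin ger0_norm ?opnorm_ge0//.
    by apply: opnorm_le => // i j; rewrite mxE; exact: BP.
have sup0 : (0 <= ess_sup nu f)%E.
  by apply: ess_sup_gee => //; apply: nearW => z; exact: abse_ge0.
have KE : (ess_sup nu f = (2 * hessian_bound u x r)%:E)%E.
  rewrite /hessian_bound LE mulrA mulfV// mul1r fineK// ge0_fin_numE//.
  by apply: le_lt_trans supB _; exact: ltry.
rewrite leNgt; apply/negP => vy.
have cv : {for y, continuous (fun z => enorm (v *m hessian u z))}.
  exact: continuous_hessian_row.
have FF : Filter (nbhs (y : 'rV[R]_N)) by exact: nbhs_filter.
have nv : nbhs y [set z | 2 * hessian_bound u x r < enorm (v *m hessian u z)].
  by apply: (cvgr_gt _ cv).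
have ny : nbhs y (eball x r) by apply: open_nbhs_nbhs; split => //; exact: open_eball.
have [e e0 eP] := nbhs_eball (filterI nv ny).
have [Z [mZ Z0 ZP]] := fae.
have := lebesgue_eball_gt0 y N0 e0; rewrite ltNge => /negP; apply.
rewrite -Z0 /nu /mrestr; apply: le_measure; rewrite ?inE.
- exact: measurable_eball.
- by apply: measurableI => //; exact: measurable_eball.
- move=> z /eP[/= zv zr]; split => //; apply: ZP => /=.
  rewrite KE /f abse_EFin lee_fin => /(le_trans (ler_norm _)).
  by rewrite leNgt (lt_le_trans zv)// le_opnorm.
Qed.

Lemma hessian_bilinear_le y a b : (0 < N)%N -> eball x r y ->
  `|\sum_i a ord0 i * (\sum_j b ord0 j * d2 i j y)| <=
  2 * hessian_bound u x r * enorm a * enorm b.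
Proof.
move=> N0 yr.
have -> : \sum_i a ord0 i * (\sum_j b ord0 j * d2 i j y) = dotp (a *m hessian u y) b.
  rewrite /dotp; under eq_bigr do rewrite mulr_sumr; rewrite exchange_big /=.
  apply: eq_bigr => j _; rewrite mxE mulr_suml; apply: eq_bigr => i _.
  by rewrite mxE -mulrA; congr (_ * _); exact: mulrC.
apply: le_trans (dotp_le_enorm _ _) _; rewrite ler_wpM2r ?enorm_ge0//.
have [->|a0] := eqVneq a 0; first by rewrite mul0mx !enorm0 mulr0.
have a1 : 0 < enorm a by rewrite enorm_gt0.
have : enorm (((enorm a)^-1 *: a) *m hessian u y) <= 2 * hessian_bound u x r.
  apply: hessian_row_le => //.
  by rewrite enormZ ger0_norm ?invr_ge0 ?enorm_ge0// mulVf ?gt_eqF.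
by rewrite -scalemxAl enormZ ger0_norm ?invr_ge0 ?enorm_ge0// ler_pdivrMl// mulrC.
Qed.

Lemma hessian_bound_ge0 : (0 < N)%N -> 0 <= hessian_bound u x r.
Proof.
move=> N0; have e1 : enorm (stdbasis 0 : 'rV[R]_N) = 1.
  by rewrite /enorm (dotp_stdbasis _ (Ordinal N0)) mxE eqxx sqrtr1.
have := hessian_row_le N0 e1 (eball_center x r0).
move/(le_trans (enorm_ge0 _)); lra.
Qed.

(** The mean value theorem on the segment from [b] to [a]. *)
Lemma gradient_lipschitz a b h : (0 < N)%N -> eball x r a -> eball x r b ->
  `|dotp h (gradient u a - gradient u b)| <=
  2 * hessian_bound u x r * enorm h * enorm (a - b).
Proof.
move=> N0 ar br.
pose psi (t : R) := \sum_i h ord0 i * d1 i (b + t *: (a - b)).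
pose dpsi (t : R) := \sum_i h ord0 i * (\sum_j (a - b) ord0 j * d2 i j (b + t *: (a - b))).
have seg (t : R) : 0 <= t <= 1 -> eball x r (b + t *: (a - b)).
  by move=> t01; exact: eball_convex.
have dpsiP (t : R) : 0 <= t <= 1 -> is_derive t 1 psi (dpsi t).
  move=> t01.
  have d i : is_derive t 1 (fun t : R => h ord0 i * d1 i (b + t *: (a - b)))
     (h ord0 i * (\sum_j (a - b) ord0 j * d2 i j (b + t *: (a - b)))).
    apply: is_deriveZ; apply: is_derive_line; apply: is_derive_C2_partial; exact: seg.
  have := is_derive_sum d.
  rewrite (_ : \sum_(i < N) _ = psi)//; apply/funext => t'.
  by rewrite fct_sumE.
have [||t t01 E] := @MVT_segment R psi dpsi 0 1 ler01.
- by move=> t; rewrite in_itv/= => /andP[t0 t1]; apply: dpsiP; rewrite !ltW.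
- apply: derivable_within_continuous => t; rewrite in_itv/= => t01.
  by have [] := dpsiP _ t01.
have -> : dotp h (gradient u a - gradient u b) = psi 1 - psi 0.
  rewrite /psi (_ : b + 1 *: (a - b) = a); last by rewrite scale1r addrC subrK.
  rewrite (_ : b + 0 *: (a - b) = b); last by rewrite scale0r addr0.
  rewrite -sumrB; apply: eq_bigr => i _.
  by rewrite !mxE mulrBr.
by rewrite E subr0 mulr1; apply: hessian_bilinear_le => //; exact: seg.
Qed.

Lemma is_derive_gradient y h : eball x r y -> is_derive y h u (dotp h (gradient u y)).
Proof.
move=> yr; rewrite (_ : dotp h _ = \sum_i h ord0 i * d1 i y); first exact: is_derive_C2.
by apply: eq_bigr => i _; rewrite mxE.
Qed.

(** The mean value theorem on the segment from [z] to [z'], whose points have norm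
    at most [|z|], reduces the claim to the variation of the gradient from [x]. *)
Lemma taylor_sphere z z' : (0 < N)%N -> enorm z < r -> enorm z' = enorm z ->
  `|u (x + z') - u (x + z) - dotp (z' - z) (gradient u x)| <=
  2 * hessian_bound u x r * enorm z * enorm (z' - z).
Proof.
move=> N0 zr zz'.
have a1 : eball x (enorm z + (r - enorm z) / 2) (x + z').
  by rewrite /eball/= addrC addKr zz' ltrDl divr_gt0// subr_gt0.
have a0 : eball x (enorm z + (r - enorm z) / 2) (x + z).
  by rewrite /eball/= addrC addKr ltrDl divr_gt0// subr_gt0.
have inr (t : R) : 0 <= t <= 1 -> enorm (z + t *: (z' - z)) <= enorm z.
  move=> /andP[t0 t1]; rewrite (_ : _ + _ = (1 - t) *: z + t *: z'); last first.
    by apply/rowP => i; rewrite !mxE; ring.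
  apply: le_trans (enormD _ _) _; rewrite !enormZ !ger0_norm ?subr_ge0// zz'.
  by rewrite -mulrDl subrK mul1r.
have seg (t : R) : 0 <= t <= 1 -> eball x r (x + z + t *: (z' - z)).
  by move=> /inr h; rewrite /eball/= -(addrA x) (addrC x) addrK; exact: le_lt_trans zr.
pose phi (t : R) := u (x + z + t *: (z' - z)).
have dphi (t : R) : 0 <= t <= 1 ->
    is_derive t 1 phi (dotp (z' - z) (gradient u (x + z + t *: (z' - z)))).
  by move=> t01; apply: is_derive_line; apply: is_derive_gradient; exact: seg.
have [||t] := @MVT_segment R phi
    (fun t => dotp (z' - z) (gradient u (x + z + t *: (z' - z)))) 0 1 ler01.
- by move=> t; rewrite in_itv/= => /andP[t0 t1]; apply: dphi; rewrite !ltW.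
- apply: derivable_within_continuous => t; rewrite in_itv/= => t01.
  by have [] := dphi _ t01.
rewrite in_itv/= => t01; rewrite /phi scale1r scale0r addr0 subr0 mulr1.
rewrite (_ : x + z + (z' - z) = x + z'); last by apply/rowP => i; rewrite !mxE; ring.
move=> ->; rewrite -dotpNr -dotpDr.
apply: le_trans (gradient_lipschitz _ N0 (seg _ t01) (eball_center x r0)) _.
have K0 := hessian_bound_ge0 N0.
have K2 : 0 <= 2 * hessian_bound u x r by apply: mulr_ge0.
rewrite mulrAC ler_wpM2r ?enorm_ge0// ler_wpM2l//.
by rewrite -(addrA x) (addrC x) addrK inr.
Qed.

(** Along [t z] the derivative of [u (x + t z) + u (x - t z)] is bounded by
    [4 K t |z|^2], so that subtracting [2 K |z|^2 t^2] makes it nonincreasing. *)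
Lemma second_difference_le z : (0 < N)%N -> enorm z < r ->
  `|u (x + z) + u (x - z) - 2 * u x| <= 2 * hessian_bound u x r * enorm z ^+ 2.
Proof.
move=> N0 zr; set K := hessian_bound u x r.
have K0 : 0 <= K := hessian_bound_ge0 N0.
have seg (e t : R) : `|e| = 1 -> 0 <= t <= 1 -> eball x r (x + t *: (e *: z)).
  move=> e1 /andP[t0 t1]; rewrite /eball/= addrC addKr !enormZ e1 mul1r ger0_norm//.
  by apply: le_lt_trans zr; rewrite ler_piMl ?enorm_ge0.
have N1 : `|-1 : R| = 1 by rewrite normrN1.
have key (e : R) : `|e| = 1 ->
    e * (u (x + z) + u (x - z) - 2 * u x) <= 2 * K * enorm z ^+ 2.
  move=> e1.
  pose D (t : R) := e * (dotp z (gradient u (x + t *: (1 *: z))) -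
                   dotp z (gradient u (x + t *: (-1 *: z)))) - 4 * K * enorm z ^+ 2 * t.
  pose Phi (t : R) := e * (u (x + t *: (1 *: z)) + u (x + t *: (-1 *: z)))
     - 2 * K * enorm z ^+ 2 * t ^+ 2.
  have dPhi (t : R) : 0 <= t <= 1 -> is_derive t 1 Phi (D t).
    move=> t01.
    have p1 := is_derive_line (is_derive_gradient (1 *: z) (seg 1 t (normr1 R) t01)).
    have p2 := is_derive_line (is_derive_gradient (-1 *: z) (seg (-1) t N1 t01)).
    have p3 : is_derive t 1 (fun t : R => t ^+ 2) (2 * t).
      have := is_deriveM (is_derive_id t (1 : R)) (is_derive_id t (1 : R)).
      by move/is_derive_eq; apply; rewrite /GRing.scale/=; ring.
    have := is_deriveB (is_deriveZ e (is_deriveD p1 p2)) (is_deriveZ (2 * K * enorm z ^+ 2) p3).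
    move/is_derive_eq; apply.
    by rewrite !dotpZl /D /GRing.scale/=; ring.
  have [||t] := @MVT_segment R Phi D 0 1 ler01.
  - by move=> t; rewrite in_itv/= => /andP[t0 t1]; apply: dPhi; rewrite !ltW.
  - apply: derivable_within_continuous => t; rewrite in_itv/= => t01.
    by have [] := dPhi _ t01.
  rewrite in_itv/= => t01; rewrite /Phi !scale1r !scale0r !addr0 subr0 mulr1 scaleN1r.
  rewrite expr1n expr0n/= !mulr0 !mulr1 subr0 => E.
  have t0 : 0 <= t by case/andP: t01.
  have Dt : D t <= 0.
    rewrite /D subr_le0 -dotpNr -dotpDr.
    apply: le_trans (ler_norm _) _; rewrite normrM e1 mul1r.
    apply: le_trans (gradient_lipschitz _ N0 (seg 1 t (normr1 R) t01) (seg (-1) t N1 t01)) _.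
    rewrite -/K (_ : _ - _ = (2 * t) *: z); last by apply/rowP => i; rewrite !mxE; ring.
    rewrite enormZ ger0_norm ?mulr_ge0//.
    by rewrite (_ : 4 * K * enorm z ^+ 2 * t = 2 * K * enorm z * (2 * t * enorm z))//; ring.
  have : Phi 1 - Phi 0 <= 0.
    by rewrite /Phi !scale1r !scale0r !addr0 scaleN1r expr1n expr0n/= !mulr0 !mulr1 subr0 E.
  rewrite /Phi !scale1r !scale0r !addr0 scaleN1r expr1n expr0n/= !mulr0 !mulr1 subr0.
  lra.
rewrite ler_norml; have h1 := key 1 (normr1 R); have h2 := key (-1) N1.
by apply/andP; split; lra.
Qed.

End c2_functions.

(** * Comparison of means *)

Section mean_comparison.
Context {R : realType} {N : nat}.
Variables (s al p eps r : R).
Hypothesis N2 : (2 <= N)%N.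
Hypothesis hs : 2^-1 < s < 1.
Hypothesis hal : 0 < al <= pi / 2.
Hypothesis p2 : 2 <= p.
Hypothesis halpha : @is_alpha R N p al.
Hypothesis heps : 0 < eps < r.
Implicit Types (y z : 'rV[R]_N) (f : 'rV[R]_N -> R).
Notation C := (cNs N s).
Notation area := (@cap_area R N al).
Notation mu := (@mu_s R N s).
Notation sec y B := (shell (ccap al y) B).

Let s01 : 0 < s < 1. Proof. by case/andP: hs => h1 ->; rewrite andbT; lra. Qed.
Let e0 : 0 < eps. Proof. by case/andP: heps. Qed.
Let er : eps < r. Proof. by case/andP: heps. Qed.
Let r0 : 0 < r. Proof. exact: lt_trans er. Qed.
Let N0 : (0 < N)%N. Proof. exact: leq_trans N2. Qed.

Lemma mu_cone y : enorm y = 1 ->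
  mu (cone al eps%:E +oo%E y) = (C * area * (eps `^ (- (2 * s)) / (2 * s)))%:E.
Proof.
move=> y1; rewrite (cone_unbounded hal (ltW e0) y1).
have mS : measurable (sec y `]eps, +oo[) by apply: measurable_sec; exact: measurable_itv.
rewrite -(integral_enormX N2 s01 hal y1 (measurable_itv `]eps, +oo[) (tail_gt0 e0) (integral_tail_const hs e0)).
under eq_integral do rewrite expr0.
by rewrite integral_cst// mul1e.
Qed.

(** The inverse of the measure of the cone is [2 s eps^(2s) / (C |A|)]. *)
Lemma mean_cone y f : enorm y = 1 ->
  mean s (cone al eps%:E +oo%E y) f =
  (\int[mu]_(z in sec y `]eps, +oo[) f z) * (2 * s * eps `^ (2 * s) / (C * area)).
Proof.
move=> y1; rewrite /mean mu_cone//= (cone_unbounded hal (ltW e0) y1); congr (_ * _).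
by rewrite powRN !invfM !invrK; ring.
Qed.

(** Suppose that the mean around [y] exceeds the one around [v].  Then the gain of
    order [|q| d^2] is at most the sum of an error linear in [d] and of one
    proportional to [W d].  If the former is the larger one, [d] is bounded by
    the first threshold for [m], and otherwise [d] satisfies the inequality that
    defines the second.  So [d <= m], and the two errors at [m] bound the
    difference of the means. *)
Lemma mean_cone_le (u : 'rV[R]_N -> R) (x q v y : 'rV[R]_N) (Mb K m : R) (W : R -> R) :
  measurable_fun setT u -> (forall z, `|u z| <= Mb) ->
  enorm v = 1 -> enorm y = 1 -> 0 < enorm q -> q = enorm q *: v -> 0 <= K ->
  (forall z z', enorm z < r -> enorm z' = enorm z ->
     u (x + z') - u (x + z) - dotp (z' - z) q <= 2 * K * enorm z * enorm (z' - z)) ->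
  (forall d a b, r < enorm (a - x) -> r < enorm (b - x) ->
     enorm (a - b) <= d -> u a - u b <= W d) ->
  (forall d, 0 <= d -> 0 <= W d) -> (forall d d', 0 <= d -> d <= d' -> W d <= W d') ->
  0 <= m ->
  16 * (N%:R + p - 2) / (p - 1) * (K / enorm q) * ((2 * s - 1) / (1 - s))
    * ((r `^ (2 - 2 * s) - eps `^ (2 - 2 * s)) / (eps `^ (1 - 2 * s) - r `^ (1 - 2 * s))) <= m ->
  (forall d, 0 <= d <= 2 ->
     d ^+ 2 <= (N%:R + p - 2) / (p - 1) * (8 * W d / enorm q)
       * (((2 * s - 1) / (2 * s) * r `^ (- 2 * s) + r `^ (1 - 2 * s))
          / (eps `^ (1 - 2 * s) - r `^ (1 - 2 * s))) -> d <= m) ->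
  mean s (cone al eps%:E +oo%E y) (fun z => u (x + z)) <=
  mean s (cone al eps%:E +oo%E v) (fun z => u (x + z)) +
  2 * (eps `^ (2 * s) * (4 * s * K * ((r `^ (2 - 2 * s) - eps `^ (2 - 2 * s)) / (1 - s)) * m
          + (r `^ (- 2 * s) + 2 * s / (2 * s - 1) * r `^ (1 - 2 * s)) * W m)).
Proof.
move=> mu_u u_bound v1 y1 q0 qE K0 near far W0 Wm m0 mX mk.
have [area0 _] := cap_area_gt0 N2 s01 hal p2 halpha.
have C0 : 0 < C by exact: cNs_gt0.
have [s_gt s_lt] := andP hs.
have N2' : 2 <= N%:R :> R by rewrite ler_nat.
(* Restated for the order of R itself, which lra recognizes. *)
have p2' : (2 : R) <= p := p2.
rewrite !mean_cone//.
set F := \int[mu]_(z in sec y _) _; set G := \int[mu]_(z in sec v _) _.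
rewrite [- 2 * s]mulNr in mk *.
set e2s := eps `^ (2 * s); have e2s0 : 0 < e2s by rewrite powR_gt0.
set rm := r `^ (- (2 * s)) in mk *; have rm0 : 0 < rm by rewrite powR_gt0.
set r1 := r `^ (1 - 2 * s) in mX mk *; have r10 : 0 < r1 by rewrite powR_gt0.
set r2 := r `^ (2 - 2 * s) in mX *.
set e1 := eps `^ (1 - 2 * s) in mX mk *; set e2 := eps `^ (2 - 2 * s) in mX *.
have er1 : r1 < e1.
  rewrite /r1 /e1 -[1 - 2 * s]opprB !powRN ltf_pV2 ?posrE ?powR_gt0//.
  by apply: gt0_ltr_powR; rewrite ?nnegrE ?ltW//; lra.
have er2 : e2 < r2.
  by apply: gt0_ltr_powR; rewrite ?nnegrE ?ltW//; lra.
set T2 := (r2 - e2) / (1 - s) in mX *.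
have T20 : 0 < T2 by rewrite divr_gt0; lra.
have B0 : 0 <= 4 * s * K * T2 * m + (rm + 2 * s / (2 * s - 1) * r1) * W m.
  have Wm0 := W0 _ m0.
  have h1 : 0 <= 2 * s / (2 * s - 1) by rewrite divr_ge0//; lra.
  apply: addr_ge0; first by rewrite mulr_ge0// mulr_ge0 ?(ltW T20)// mulr_ge0//; lra.
  by rewrite mulr_ge0// addr_ge0 ?(ltW rm0)// mulr_ge0// ltW.
have c0 : 0 < 2 * s * e2s / (C * area).
  by rewrite divr_gt0 ?(mulr_gt0 C0 area0)// mulr_gt0//; lra.
have [FG|GF] := leP F G.
  apply: (@le_trans _ _ (G * (2 * s * e2s / (C * area)))); first by rewrite ler_pM2r.
  by rewrite lerDl mulr_ge0// mulr_ge0// ltW.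
set d := enorm (y - v).
have d0 : 0 < d.
  rewrite enorm_gt0 subr_eq0; apply/eqP => yv.
  by move: GF; rewrite /F /G yv ltxx.
have d2 : d <= 2.
  by have := enormD y (- v); rewrite enormN y1 v1.
have := integral_cone_difference_le N2 hs hal p2 halpha heps mu_u u_bound v1 y1 qE d0 (W0 _ (ltW d0))
  near (far d) K0.
rewrite -/F -/G -/d -/r1 -/e1 -/r2 -/e2 -/rm => core.
set g := (p - 1) / (N%:R + p - 2) in core.
have g0 : 0 < g by rewrite divr_gt0//; lra.
have gI : (N%:R + p - 2) / (p - 1) = g^-1 by rewrite /g invf_div.
set T1 := (e1 - r1) / (2 * s - 1) in core.
have T10 : 0 < T1 by rewrite divr_gt0; lra.
set Q := rm / (2 * s) + r1 / (2 * s - 1) in core.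
have Q0 : 0 < Q by rewrite addr_gt0 ?divr_gt0//; lra.
have T2E : (r2 - e2) / (2 - 2 * s) = T2 / 2 by rewrite /T2; field; lra.
rewrite T2E in core.
set A := enorm q * g * T1; have A0 : 0 < A by apply: mulr_gt0 => //; apply: mulr_gt0.
have CA : 0 < C * area by exact: mulr_gt0.
have d_ineq : d ^+ 2 * A < 2 * K * d * T2 + 4 * W d * Q.
  have : 0 < C * area * (- (enorm q * (d ^+ 2 / 2) * (g * T1)) + 2 * K * d * (T2 / 2) + 2 * W d * Q).
    by apply: lt_le_trans core; rewrite subr_gt0.
  rewrite pmulr_rgt0// /A => h; lra.
have dm : d <= m.
  (* Either the linear error or the one in W is at least half of the gain. *)
  have [dX|dX] := leP (d ^+ 2 * A) (4 * K * d * T2).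
    apply: le_trans mX.
    have -> : 16 * (N%:R + p - 2) / (p - 1) * (K / enorm q) * ((2 * s - 1) / (1 - s)) *
        ((r2 - e2) / (e1 - r1)) = 16 * K * T2 / A.
      rewrite /A /T1 -(mulrA 16) gI /T2; field.
      by rewrite !gt_eqF//; lra.
    rewrite ler_pdivlMr//.
    have : d * A <= 4 * K * T2.
      rewrite -(ler_pM2l d0); move: dX; rewrite expr2; lra.
    have : 0 <= K * T2 by apply: mulr_ge0 => //; exact: ltW.
    lra.
  apply: mk; first by rewrite (ltW d0).
  have -> : (N%:R + p - 2) / (p - 1) * (8 * W d / enorm q) *
      (((2 * s - 1) / (2 * s) * rm + r1) / (e1 - r1)) = 8 * W d * Q / A.
    rewrite gI /Q /A /T1; field.
    by rewrite !gt_eqF//; lra.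
  rewrite ler_pdivlMr//; lra.
have Wdm : W d <= W m by apply: Wm => //; exact: ltW.
have FGb : F - G <= C * area * (K * m * T2 + 2 * W m * Q).
  apply: le_trans core _; rewrite ler_pM2l//.
  have h1 : 0 <= enorm q * (d ^+ 2 / 2) * (g * T1).
    apply: mulr_ge0; last by apply: mulr_ge0; exact: ltW.
    by apply: mulr_ge0; [exact: ltW|apply: divr_ge0 => //; exact: sqr_ge0].
  have h2 : K * d * T2 <= K * m * T2 by rewrite ler_wpM2r ?(ltW T20)// ler_wpM2l.
  have h3 : W d * Q <= W m * Q by rewrite ler_wpM2r ?(ltW Q0).
  lra.
rewrite -lerBlDl -mulrBl.
apply: (@le_trans _ _ (C * area * (K * m * T2 + 2 * W m * Q) * (2 * s * e2s / (C * area)))).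
  by rewrite ler_wpM2r// ltW.
have -> : C * area * (K * m * T2 + 2 * W m * Q) * (2 * s * e2s / (C * area)) =
  2 * (e2s * (s * K * T2 * m + (rm + 2 * s / (2 * s - 1) * r1) * W m)).
  rewrite /Q; field; by rewrite !gt_eqF//; lra.
rewrite ler_pM2l// ler_pM2l// lerD2r.
have : 0 <= s * (K * T2 * m).
  apply: mulr_ge0; first by lra.
  by apply: mulr_ge0 => //; apply: mulr_ge0 => //; exact: ltW.
lra.
Qed.

End mean_comparison.

(** * The modulus of continuity and the operator L *)

Section modulus_of_continuity.
Context {R : realType} {N : nat}.
Variables (u : 'rV[R]_N -> R) (x : 'rV[R]_N) (r Mb : R).
Hypothesis N0 : (0 < N)%N.
Hypothesis r0 : 0 < r.
Hypothesis u_bound : forall z, `|u z| <= Mb.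
Notation D := (~` ecball x r).

Let osc (a : R) := [set t : R | exists z z',
  [/\ D z, D z', enorm (z - z') <= a & t = `|u z - u z'|]].

Let osc_ub a : has_ubound (osc a).
Proof.
exists (Mb + Mb) => _ [z [z' [_ _ _ ->]]].
by apply: le_trans (ler_normB _ _) _; exact: lerD.
Qed.

Let osc0 a : 0 <= a -> osc a 0.
Proof.
move=> a0; pose z : 'rV[R]_N := x + (r + 1) *: stdbasis 0.
have zD : D z.
  rewrite /ecball/= /z addrC addKr enormZ; apply/negP; rewrite -ltNge.
  have -> : enorm (stdbasis 0 : 'rV[R]_N) = 1.
    by rewrite /enorm (dotp_stdbasis _ (Ordinal N0)) mxE eqxx sqrtr1.
  by rewrite mulr1 ger0_norm ?addr_ge0 ?(ltW r0)// ltrDl.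
by exists z, z; split=> //; rewrite subrr ?enorm0 ?normr0.
Qed.

Lemma modulus_ge0 a : 0 <= a -> 0 <= modulus u D a.
Proof. by move=> a0; apply: (ub_le_sup (osc_ub a)); exact: osc0. Qed.

Lemma le_modulus a b : 0 <= a -> a <= b -> modulus u D a <= modulus u D b.
Proof.
move=> a0 ab; apply: ge_sup; first by exists 0; exact: osc0.
move=> _ [z [z' [Dz Dz' zz' ->]]]; apply: (ub_le_sup (osc_ub b)).
by exists z, z'; split=> //; exact: le_trans zz' ab.
Qed.

Lemma modulusP d a b : r < enorm (a - x) -> r < enorm (b - x) ->
  enorm (a - b) <= d -> `|u a - u b| <= modulus u D d.
Proof.
move=> ar br abd; apply: (ub_le_sup (osc_ub d)).
by exists a, b; split=> //; rewrite /ecball/=; apply/negP; rewrite -ltNge.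
Qed.

End modulus_of_continuity.

Section operator_L.
Context {R : realType} {N : nat}.
Variables (s al eps r : R).
Hypothesis N2 : (2 <= N)%N.
Hypothesis hs : 2^-1 < s < 1.
Hypothesis hal : 0 < al <= pi / 2.
Hypothesis heps : 0 < eps < r.
Notation C := (cNs N s).
Notation area := (@cap_area R N al).
Notation mu := (@mu_s R N s).
Notation sec y B := (shell (ccap al y) B).
Variables (u : 'rV[R]_N -> R) (x v : 'rV[R]_N) (Mb K : R).
Hypothesis mu_u : measurable_fun setT u.
Hypothesis u_bound : forall z, `|u z| <= Mb.
Hypothesis v1 : enorm v = 1.
Hypothesis area0 : 0 < area.
Hypothesis second : forall z, enorm z < r ->
  `|u (x + z) + u (x - z) - 2 * u x| <= 2 * K * enorm z ^+ 2.

Let s01 : 0 < s < 1. Proof. by case/andP: hs => h1 ->; rewrite andbT; lra. Qed.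
Let e0 : 0 < eps. Proof. by case/andP: heps. Qed.
Let er : eps < r. Proof. by case/andP: heps. Qed.
Let r0 : 0 < r. Proof. exact: lt_trans er. Qed.

Notation F y := (mean s (cone al eps%:E +oo%E y) (fun z => u (x + z))).
Let g z := u (x + z) + u (x - z) - 2 * u x.

Let mshift (M : 'M[R]_N) : measurable_fun setT (fun z : 'rV[R]_N => u (x + z *m M)).
Proof.
apply: (measurableT_comp mu_u); apply: measurable_rVD => //.
exact: measurable_rVmulmx.
Qed.

Let m1 : measurable_fun setT (fun z : 'rV[R]_N => u (x + z)).
Proof. by have := mshift 1%:M; congr (measurable_fun _ _); apply/funext => z; rewrite mulmx1. Qed.

Let m2 : measurable_fun setT (fun z : 'rV[R]_N => u (x - z)).
Proof.
have := mshift (-1)%:M; congr (measurable_fun _ _); apply/funext => z.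
by rewrite mul_mx_scalar scaleN1r.
Qed.

Let mg : measurable_fun setT g.
Proof. by apply: measurable_funB => //; apply: measurable_funD. Qed.

(** Over the cone with [|z| > eps] the integral of the second difference is the
    sum of the two opposite means minus [2 u x], times the measure of the cone;
    the bounded cone only contributes the second-order error. *)
Lemma Lsp_expansion :
  `| s / (C * area) * eps `^ (2 * s) *
     (\int[mu]_(z in cone al 0 +oo v) g z)
     - (2^-1 * (F v + F (- v)) - u x) | <= s / (1 - s) * K * eps ^+ 2.
Proof.
have C0 : 0 < C by exact: cNs_gt0.
have CA : 0 < C * area by exact: mulr_gt0.
have [s_gt s_lt] := andP hs.
have vN : enorm (- v) = 1 by rewrite enormN.
set Bi := `]0, eps]%classic; set Be := `]eps, +oo[%classic.
have mBi : measurable Bi by exact: measurable_itv.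
have mBe : measurable Be by exact: measurable_itv.
have mSi : measurable (sec v Bi) by exact: measurable_sec.
have mSe : measurable (sec v Be) by exact: measurable_sec.
have i2 := integrable_enormX N2 s01 hal v1 mBi (@core_gt0 R eps) (integral_core_quadratic hs heps).
have I2 := integral_enormX N2 s01 hal v1 mBi (@core_gt0 R eps) (integral_core_quadratic hs heps).
have iK := integrable_realZ mSi (2 * K) i2.
have gi z : sec v Bi z -> `|g z| <= 2 * K * enorm z ^+ 2.
  move=> [_]; rewrite /Bi/= in_itv/= => /andP[_ ze].
  by apply: second; exact: le_lt_trans er.
have igi : mu.-integrable (sec v Bi) (EFin \o g).
  apply: le_integrable iK => //.
    exact/measurable_EFinP/measurable_funTS.
  move=> z /gi gz; rewrite /= lee_fin; exact: le_trans gz (ler_norm _).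
have iu1 : mu.-integrable (sec v Be) (EFin \o (fun z => u (x + z))).
  exact: (bounded_integrable_sec N2 hs hal v1 e0 m1 (fun z => u_bound _)).
have iu2 : mu.-integrable (sec v Be) (EFin \o (fun z => u (x - z))).
  exact: (bounded_integrable_sec N2 hs hal v1 e0 m2 (fun z => u_bound _)).
have ic : mu.-integrable (sec v Be) (EFin \o (fun z => - (2 * u x))).
  by apply: (bounded_integrable_sec N2 hs hal v1 e0) => // z; exact: lexx.
have iu12 := integrable_realD mSe iu1 iu2.
have ige : mu.-integrable (sec v Be) (EFin \o g) := integrable_realD mSe iu12 ic.
have LE : \int[mu]_(z in cone al 0 +oo v) g z =
    \int[mu]_(z in sec v Bi) g z + \int[mu]_(z in sec v Be) g z.
  rewrite (cone_unbounded hal (lexx 0) v1) /Rintegral.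
  have -> : sec v `]0, +oo[ = sec v Bi `|` sec v Be.
    rewrite -setIUr -preimage_setU; congr (_ `&` _ @^-1` _).
    apply/seteqP; split=> t; rewrite /Bi /Be /= !in_itv/= !andbT.
      by move=> t0; case: (leP t eps) => te; [left; rewrite t0|right].
    by case=> [/andP[]//|/(lt_trans e0)].
  rewrite integral_setU//; last 2 first.
  - by apply/measurable_EFinP/measurable_funTS.
  - rewrite disj_set2E; apply/eqP/seteqP; split=> // z [[_ h1] [_ h2]].
    move: h1 h2; rewrite /Bi /Be /= !in_itv/= andbT => /andP[_ h1] /(le_lt_trans h1).
    by rewrite ltxx.
  by rewrite fineD//; exact: integrable_fin_num.
have FvE : F v = (\int[mu]_(z in sec v Be) u (x + z)) * (2 * s * eps `^ (2 * s) / (C * area)).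
  exact: (mean_cone N2 hs hal heps _ v1).
have FnE : F (- v) = (\int[mu]_(z in sec v Be) u (x - z)) * (2 * s * eps `^ (2 * s) / (C * area)).
  rewrite (mean_cone N2 hs hal heps _ vN); congr (_ * _); rewrite /Rintegral.
  have oM : orthogonal ((-1)%:M : 'M[R]_N).
    by rewrite /orthogonal tr_scalar_mx -scalar_mxM mulrNN mulr1.
  have vM : v *m (-1)%:M = - v by rewrite mul_mx_scalar scaleN1r.
  rewrite -vM (integral_mu_s_orthogonal s01 oM); last 2 first.
  - by apply: measurable_sec.
  - by apply/measurable_EFinP/measurable_funTS.
  rewrite shell_orthogonal//; congr fine; apply: eq_integral => z _.
  by rewrite mul_mx_scalar scaleN1r.
have f0 := integral_enormX N2 s01 hal v1 mBe (tail_gt0 e0) (integral_tail_const hs e0).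
have cE : \int[mu]_(z in sec v Be) (- (2 * u x)) =
    - (2 * u x) * (C * area * (eps `^ (- (2 * s)) / (2 * s))).
  rewrite Rintegral_cst//; congr (_ * _).
  by rewrite -[LHS]/(fine (mu (sec v Be))) /Be -(cone_unbounded hal (ltW e0) v1) (mu_cone N2 hs hal heps v1).
have geE : \int[mu]_(z in sec v Be) g z = \int[mu]_(z in sec v Be) u (x + z) +
    \int[mu]_(z in sec v Be) u (x - z) - 2 * u x * (C * area * (eps `^ (- (2 * s)) / (2 * s))).
  by rewrite (RintegralD mSe iu12 ic) (RintegralD mSe iu1 iu2) cE mulNr.
have Ib : `|\int[mu]_(z in sec v Bi) g z| <=
    2 * K * (C * area * (eps `^ (2 - 2 * s) / (2 - 2 * s))).
  apply: le_trans (le_normr_Rintegral mSi igi) _.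
  have -> : 2 * K * (C * area * (eps `^ (2 - 2 * s) / (2 - 2 * s))) =
      \int[mu]_(z in sec v Bi) (2 * K * enorm z ^+ 2).
    by rewrite (RintegralZl _ mSi i2) /Rintegral I2.
  apply: le_Rintegral => //; exact: (integrable_abse igi).
rewrite LE geE FvE FnE.
set I := \int[mu]_(z in sec v Bi) g z in Ib *.
set A1 := \int[mu]_(z in _) _; set A2 := \int[mu]_(z in _) _.
have e2s : 0 < eps `^ (2 * s) by rewrite powR_gt0.
rewrite (_ : _ - _ = s / (C * area) * eps `^ (2 * s) * I); last first.
  by rewrite powRN; field; rewrite !gt_eqF//; lra.
have c0 : 0 <= s / (C * area) * eps `^ (2 * s).
  apply: mulr_ge0; last exact: ltW.
  by apply: divr_ge0; [lra|exact: ltW].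
rewrite normrM ger0_norm//; apply: le_trans (ler_wpM2l c0 Ib) _.
have -> : eps ^+ 2 = eps `^ (2 * s) * eps `^ (2 - 2 * s).
  rewrite -powRD; last by rewrite (gt_eqF e0) implybT.
  by rewrite (_ : 2 * s + (2 - 2 * s) = 2%:R); [rewrite powR_mulrn// ltW|ring].
rewrite le_eqVlt; apply/orP; left; apply/eqP; field.
by rewrite !gt_eqF//; lra.
Qed.

End operator_L.

(** * The asymptotic expansion *)

Theorem theorem3p1 (R : realType) (N : nat) (p s alpha : R)
    (u : 'rV[R]_N -> R) (x : 'rV[R]_N) (r : R)
    (hN : (2 <= N)%N) (hp : 2 <= p) (hs : 2^-1 < s < 1)
    (halpha : @is_alpha R N p alpha)
    (u_bounded : bounded_fun u) (u_borel : measurable_fun setT u)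
    (r_gt0 : 0 < r) (u_C2 : C2_ecball u x r) (grad_neq0 : gradient u x != 0)
    (u_ucont : @unif_continuous (subspace (~` ecball x r)) R u)
    (eps : R) (heps : 0 < eps < r) :
  let C := hessian_bound u x r in
  let m := m_eps p s u x r eps in
  `| Aeps alpha s eps u x - u x
     - s / (cNs N s * @cap_area R N alpha) * eps `^ (2 * s) * Lsp alpha s u x |
  <= s / (1 - s) * C * eps ^+ 2
     + eps `^ (2 * s)
       * (4 * s * C * ((r `^ (2 - 2 * s) - eps `^ (2 - 2 * s)) / (1 - s)) * m
          + (r `^ (- 2 * s) + 2 * s / (2 * s - 1) * r `^ (1 - 2 * s))
            * modulus u (~` ecball x r) m).
Proof.
lazy zeta; set K := hessian_bound u x r; set m := m_eps p s u x r eps.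
have N0 : (0 < N)%N by exact: leq_trans hN.
have [hal _] := halpha.
have [s_gt s_lt] := andP hs.
have [e0 er] := andP heps.
have s01 : 0 < s < 1 by rewrite s_lt andbT; lra.
have [area0 _] := cap_area_gt0 hN s01 hal hp halpha.
have [Mb u_bound] : exists Mb : R, forall z, `|u z| <= Mb.
  by have [M [_ MP]] := u_bounded; exists (M + 1) => z; apply: (MP (M + 1)); rewrite ?ltrDl.
have K0 : 0 <= K := hessian_bound_ge0 r_gt0 u_C2 N0.
set q := gradient u x.
have q0 : 0 < enorm q by rewrite enorm_gt0.
pose v := (enorm q)^-1 *: q.
have v1 : enorm v = 1 by exact: enorm_normalize.
have vN1 : enorm (- v) = 1 by rewrite enormN.
have qE : q = enorm q *: v by rewrite /v scalerA mulfV ?gt_eqF// scale1r.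
pose W := modulus u (~` ecball x r).
have W0 d : 0 <= d -> 0 <= W d by exact: (modulus_ge0 x N0 r_gt0 u_bound).
have Wm d d' : 0 <= d -> d <= d' -> W d <= W d' by exact: (le_modulus x N0 r_gt0 u_bound).
have Wfar d a b : r < enorm (a - x) -> r < enorm (b - x) -> enorm (a - b) <= d ->
    `|u a - u b| <= W d by move=> ar br ab; apply: (modulusP u_bound).
have near := fun z z' => @taylor_sphere R N u x r r_gt0 u_C2 z z' N0.
have kappa_ge d : 0 <= d <= 2 ->
     d ^+ 2 <= (N%:R + p - 2) / (p - 1) * (8 * W d / enorm q)
       * (((2 * s - 1) / (2 * s) * r `^ (- 2 * s) + r `^ (1 - 2 * s))
          / (eps `^ (1 - 2 * s) - r `^ (1 - 2 * s))) -> d <= m.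
  move=> d02 dk; rewrite /m /m_eps le_max; apply/orP; right.
  apply: ub_le_sup; first by exists 2 => t [/andP[]].
  by split.
have m0 : 0 <= m.
  apply: kappa_ge; first by rewrite lexx ler0n.
  have N2' : (2 : R) <= N%:R by rewrite ler_nat.
  have p2' : (2 : R) <= p := hp.
  have W00 := W0 0 (lexx 0).
  have er1 : r `^ (1 - 2 * s) <= eps `^ (1 - 2 * s).
    rewrite -[1 - 2 * s]opprB !powRN lef_pV2 ?posrE ?powR_gt0//.
    by apply: ge0_ler_powR; rewrite ?nnegrE ?ltW//; lra.
  rewrite expr0n/=; apply: mulr_ge0; apply: mulr_ge0.
  - by apply: divr_ge0; lra.
  - by apply: divr_ge0; [exact: mulr_ge0|exact: ltW].
  - apply: addr_ge0; last exact: powR_ge0.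
    by apply: mulr_ge0; [apply: divr_ge0; lra|exact: powR_ge0].
  - by rewrite invr_ge0 subr_ge0.
have mX : 16 * (N%:R + p - 2) / (p - 1) * (K / enorm q) * ((2 * s - 1) / (1 - s))
    * ((r `^ (2 - 2 * s) - eps `^ (2 - 2 * s)) / (eps `^ (1 - 2 * s) - r `^ (1 - 2 * s))) <= m.
  by rewrite /m /m_eps le_max lexx.
set E := 4 * s * K * _ * m + _.
pose F (f : 'rV[R]_N -> R) y := mean s (cone alpha eps%:E +oo%E y) (fun z => f (x + z)).
have upper y : enorm y = 1 -> F u y <= F u v + 2 * (eps `^ (2 * s) * E).
  move=> y1; apply: (mean_cone_le hN hs hal hp halpha heps u_borel u_bound v1 y1 q0 qE K0) => //.
  - by move=> z z' zr zz'; apply: le_trans (near z z' zr zz'); exact: ler_norm.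
  - by move=> d a b ar br ab; apply: le_trans (Wfar d a b ar br ab); exact: ler_norm.
(* The lower bound is the upper bound for - u, whose gradient is - q. *)
pose u' z := - u z.
have FN y : enorm y = 1 -> F u' y = - F u y.
  move=> y1; rewrite /F !(mean_cone hN hs hal heps _ y1) -mulNr; congr (_ * _).
  rewrite -mulN1r -RintegralZl.
  - by apply: eq_Rintegral => z _; rewrite mulN1r.
  - by apply: measurable_sec; exact: measurable_itv.
  - apply: (bounded_integrable_sec hN hs hal y1 e0) => //.
    by apply: (measurableT_comp u_borel); exact: measurable_rVD.
have lower y : enorm y = 1 -> F u (- v) - 2 * (eps `^ (2 * s) * E) <= F u y.
  move=> y1; have : F u' y <= F u' (- v) + 2 * (eps `^ (2 * s) * E).
    apply: (@mean_cone_le _ _ s alpha p eps r hN hs hal hp halpha heps u' x (- q) (- v) y Mb K m W) => //.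
    - rewrite (_ : u' = fun z => 0 - u z); first exact: measurable_funB.
      by apply/funext => z; rewrite sub0r.
    - by move=> z; rewrite /u' normrN.
    - by rewrite enormN.
    - by rewrite enormN scalerN -qE.
    - move=> z z' zr zz'; have := near z z' zr zz'; rewrite -/q -/K => nz.
      have := ler_norm (- (u (x + z') - u (x + z) - dotp (z' - z) q)).
      by rewrite normrN /u' dotpNr; lra.
    - move=> d a b ar br ab; apply: le_trans (Wfar d a b ar br ab).
      by rewrite /u' opprK addrC -(normrN (u a - u b)) opprB ler_norm.
    - by rewrite enormN.
    - by move=> d d02; rewrite enormN; exact: kappa_ge.
  by rewrite !FN//; lra.
set S := [set F u y | y in [set y | enorm y = 1]].
have Sv : S (F u v) by exists v.
have SN : S (F u (- v)) by exists (- v).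
have S_sup : F u v <= sup S <= F u v + 2 * (eps `^ (2 * s) * E).
  apply/andP; split.
    by apply: ub_le_sup => //; exists (F u v + 2 * (eps `^ (2 * s) * E)) => _ [y y1 <-]; exact: upper.
  by apply: ge_sup; [exists (F u v)|move=> _ [y y1 <-]; exact: upper].
have S_inf : F u (- v) - 2 * (eps `^ (2 * s) * E) <= inf S <= F u (- v).
  apply/andP; split.
    by apply: lb_le_inf; [exists (F u v)|move=> _ [y y1 <-]; exact: lower].
  by apply: ge_inf => //; exists (F u (- v) - 2 * (eps `^ (2 * s) * E)) => _ [y y1 <-]; exact: lower.
set L := Lsp alpha s u x.
have LE : `|s / (cNs N s * @cap_area R N alpha) * eps `^ (2 * s) * L
    - (2^-1 * (F u v + F u (- v)) - u x)| <= s / (1 - s) * K * eps ^+ 2.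
  exact: (Lsp_expansion hN hs hal heps u_borel u_bound v1 area0
    (fun z => @second_difference_le R N u x r r_gt0 u_C2 z N0)).
rewrite -[Aeps _ _ _ _ _]/(2^-1 * (sup S + inf S)).
move: LE S_sup S_inf; rewrite !ler_norml => /andP[L1 L2] /andP[p1 p2] /andP[i1 i2].
move: L1 L2 p1 p2 i1 i2; clear.
move: (sup S) (inf S) (F u v) (F u (- v)) (eps `^ (2 * s) * E) (s / (1 - s) * K * eps ^+ 2)
  (s / (cNs N s * cap_area alpha) * eps `^ (2 * s) * L) (u x) => *.
by apply/andP; split; lra.
Qed.
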